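(* Let $\mathbb{Q}$ be a bounded signed measure and $\mathbf{P}$ a probability measure with $\mathbb{Q}\ll\mathbf{P}$, let $D$ be the density process of $\mathbb{Q}$ with respect to $\mathbf{P}$, and let $M=m+v$ be a $\mathbf{P}$-semimartingale ($m$ the $\mathbf{P}$-local martingale part, $v$ the finite variation part). Then $M$ is a $(\mathbb{Q},\mathbf{P})$-local martingale if and only if $$\int_{0}^{t}D_{s}\,dv_{s}+\langle M,D\rangle_{t}=0\qquad\text{for all }t\geq 0.$$
   Context: Setting: $(\Omega,\mathcal{F}_\infty,\mathbb{Q})$ is a measure space with $\mathbb{Q}$ a bounded signed measure; $\mathbf{P}$ is a probability measure on $\mathcal{F}_\infty$ with $\mathbb{Q}\ll\mathbf{P}$; $(\mathcal{F}_t)_{t\ge0}$ is a right-continuous filtration completed with respect to $\mathbf{P}$ with $\mathcal{F}_\infty=\bigvee_t\mathcal{F}_t$. $D_t=\frac{d\mathbb{Q}}{d\mathbf{P}}\big|_{\mathcal{F}_t}$, a uniformly integrable $\mathbf{P}$-martingale with limit $D_\infty$. Standing assumptions: $D$ is continuous and $\mathbf{P}(D_\infty=0)=0$. An $(\mathcal{F}_t)$-adapted process $M$ is a $(\mathbb{Q},\mathbf{P})$-martingale (resp. uniformly integrable martingale, local martingale) if $M$ is a $\mathbf{P}$-semimartingale and $MD$ is a $\mathbf{P}$-martingale (resp. uniformly integrable $\mathbf{P}$-martingale, $\mathbf{P}$-local martingale).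
   Formalization: The decomposition M = m + v is taken to be the canonical one (v predictable, null at 0); for an arbitrary finite variation part the claim fails, e.g. D = 1, m = 0, M = v a compensated Poisson process. *)

(* Defs.v *)
From HB Require Import structures.
From mathcomp Require Import all_boot all_order all_algebra.
From mathcomp Require Import all_classical all_reals all_analysis.

(* MathComp-Analysis, over an arbitrary R : realType.
   A process is a function X : R -> T -> R (time first); only its values at
   times t >= 0 are meaningful.  Path properties (cadlag, continuity, finite
   variation) are required of every path. *)

Set Implicit Arguments.
Unset Strict Implicit.
Unset Printing Implicit Defensive.

Import Order.TTheory GRing.Theory Num.Theory.
Import numFieldNormedType.Exports.

Local Open Scope classical_set_scope.
Local Open Scope ring_scope.

Section Processes.
Context {R : realType} {d : measure_display} {T : measurableType d}.
Variables (P : probability T R) (F : R -> set (set T)).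
Implicit Types (X Y M D C m v : R -> T -> R) (tau : T -> \bar R).

(* Filtration satisfying the usual conditions; the measurable sets of T are
   exactly those of F_oo, the sigma-algebra generated by the F t. *)
Definition usual_filtration : Prop :=
  [/\ forall t, 0 <= t -> sigma_algebra setT (F t),
      forall s t, 0 <= s -> s <= t -> F s `<=` F t,
      forall t, 0 <= t -> \bigcap_(s in [set s | t < s]) F s `<=` F t,
      forall N, P.-negligible N -> F 0 N
    & @measurable d T = <<s \bigcup_(t in [set t | 0 <= t]) F t >> ].

Definition adapted X : Prop :=
  forall t, 0 <= t -> forall B : set R, measurable B -> F t (X t @^-1` B).

Definition cadlag X : Prop := forall w t, 0 <= t ->
  (X s w @[s --> t^'+] --> X t w) /\ (0 < t -> cvg (X s w @[s --> t^'-])).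

Definition continuous_process X : Prop :=
  forall w, {within `[0, +oo[, continuous (fun t => X t w)}.

Definition martingale X : Prop :=
  [/\ adapted X,
      forall t, 0 <= t -> P.-integrable setT (EFin \o X t)
    & forall s t A, 0 <= s -> s <= t -> F s A ->
        (\int[P]_(w in A) (X t w)%:E = \int[P]_(w in A) (X s w)%:E)%E].

Definition stopping_time tau : Prop :=
  (forall w, (0 <= tau w)%E) /\
  (forall t, 0 <= t -> F t [set w | (tau w <= t%:E)%E]).

(* The process X^tau 1_{tau > 0}. *)
Definition stopped X tau : R -> T -> R := fun t w =>
  if (0 < tau w)%E then X (fine (mine t%:E (tau w))) w else 0.

(* The factor 1_{tau > 0} in the stopped process means that no integrability
   of X 0 is required. *)
Definition local_martingale X : Prop :=
  [/\ adapted X, cadlag X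
    & exists tau : nat -> T -> \bar R,
      [/\ forall n, stopping_time (tau n),
          forall w, nondecreasing_seq (fun n => tau n w),
          {ae P, forall w, tau n w @[n --> \oo] --> +oo%E}
        & forall n, martingale (stopped X (tau n))]].

Definition finite_variation_process v : Prop :=
  [/\ adapted v, cadlag v, forall w, v 0 w = 0
    & forall w t, 0 <= t -> bounded_variation 0 t (fun s => v s w)].

Definition predictable_rectangle : set (set (R * T)) :=
  [set E | (exists2 A, F 0 A & E = [set 0] `*` A) \/
           (exists s t A, [/\ 0 <= s, s <= t, F s A & E = `]s, t] `*` A])].

Definition predictable X : Prop :=
  let E := [set z : R * T | 0 <= z.1] in
  forall B : set R, measurable B ->
    <<s E, predictable_rectangle >> (E `&` [set z | B (X z.1 z.2)]).

Definition semimartingale M : Prop :=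
  exists m v, [/\ local_martingale m, finite_variation_process v
                & forall t w, 0 <= t -> M t w = m t w + v t w].

(* Predictability of the finite variation part is what makes the local
   martingale part and the finite variation part of M well defined (up to
   indistinguishability).  For a continuous M it amounts to continuity of v. *)
Definition canonical_decomposition M m v : Prop :=
  [/\ local_martingale m, finite_variation_process v, predictable v
    & forall t w, 0 <= t -> M t w = m t w + v t w].

(* C is (a version of) <X, Y>: the bracket of the local martingale parts of X
   and Y, i.e. the predictable finite variation process C, null at 0, such
   that m n - C is a local martingale.  If X and Y both had jumps, other
   conventions would also count the common jumps of their finite variation
   parts; the notions agree when X or Y is continuous. *)
Definition angle_bracket X Y C : Prop :=
  exists m v n w,
    [/\ canonical_decomposition X m v, canonical_decomposition Y n w,
        finite_variation_process C, predictable C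
      & local_martingale (fun t o => m t o * n t o - C t o)].

(* D t is the density of Q with respect to P on F t. *)
Definition density_process (Q : {charge set T -> \bar R}) D : Prop :=
  adapted D /\
  forall t, 0 <= t -> P.-integrable setT (EFin \o D t) /\
    forall A, F t A -> (Q A = \int[P]_(w in A) (D t w)%:E)%E.

(* (Q, P)-local martingale, where D is the density process of Q. *)
Definition QP_local_martingale D M : Prop :=
  semimartingale M /\ local_martingale (fun t w => M t w * D t w).

End Processes.

Section Stieltjes.
Context {R : realType}.
Implicit Types (g v : R -> R) (t I : R).

(* Lebesgue-Stieltjes integral of g over ]0, t] against a right-continuous
   function v of bounded variation on [0, t], written there as v 0 plus a
   difference of two nondecreasing right-continuous functions; the value does
   not depend on the choice of the two functions. *)
Definition is_stieltjes_integral g v t I : Prop :=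
  exists a b : cumulative R R,
    [/\ forall s, 0 <= s <= t -> v s - v 0 = a s - b s,
        (lebesgue_stieltjes_measure a).-integrable `]0, t] (EFin \o g),
        (lebesgue_stieltjes_measure b).-integrable `]0, t] (EFin \o g)
      & I = Rintegral (lebesgue_stieltjes_measure a) `]0, t] g
            - Rintegral (lebesgue_stieltjes_measure b) `]0, t] g].

Definition stieltjes_integral g v t : R :=
  xget 0 [set I | is_stieltjes_integral g v t I].

End Stieltjes.

(* Main.v *)
(* With A = int D dv + <M, D>, write on [0, +oo[
     M D = (m D - <M, D>) + (v D - int D dv) + A.
   Both brackets are local martingales: the first by the definition of <M, D>
   and the uniqueness of canonical decompositions, the second because v D -
   int D dv is the limit of the martingale sums of v against the increments of
   D, uniformly bounded up to a localizing time.  So M D is a local martingale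
   iff A is, and as A is predictable of finite variation this means A = 0 a.s.

   That a predictable martingale A = a - b of integrable variation vanishes is
   seen on the Doleans measures P(dw) da(w) and P(dw) db(w), which agree on
   predictable sets: for phi x = x^2 / (1 + x^2), E phi(A_t) is the integral
   against their difference of a bounded predictable process. *)

Require Import Defs.
From HB Require Import structures.
From mathcomp Require Import all_boot all_order all_algebra.
From mathcomp Require Import all_classical all_reals all_analysis.
From mathcomp Require Import measurable_realfun.
From mathcomp Require Import ring lra.

Set Implicit Arguments.
Unset Strict Implicit.
Unset Printing Implicit Defensive.

Import Order.TTheory GRing.Theory Num.Theory.
Import numFieldNormedType.Exports.

Local Open Scope classical_set_scope.
Local Open Scope ring_scope.

(** * Expectations and uniform integrability *)

(** Martingales are tested on events of the past, without conditional expectations, and each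
    continuous-time statement is a limit of finite sums over uniform grids.

    Jumps shape the argument. [A] may jump at the time where its variation is cut, so localization
    gives integrable variation but, a priori, no second moment: this is why [phi] is bounded. Its
    difference quotient involves both the left limit [A_{s-}] and the value [A_s]; predictability of
    [A] makes the dependence on [A_s] admissible. The Doleans measures agree because the martingale
    identity on an event of [F s] is their equality on a rectangle over that event.

    For [v D - int D dv], a jump of [v] at the localizing time is harmless: the sums read [v] at the
    left end of each cell, so its value at that time meets no increment of the stopped [D].
    Continuity of [D] serves twice: it bounds [D] up to and including that time, and it makes sums
    with [D] at right ends converge to the Stieltjes integral. *)

Section expectation.
Context {d : measure_display} {T : measurableType d} {R : realType}.
Variable mu : {measure set T -> \bar R}.
Implicit Types (f g : T -> R) (A B : set T).

Definition L1 f := mu.-integrable setT (EFin \o f).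

Definition expect f : R := Rintegral mu setT f.

Lemma expectE f : L1 f -> (expect f)%:E = (\int[mu]_x (f x)%:E)%E.
Proof. by move=> f1; rewrite fineK //; exact: integrable_fin_num f1. Qed.

Lemma eq_expect f g : f =1 g -> expect f = expect g.
Proof. by move=> /funext->. Qed.

Lemma L1_measurable f : L1 f -> measurable_fun setT f.
Proof. by move=> /integrableP[] /measurable_EFinP. Qed.

Lemma L1_le f g : measurable_fun setT f -> L1 g ->
  (forall x, `|f x| <= `|g x|) -> L1 f.
Proof.
move=> mf g1 fg; apply: (le_integrable _ _ _ g1) => //.
  exact/measurable_EFinP.
by move=> x _ /=; rewrite lee_fin.
Qed.

Lemma L1D f g : L1 f -> L1 g -> L1 (fun x => f x + g x).
Proof. by move=> f1 g1; have := integrableD measurableT f1 g1; apply: eq_integrable. Qed.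

Lemma L1Z k f : L1 f -> L1 (fun x => k * f x).
Proof. by move=> f1; have := integrableZl measurableT k f1; apply: eq_integrable. Qed.

Lemma L1N f : L1 f -> L1 (fun x => - f x).
Proof. by move=> f1; have := integrableN f1; apply: eq_integrable. Qed.

Lemma L1B f g : L1 f -> L1 g -> L1 (fun x => f x - g x).
Proof. by move=> f1 g1; apply: L1D => //; exact: L1N. Qed.

Lemma L1_norm f : L1 f -> L1 (fun x => `|f x|).
Proof.
move=> f1; apply: (L1_le _ f1) => [|x]; last by rewrite normr_id.
by apply: measurableT_comp => //; exact: L1_measurable.
Qed.

Lemma L1_0 : L1 (fun=> 0).
Proof. exact: integrable0. Qed.

Lemma L1_sum (I : Type) (r : seq I) (F : I -> T -> R) :
  (forall i, L1 (F i)) -> L1 (fun x => \sum_(i <- r) F i x).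
Proof.
move=> F1; elim: r => [|i r ih].
  by under eq_fun do rewrite big_nil; exact: L1_0.
by under eq_fun do rewrite big_cons; exact: L1D.
Qed.

Lemma L1_indic f A : measurable A -> L1 f -> L1 (fun x => f x * \1_A x).
Proof.
move=> mA f1; apply: (L1_le _ f1) => [|x].
  by apply: measurable_funM; [exact: L1_measurable|exact: measurable_indic].
by rewrite normrM indicE; case: (_ \in _); rewrite /= ?normr1 ?normr0 ?mulr1 ?mulr0.
Qed.

Lemma expectD f g : L1 f -> L1 g ->
  expect (fun x => f x + g x) = expect f + expect g.
Proof. by move=> f1 g1; rewrite /expect RintegralD. Qed.

Lemma expectZ k f : L1 f -> expect (fun x => k * f x) = k * expect f.
Proof. by move=> f1; rewrite /expect RintegralZl. Qed.

Lemma expectB f g : L1 f -> L1 g ->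
  expect (fun x => f x - g x) = expect f - expect g.
Proof. by move=> f1 g1; rewrite /expect RintegralB. Qed.

Lemma expect0 : expect (fun=> 0) = 0.
Proof. by rewrite /expect /Rintegral integral0. Qed.

Lemma expect_sum (I : Type) (r : seq I) (F : I -> T -> R) :
  (forall i, L1 (F i)) ->
  expect (fun x => \sum_(i <- r) F i x) = \sum_(i <- r) expect (F i).
Proof.
move=> F1; elim: r => [|i r ih].
  by under eq_expect do rewrite big_nil; rewrite expect0 big_nil.
under eq_expect do rewrite big_cons.
by rewrite big_cons expectD ?ih//; exact: L1_sum.
Qed.

Lemma le_expect f g : L1 f -> L1 g -> (forall x, f x <= g x) ->
  expect f <= expect g.
Proof. by move=> f1 g1 fg; apply: le_Rintegral. Qed.

Lemma norm_expect f : L1 f -> `|expect f| <= expect (fun x => `|f x|).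
Proof. by move=> f1; apply: le_normr_Rintegral. Qed.

Lemma integral_indic_expect f A : measurable A -> L1 f ->
  (\int[mu]_(x in A) (f x)%:E)%E = (expect (fun x => f x * \1_A x))%:E.
Proof.
move=> mA f1; rewrite expectE; last exact: L1_indic.
rewrite integral_mkcond; apply: eq_integral => x _.
by rewrite patchE indicE; case: (_ \in _); rewrite /= ?mulr1 ?mulr0.
Qed.

Lemma expect_dct (F : nat -> T -> R) f g :
  (forall n, measurable_fun setT (F n)) -> L1 g ->
  (forall x, (F n x) @[n --> \oo] --> f x) ->
  (forall n x, `|F n x| <= g x) ->
  L1 f /\ (expect (F n) @[n --> \oo] --> expect f).
Proof.
move=> mF g1 Ff Fg.
have mf : measurable_fun setT f by apply: (measurable_fun_cvg mF) => x _; exact: Ff.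
have [] := @dominated_convergence _ _ _ mu setT measurableT
  (fun n x => (F n x)%:E) (EFin \o f) (EFin \o g).
- by move=> n; exact/measurable_EFinP.
- exact/measurable_EFinP.
- by apply: aeW => x _; apply: cvg_EFin; [exact: nearW|exact: Ff].
- exact: g1.
- by apply: aeW => x n _ /=; rewrite lee_fin.
move=> f1 _ cF; split => //; apply: fine_cvg.
rewrite expectE//; apply: cvg_trans cF.
Qed.

(** Fatou's lemma, for sequences with bounded norms but no integrable majorant at hand. *)
Lemma L1_fatou (F : nat -> T -> R) f (K : R) :
  (forall n, L1 (F n)) -> (forall x, (F n x) @[n --> \oo] --> f x) ->
  (forall n, expect (fun x => `|F n x|) <= K) ->
  L1 f.
Proof.
move=> F1 Ff FK.
have mF n : measurable_fun setT (F n) by exact: L1_measurable.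
have mf : measurable_fun setT f by apply: (measurable_fun_cvg mF) => x _; exact: Ff.
have cF x : ((`|F n x|)%:E @[n --> \oo] --> (`|f x|)%:E)%E.
  by apply: cvg_EFin; [exact: nearW|apply: cvg_norm; exact: Ff].
apply/integrableP; split; first exact/measurable_EFinP.
have H := @fatou _ _ _ mu setT measurableT (fun n x => (`|F n x|)%:E) _ _.
apply: (@le_lt_trans _ _ K%:E); last by rewrite ltry.
have -> : (\int[mu]_x `|(EFin \o f) x|)%E =
    (\int[mu]_x limn_einf (fun n => (`|F n x|)%:E))%E.
  by apply: eq_integral => x _; have [-> _] := cvg_limn_einf_sup (cF x).
apply: le_trans; first apply: H.
- move=> n; apply/measurable_EFinP; apply: measurableT_comp => //.
- by move=> n x _; rewrite lee_fin.
rewrite limn_einf_lim; apply: lime_le; first exact: is_cvg_einfs.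
apply: nearW => n; apply: le_trans (_ : (\int[mu]_x (`|F n x|)%:E <= _)%E).
  by apply: ereal_inf_lbound; exists n => /=.
by rewrite -expectE ?lee_fin//; exact: L1_norm.
Qed.

End expectation.

Lemma cvg_le_dist (R : realType) (S : Type) (F : set_system S) (FF : Filter F)
    (u b : S -> R) l :
  (forall n, `|u n - l| <= b n) -> b n @[n --> F] --> 0 -> u n @[n --> F] --> l.
Proof.
move=> ulb b0; apply/cvgrPdist_le => e e0.
near=> n; rewrite distrC (le_trans (ulb n))//.
have : `|b n| <= e by near: n; move/cvgr0Pnorm_le : b0; exact.
by apply: le_trans; exact: ler_norm.
Unshelve. all: by end_near. Qed.

Section uniform_integrability.
Context {d : measure_display} {T : measurableType d} {R : realType}.
Variable mu : {measure set T -> \bar R}.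
Hypothesis muT : (mu setT < +oo)%E.
Implicit Types (f g : T -> R) (A B : set T).

Lemma L1_bounded f (K : R) : measurable_fun setT f -> (forall x, `|f x| <= K) ->
  L1 mu f.
Proof.
move=> mf fK; apply: (@L1_le _ _ _ mu f (cst K)) => //.
  apply/integrableP; split; first exact/measurable_EFinP.
  rewrite (_ : (fun x => _) = cst (`|K|%:E)) ?integral_cst//.
  by rewrite lte_mul_pinfty.
by move=> x; rewrite (le_trans (fK x))// ler_norm.
Qed.

(** A continuous truncation: unlike a cut-off by an indicator, it commutes with pointwise limits, so
    truncated expectations converge by bounded convergence. *)
Definition clamp (k x : R) : R := Num.max (- k) (Num.min k x).

Lemma norm_clamp k x : 0 <= k -> `|clamp k x| <= k.
Proof.
move=> k0; rewrite ler_norml /clamp ge_max le_max ge_min lexx /=.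
by rewrite lexx /= andbT; lra.
Qed.

Lemma clamp_id k x : `|x| <= k -> clamp k x = x.
Proof.
rewrite ler_norml => /andP[kx xk].
by rewrite /clamp min_r// max_r.
Qed.

Lemma norm_clamp_le k x : 0 <= k -> `|clamp k x| <= `|x|.
Proof.
move=> k0; have [xk|kx] := leP `|x| k; first by rewrite clamp_id.
by rewrite (le_trans (norm_clamp _ _))// ltW.
Qed.

Lemma clampE k x : 0 <= k ->
  clamp k x = if k < x then k else if x < - k then - k else x.
Proof.
move=> k0; rewrite /clamp; case: ifPn => [kx|]; last rewrite -leNgt => xk.
  by rewrite min_l ?(ltW kx)// max_r//; lra.
rewrite min_r//; case: ifPn => [xk'|]; first by rewrite max_l// ltW.
by rewrite -leNgt => ?; rewrite max_r.
Qed.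

Lemma clamp_lip k x y : 0 <= k -> `|clamp k x - clamp k y| <= `|x - y|.
Proof.
move=> k0; rewrite ler_norml !clampE//.
have := ler_norm (x - y); have := ler_norm (y - x); rewrite (distrC y) => ? ?.
do !(case: ifPn; rewrite -?leNgt => ?); lra.
Qed.

Lemma norm_sub_clamp k x : 0 <= k -> `|x - clamp k x| <= `|x|.
Proof.
move=> k0; rewrite clampE//; have := ler_norm x; have := ler_norm (- x).
by rewrite normrN ler_norml => ? ?; do !(case: ifPn; rewrite -?leNgt => ?); lra.
Qed.

Lemma clamp_cvg (u : nat -> R) l k : 0 <= k ->
  u n @[n --> \oo] --> l -> clamp k (u n) @[n --> \oo] --> clamp k l.
Proof.
move=> k0 ul; apply: (@cvg_le_dist _ _ _ _ _ (fun n => `|u n - l|)).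
  by move=> n; exact: clamp_lip.
by rewrite -(normr0 R) -(subrr l); apply: cvg_norm; apply: cvgB => //; exact: cvg_cst.
Qed.

Lemma measurable_clamp k f : measurable_fun setT f ->
  measurable_fun setT (fun x => clamp k (f x)).
Proof.
move=> mf; apply: measurable_maxr; first exact: measurable_cst.
by apply: measurable_minr => //; exact: measurable_cst.
Qed.

Lemma clamp_near_id (x : R) : clamp n%:R x @[n --> \oo] --> x.
Proof.
apply: cvg_trans (_ : (fun=> x) n @[n --> \oo] --> x); last exact: cvg_cst.
apply: near_eq_cvg; near=> n; rewrite clamp_id//.
by near: n; exact: nbhs_infty_ger.
Unshelve. all: by end_near. Qed.

Lemma measurable_norm_gt f (c : R) : measurable_fun setT f ->
  measurable [set x | c < `|f x|].
Proof.
move=> mf; have mnf : measurable_fun setT (fun x => `|f x|) by exact: measurableT_comp.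
have := mnf measurableT _ (measurable_itv `]c, +oo[).
by rewrite setTI; congr measurable; apply/seteqP; split => x /=; rewrite in_itv/= andbT.
Qed.

(** Truncation at level [k] changes [expect (Y n)] by at most the integral of [|Z|] over [A k], the
    event that some [|Y n|] exceeds [k]. This bound is uniform in [n], and it vanishes as [k] grows
    because convergent sequences are bounded. Domination of tails by one integrable [Z] thus takes
    the place of uniform integrability. *)
Lemma expect_uniformly_dominated (Y : nat -> T -> R) y Z e :
  L1 mu Z -> (forall n, L1 mu (Y n)) ->
  (forall x, Y n x @[n --> \oo] --> y x) ->
  (forall n c, 0 <= c -> expect mu (fun x => `|Y n x| * \1_[set x | c < `|Y n x|] x)
     <= expect mu (fun x => `|Z x| * \1_[set x | c < `|Y n x|] x)) ->
  (forall n, expect mu (Y n) = e) ->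
  L1 mu y /\ expect mu y = e.
Proof.
move=> Z1 Y1 Yy YZ Ye.
have mY n : measurable_fun setT (Y n) by exact: L1_measurable (Y1 n).
have mYc n c : measurable [set x | c < `|Y n x|] by exact: measurable_norm_gt.
have nZ1 := L1_norm Z1.
have y1 : L1 mu y.
  (* The tail bound at [c = 0] bounds the norm of [Y n] by that of [Z]. *)
  apply: (L1_fatou (K := expect mu (fun x => `|Z x|)) Y1 Yy) => n.
  rewrite (@eq_expect _ _ _ _ _ (fun x => `|Y n x| * \1_[set x | 0 < `|Y n x|] x)).
    apply: (le_trans (YZ n 0 _)) => //.
    apply: le_expect => //; first exact: L1_indic.
    by move=> x; rewrite indicE; case: (_ \in _); rewrite ?mulr1 ?mulr0.
  move=> x; rewrite indicE; case: (boolP (x \in _)); rewrite /= ?mulr1//.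
  rewrite notin_setE/= mulr0 => /negP; rewrite -leNgt => Y0.
  by apply/eqP; rewrite eq_le Y0 normr_ge0.
split => //.
pose A k := \bigcup_n [set x | k%:R < `|Y n x|].
have mA k : measurable (A k) by apply: bigcupT_measurable => n; exact: mYc.
have mcl k n : measurable_fun setT (fun x => clamp k%:R (Y n x)).
  exact: measurable_clamp.
have cl1 k n : L1 mu (fun x => clamp k%:R (Y n x)).
  by apply: (@L1_bounded _ k%:R) => // x; exact: norm_clamp.
have cly k : expect mu (fun x => clamp k%:R (Y n x)) @[n --> \oo] -->
    expect mu (fun x => clamp k%:R (y x)).
  apply: (proj2 (@expect_dct _ _ _ mu _ _ (cst k%:R) _ _ _ _)) => //.
  - by apply: (@L1_bounded _ k%:R) => // x; rewrite ger0_norm.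
  - by move=> x; apply: clamp_cvg => //; exact: Yy.
  - by move=> n x; exact: norm_clamp.
have clYn k n : `|expect mu (fun x => clamp k%:R (Y n x)) - e| <=
    expect mu (fun x => `|Z x| * \1_(A k) x).
  rewrite -(Ye n) -expectB//; apply: (le_trans (norm_expect _)); first exact: L1B.
  apply: (@le_trans _ _ (expect mu (fun x => `|Y n x| * \1_[set x | k%:R < `|Y n x|] x))).
    apply: le_expect; first exact/L1_norm/L1B.
      by apply: L1_indic => //; exact: L1_norm.
    move=> x; rewrite indicE; case: (boolP (x \in _)) => /=.
      by move=> _; rewrite mulr1 distrC; exact: norm_sub_clamp.
    by rewrite notin_setE/= mulr0 => /negP; rewrite -leNgt => /clamp_id->; rewrite subrr normr0.
  apply: (le_trans (YZ n k%:R _)) => //; apply: le_expect; [exact: L1_indic..|].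
  move=> x; rewrite ler_wpM2l// !indicE; case: (boolP (x \in [set _ | _])) => //.
  rewrite inE/= => Yx; rewrite mem_set//; by exists n.
have clyk k : `|expect mu (fun x => clamp k%:R (y x)) - e| <=
    expect mu (fun x => `|Z x| * \1_(A k) x).
  have : `|expect mu (fun x => clamp k%:R (Y n x)) - e| @[n --> \oo] -->
      `|expect mu (fun x => clamp k%:R (y x)) - e|.
    by apply: cvg_norm; apply: cvgB; [exact: cly|exact: cvg_cst].
  move=> /cvg_lim <- //; apply: limr_le; last exact: nearW.
  apply/cvg_ex; exists (`|expect mu (fun x => clamp k%:R (y x)) - e|).
  by apply: cvg_norm; apply: cvgB; [exact: cly|exact: cvg_cst].
have ZA0 : expect mu (fun x => `|Z x| * \1_(A k) x) @[k --> \oo] --> 0.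
  rewrite -(expect0 mu).
  apply: (proj2 (@expect_dct _ _ _ mu _ _ (fun x => `|Z x|) _ _ _ _)) => //.
  - by move=> n; exact: (L1_measurable (L1_indic (mA n) nZ1)).
  - move=> x; have /cvg_seq_bounded [M [_ /(_ (M + 1))]] : cvgn (fun n => Y n x).
      by apply/cvg_ex; exists (y x); exact: Yy.
    rewrite ltrDl ltr01 => /(_ isT) YM.
    apply: cvg_trans (_ : (fun=> 0) n @[n --> \oo] --> (0 : R)); last exact: cvg_cst.
    apply: near_eq_cvg; near=> k; rewrite indicE memNset ?mulr0//.
    move=> [n _ /=]; apply/negP; rewrite -leNgt (le_trans (YM n _))//.
    by near: k; exact: nbhs_infty_ger.
  - move=> n x; rewrite normrM normr_id indicE.
    by case: (_ \in _); rewrite /= ?normr1 ?normr0 ?mulr1 ?mulr0.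
have cy : expect mu (fun x => clamp k%:R (y x)) @[k --> \oo] --> expect mu y.
  apply: (proj2 (@expect_dct _ _ _ mu _ _ (fun x => `|y x|) _ _ _ _)) => //.
  - by move=> n; apply: measurable_clamp; exact: L1_measurable y1.
  - exact: L1_norm.
  - by move=> x; exact: clamp_near_id.
  - by move=> n x; exact: norm_clamp_le.
apply: (cvg_unique _ cy) => //; exact: cvg_le_dist ZA0.
Unshelve. all: by end_near. Qed.

End uniform_integrability.

(** * Filtrations and optional stopping *)

Section grid.
Context {R : realType}.
Implicit Types (s t x : R) (f : R -> R) (n i : nat).

Definition grid n i : R := i%:R / n.+1%:R.

Definition grid_index n s : nat := `|Num.ceil (s * n.+1%:R)|%N.

(* [lgrid n s < s <= rgrid n s] for [0 < s]; the truncated predecessor makes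
   [lgrid n 0 = 0]. *)
Definition rgrid n s := grid n (grid_index n s).

Definition lgrid n s := grid n (grid_index n s).-1.

Lemma grid_ge0 n i : 0 <= grid n i.
Proof. by rewrite divr_ge0. Qed.

Lemma grid0 n : grid n 0 = 0.
Proof. by rewrite /grid mul0r. Qed.

Lemma le_grid n i j : (grid n i <= grid n j) = (i <= j)%N.
Proof. by rewrite /grid ler_pM2r ?invr_gt0// ler_nat. Qed.

(** A Galois connection between times and indices; comparisons of times with grid points are reduced
    to it or to its strict form. *)
Lemma grid_index_le n s i : 0 <= s -> (grid_index n s <= i)%N = (s <= grid n i).
Proof.
move=> s0; rewrite /grid ler_pdivlMr// /grid_index.
have c0 : 0 <= Num.ceil (s * n.+1%:R).
  by rewrite ceil_ge0 (lt_le_trans _ (mulr_ge0 s0 _)).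
by rewrite -lez_nat gez0_abs// ceil_le_int.
Qed.

Lemma grid_index_gt n s i : 0 <= s -> (i < grid_index n s)%N = (grid n i < s).
Proof. by move=> s0; rewrite ltnNge [RHS]ltNge -(grid_index_le _ _ s0). Qed.

Lemma grid_index_gt0 n s : 0 < s -> (0 < grid_index n s)%N.
Proof. by move=> s0; rewrite grid_index_gt ?ltW// grid0. Qed.

Lemma le_grid_index n s t : 0 <= s -> s <= t -> (grid_index n s <= grid_index n t)%N.
Proof.
by move=> s0 st; rewrite grid_index_le// (le_trans st)// -grid_index_le// (le_trans s0).
Qed.

Lemma rgrid_ge n s : 0 <= s -> s <= rgrid n s.
Proof. by move=> s0; rewrite -grid_index_le. Qed.

Lemma lgrid_ge0 n s : 0 <= lgrid n s.
Proof. exact: grid_ge0. Qed.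

Lemma lgrid_lt n s : 0 < s -> lgrid n s < s.
Proof.
by move=> s0; rewrite /lgrid -grid_index_gt ?ltW// prednK// grid_index_gt0.
Qed.

Lemma lgrid0 n : lgrid n 0 = 0.
Proof.
rewrite /lgrid (_ : grid_index n 0 = 0)%N ?grid0//.
by apply/eqP; rewrite -leqn0 grid_index_le// grid0.
Qed.

Lemma rgrid_lgrid n s : 0 < s -> rgrid n s = lgrid n s + n.+1%:R^-1.
Proof.
move=> s0; rewrite /rgrid /lgrid /grid -{1}(prednK (grid_index_gt0 n s0)).
by rewrite -natr1 mulrDl mul1r.
Qed.

Lemma rgrid_le n s : 0 <= s -> rgrid n s <= s + n.+1%:R^-1.
Proof.
rewrite le_eqVlt => /predU1P[<-|s0]; last by rewrite rgrid_lgrid// lerD2r ltW// lgrid_lt.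
rewrite /rgrid (_ : grid_index n 0 = 0)%N ?grid0 ?add0r//.
by apply/eqP; rewrite -leqn0 grid_index_le// grid0.
Qed.

Lemma lgrid_ge n s : 0 <= s -> s - n.+1%:R^-1 <= lgrid n s.
Proof.
rewrite le_eqVlt => /predU1P[<-|s0]; first by rewrite lgrid0 sub0r oppr_le0.
by rewrite lerBlDr -rgrid_lgrid// rgrid_ge// ltW.
Qed.

Lemma cvg_rgrid s : 0 <= s -> rgrid n s @[n --> \oo] --> s.
Proof.
move=> s0; apply: (@cvg_le_dist _ _ _ _ _ (@harmonic R)); last exact: cvg_harmonic.
move=> n; rewrite ger0_norm ?subr_ge0 ?rgrid_ge// lerBlDl; exact: rgrid_le.
Qed.

Lemma cvg_lgrid s : 0 <= s -> lgrid n s @[n --> \oo] --> s.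
Proof.
move=> s0; apply: (@cvg_le_dist _ _ _ _ _ (@harmonic R)); last exact: cvg_harmonic.
move=> n; have := lgrid_ge n s0.
rewrite le_eqVlt in s0; case/predU1P: s0 => [<-|s0].
  by rewrite lgrid0 subrr normr0 /harmonic /= => _; rewrite invr_ge0.
by rewrite ltr0_norm ?subr_lt0 ?lgrid_lt// opprB lerBlDr -lerBlDl.
Qed.

(** The sequence may take the value [s], since the right limit is [f s] itself. A left limit may
    differ from [f s], hence the strict inequality in [cvg_at_left_seq]. *)
Lemma cvg_at_right_seq f s (u : nat -> R) :
  f x @[x --> s^'+] --> f s -> (forall n, s <= u n) ->
  u n @[n --> \oo] --> s -> f (u n) @[n --> \oo] --> f s.
Proof.
move=> /cvgrPdist_le fs su us; apply/cvgrPdist_le => e e0.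
have [r /= r0 H] := fs e e0.
move/cvgrPdist_lt : us => /(_ r r0) us.
near=> n; have := su n; rewrite le_eqVlt => /predU1P[<-|sun].
  by rewrite subrr normr0 ltW.
by apply: H => //=; near: n.
Unshelve. all: by end_near. Qed.

Lemma cvg_at_left_seq f s (l : R) (u : nat -> R) :
  f x @[x --> s^'-] --> l -> (forall n, u n < s) ->
  u n @[n --> \oo] --> s -> f (u n) @[n --> \oo] --> l.
Proof.
move=> /cvgrPdist_le fs su us; apply/cvgrPdist_le => e e0.
have [r /= r0 H] := fs e e0.
move/cvgrPdist_lt : us => /(_ r r0) us.
by near=> n; apply: H => //=; near: n.
Unshelve. all: by end_near. Qed.

End grid.

Section sub_sigma_algebra.
Context {d : measure_display} {T : measurableType d} {R : realType}.
Implicit Types (G : set (set T)) (f g : T -> R).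

Definition measurable_wrt G f := forall B : set R, measurable B -> G (f @^-1` B).

(** Passing to the measurable type generated by [G] gives a mere family of sets access to the
    closure properties of measurable functions. *)
Lemma measurable_wrtP G f : sigma_algebra setT G ->
  measurable_wrt G f <-> measurable_fun [set: g_sigma_algebraType G] f.
Proof.
move=> sG; split => [mf _ B mB|mf B mB].
  by rewrite setTI; apply: sub_sigma_algebra; exact: mf.
have := mf measurableT B mB; rewrite setTI /measurable/=.
by rewrite (_ : <<s G >> = G)//; exact: sigma_algebra_id.
Qed.

End sub_sigma_algebra.

Section filtration.
Context {R : realType} {d : measure_display} {T : measurableType d}.
Variables (P : probability T R) (F : R -> set (set T)).
Hypothesis hF : usual_filtration P F.
Implicit Types (X Y : R -> T -> R) (tau sigma : T -> \bar R) (A B : set T).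

Lemma F_sigma t : 0 <= t -> sigma_algebra setT (F t).
Proof. by case: hF => + _ _ _ _; apply. Qed.

Lemma F_mono s t : 0 <= s -> s <= t -> F s `<=` F t.
Proof. by case: hF => _ + _ _ _; apply. Qed.

Lemma F_right t A : 0 <= t -> (forall s, t < s -> F s A) -> F t A.
Proof. by case: hF => _ _ Fr _ _ t0 FA; apply: Fr. Qed.

Lemma F_measurable t A : 0 <= t -> F t A -> measurable A.
Proof.
by move=> t0 FA; case: hF => _ _ _ _ ->; apply: sub_sigma_algebra; exists t.
Qed.

Lemma F_set0 t : 0 <= t -> F t set0.
Proof. by move=> /F_sigma[]. Qed.

Lemma F_setC t A : 0 <= t -> F t A -> F t (~` A).
Proof. by move=> /F_sigma[_ + _] => /[apply]; rewrite setTD. Qed.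

Lemma F_setT t : 0 <= t -> F t setT.
Proof. by move=> t0; rewrite -setC0; apply: F_setC => //; exact: F_set0. Qed.

Lemma F_bigcup t (A : nat -> set T) : 0 <= t -> (forall n, F t (A n)) ->
  F t (\bigcup_n A n).
Proof. by move=> /F_sigma[_ _ +] => /[apply]. Qed.

Lemma F_bigcap t (A : nat -> set T) : 0 <= t -> (forall n, F t (A n)) ->
  F t (\bigcap_n A n).
Proof.
move=> t0 FA; rewrite -[X in F t X]setCK setC_bigcap; apply: F_setC => //.
by apply: F_bigcup => // n; exact: F_setC.
Qed.

Lemma F_setI t A B : 0 <= t -> F t A -> F t B -> F t (A `&` B).
Proof.
by move=> t0 FA FB; rewrite -bigcap2E; apply: F_bigcap => // -[|[|n]]//=; exact: F_setT.
Qed.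

Lemma F_setU t A B : 0 <= t -> F t A -> F t B -> F t (A `|` B).
Proof.
by move=> t0 FA FB; rewrite -bigcup2E; apply: F_bigcup => // -[|[|n]]//=; exact: F_set0.
Qed.

Lemma F_setD t A B : 0 <= t -> F t A -> F t B -> F t (A `\` B).
Proof. by move=> t0 FA FB; rewrite setDE; apply: F_setI => //; exact: F_setC. Qed.

Lemma measurable_wrt_mono s t (f : T -> R) : 0 <= s -> s <= t ->
  measurable_wrt (F s) f -> measurable_wrt (F t) f.
Proof. by move=> s0 st mf B mB; apply: (F_mono s0 st); exact: mf. Qed.

Lemma measurable_wrt_measurable t (f : T -> R) : 0 <= t ->
  measurable_wrt (F t) f -> measurable_fun setT f.
Proof. by move=> t0 mf _ B mB; rewrite setTI; apply: (F_measurable t0); exact: mf. Qed.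

Lemma adapted_measurable X t : adapted F X -> 0 <= t -> measurable_fun setT (X t).
Proof. by move=> aX t0; apply: (measurable_wrt_measurable t0); exact: aX. Qed.

Lemma measurable_wrt_indic t A : 0 <= t -> F t A -> measurable_wrt (F t) (\1_A : T -> R).
Proof.
move=> t0 FA; apply/measurable_wrtP; first exact: F_sigma.
by apply: measurable_indic; rewrite measurable_g_measurableTypeE//; exact: F_sigma.
Qed.

Lemma measurable_wrtM t (f g : T -> R) : 0 <= t ->
  measurable_wrt (F t) f -> measurable_wrt (F t) g ->
  measurable_wrt (F t) (fun w => f w * g w).
Proof.
move=> t0; have sF := F_sigma t0; move=> /(measurable_wrtP _ sF) mf.
by move=> /(measurable_wrtP _ sF) mg; apply/(measurable_wrtP _ sF)/measurable_funM.
Qed.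

Lemma measurable_wrtD t (f g : T -> R) : 0 <= t ->
  measurable_wrt (F t) f -> measurable_wrt (F t) g ->
  measurable_wrt (F t) (fun w => f w + g w).
Proof.
move=> t0; have sF := F_sigma t0; move=> /(measurable_wrtP _ sF) mf.
by move=> /(measurable_wrtP _ sF) mg; apply/(measurable_wrtP _ sF)/measurable_funD.
Qed.

Lemma measurable_wrtB t (f g : T -> R) : 0 <= t ->
  measurable_wrt (F t) f -> measurable_wrt (F t) g ->
  measurable_wrt (F t) (fun w => f w - g w).
Proof.
move=> t0; have sF := F_sigma t0; move=> /(measurable_wrtP _ sF) mf.
by move=> /(measurable_wrtP _ sF) mg; apply/(measurable_wrtP _ sF)/measurable_funB.
Qed.

Lemma measurable_wrt_norm t (f : T -> R) : 0 <= t ->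
  measurable_wrt (F t) f -> measurable_wrt (F t) (fun w => `|f w|).
Proof.
move=> t0; have sF := F_sigma t0; move=> /(measurable_wrtP _ sF) mf.
by apply/(measurable_wrtP _ sF)/measurableT_comp.
Qed.

Lemma measurable_wrt_cst t (c : R) : 0 <= t -> measurable_wrt (F t) (fun=> c).
Proof.
by move=> t0; have sF := F_sigma t0; apply/(measurable_wrtP _ sF)/measurable_cst.
Qed.

Lemma measurable_wrt_sum t (I : Type) (r : seq I) (f : I -> T -> R) : 0 <= t ->
  (forall i, measurable_wrt (F t) (f i)) ->
  measurable_wrt (F t) (fun w => \sum_(i <- r) f i w).
Proof.
move=> t0 mf; elim: r => [|i r ih].
  by under eq_fun do rewrite big_nil; exact: measurable_wrt_cst.
by under eq_fun do rewrite big_cons; exact: measurable_wrtD.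
Qed.

Lemma measurable_wrt_cvg t (f : nat -> T -> R) g : 0 <= t ->
  (forall n, measurable_wrt (F t) (f n)) ->
  (forall w, f n w @[n --> \oo] --> g w) -> measurable_wrt (F t) g.
Proof.
move=> t0 mf fg; have sF := F_sigma t0; apply/(measurable_wrtP _ sF).
apply: (@measurable_fun_cvg _ (g_sigma_algebraType (F t)) R setT f) => [n|x _]; last exact: fg.
exact/(measurable_wrtP _ sF).
Qed.

Lemma measurable_wrt_le t (f : T -> R) c : 0 <= t ->
  measurable_wrt (F t) f -> F t [set w | f w <= c].
Proof.
move=> t0 mf; have := mf _ (measurable_itv `]-oo, c]); congr (F t _).
Qed.

Lemma measurable_wrt_gt t (f : T -> R) c : 0 <= t ->
  measurable_wrt (F t) f -> F t [set w | c < f w].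
Proof.
move=> t0 mf; have := mf _ (measurable_itv `]c, +oo[); congr (F t _).
by apply/seteqP; split => w /=; rewrite in_itv/= andbT.
Qed.

(** The time [t] or [tau], whichever comes first, as a real number; for [tau w >= 0] the minimum is
    finite even when [tau w] is not, so [fine] loses nothing. *)
Definition cap tau t w : R := fine (mine t%:E (tau w)).

Lemma stoppedE X tau t w :
  stopped X tau t w = if (0 < tau w)%E then X (cap tau t w) w else 0.
Proof. by []. Qed.

Lemma capE tau t w : (0 <= tau w)%E -> (cap tau t w)%:E = mine t%:E (tau w).
Proof.
rewrite /cap => t0; rewrite fineK//; case: (tau w) t0 => [r| |]//= _.
  by rewrite -EFin_min.
by rewrite min_l// leey.
Qed.

Lemma cap_le tau t w s : (0 <= tau w)%E ->
  (cap tau t w <= s) = (t <= s) || (tau w <= s%:E)%E.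
Proof. by move=> tau0; rewrite -[LHS]lee_fin capE// ge_min lee_fin. Qed.

Lemma cap_lt tau t w s : (0 <= tau w)%E ->
  (s < cap tau t w) = (s < t) && (s%:E < tau w)%E.
Proof. by move=> tau0; rewrite ltNge cap_le// negb_or -!ltNge. Qed.

Lemma cap_ge0 tau t w : (0 <= tau w)%E -> 0 <= t -> 0 <= cap tau t w.
Proof. by move=> tau0 t0; rewrite -lee_fin capE// le_min tau0 lee_fin t0. Qed.

Lemma cap_le_id tau t w : (0 <= tau w)%E -> cap tau t w <= t.
Proof. by move=> tau0; rewrite cap_le// lexx. Qed.

Lemma cap_id tau t w : (t%:E <= tau w)%E -> cap tau t w = t.
Proof. by move=> h; rewrite /cap (min_l h). Qed.

Lemma cap_const tau t w : (tau w <= t%:E)%E -> cap tau t w = fine (tau w).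
Proof. by move=> h; rewrite /cap (min_r h). Qed.

Lemma le_cap tau s t w : (0 <= tau w)%E -> s <= t -> cap tau s w <= cap tau t w.
Proof.
move=> tau0 st; rewrite cap_le//; have [h|] := boolP (t%:E <= tau w)%E.
  by rewrite cap_id// st.
by rewrite -ltNge => /ltW h; rewrite capE// min_r// lexx orbT.
Qed.

End filtration.

(** * Optional stopping by rounding to grids *)

Section optional_stopping.
Context {R : realType} {d : measure_display} {T : measurableType d}.
Variables (P : probability T R) (F : R -> set (set T)).
Hypothesis hF : usual_filtration P F.
Implicit Types (X Y : R -> T -> R) (tau sigma : T -> \bar R) (A B G : set T).

Lemma P_fin : (P setT < +oo)%E.
Proof. by rewrite probability_setT ltry. Qed.

Lemma martingaleP X : martingale P F X <->
  [/\ adapted F X, forall t, 0 <= t -> L1 P (X t)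
    & forall s t A, 0 <= s -> s <= t -> F s A ->
      expect P (fun w => X t w * \1_A w) = expect P (fun w => X s w * \1_A w)].
Proof.
split=> -[aX iX mX]; split => // s t A s0 st FA; have t0 := le_trans s0 st.
  have := mX _ _ _ s0 st FA; have mA := F_measurable hF s0 FA.
  rewrite (integral_indic_expect mA (iX _ t0)) (integral_indic_expect mA (iX _ s0)).
  by case.
have mA := F_measurable hF s0 FA.
rewrite (integral_indic_expect mA (iX _ t0)) (integral_indic_expect mA (iX _ s0)).
by rewrite (mX _ _ _ s0 st FA).
Qed.

Section discretization.
Variable tau : T -> \bar R.
Hypothesis htau : stopping_time F tau.
Variable t : R.
Hypothesis t0 : 0 <= t.

Let tau0 w : (0 <= tau w)%E. Proof. by case: htau. Qed.

(** Rounding is upwards, so that right-continuity recovers the limit and each level set is decided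
    at its own rounded time. The cut at [t] keeps values of [X] after [t] out of the sums. *)
Definition discretized n w : R := Num.min t (rgrid n (cap tau t w)).

Definition level n i : set T := [set w | grid_index n (cap tau t w) = i].

Let c0 w : 0 <= cap tau t w. Proof. exact: cap_ge0. Qed.

Let F_cap_le (s : R) : 0 <= s -> F (Num.min t s) [set w | cap tau t w <= s].
Proof.
move=> s0; have [ts|] := boolP (t <= s).
  rewrite min_l// (_ : [set _ | _] = setT); first exact: (F_setT hF).
  by apply/seteqP; split => // w _ /=; rewrite cap_le// ts.
rewrite -ltNge => st; rewrite min_r ?(ltW st)//.
rewrite (_ : [set _ | _] = [set w | (tau w <= s%:E)%E]); first by case: htau => _; apply.
by apply/seteqP; split => w /=; rewrite cap_le// (leNgt t) st.
Qed.

Lemma F_level n i : F (Num.min t (grid n i)) (level n i).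
Proof.
have m0 j : 0 <= Num.min t (grid n j) by rewrite le_min t0 grid_ge0.
case: i => [|i].
  rewrite (_ : level _ _ = [set w | cap tau t w <= grid n 0]); first exact: F_cap_le (grid_ge0 _ _).
  apply/seteqP; split => w /=; rewrite -grid_index_le// leqn0; first by move=> ->.
  by move/eqP.
rewrite (_ : level _ _ = [set w | cap tau t w <= grid n i.+1] `\`
    [set w | cap tau t w <= grid n i]).
  apply: (F_setD hF) => //; first exact: F_cap_le (grid_ge0 _ _).
  apply: (F_mono hF (m0 i)); last exact: F_cap_le (grid_ge0 _ _).
  by rewrite le_min ge_min lexx/= ge_min le_grid leqnSn orbT.
apply/seteqP; split => w /=; rewrite -!grid_index_le//.
  by move=> ->; rewrite leqnn ltnn.
by case=> ? /negP; rewrite -ltnNge => ?; apply/eqP; rewrite eqn_leq; apply/andP.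
Qed.

Lemma discretized_sum X n w : X (discretized n w) w =
  \sum_(i < (grid_index n t).+1) X (Num.min t (grid n i)) w * \1_(level n i) w.
Proof.
have h : (grid_index n (cap tau t w) < (grid_index n t).+1)%N.
  by rewrite ltnS le_grid_index// cap_le_id.
rewrite (bigD1 (Ordinal h))//= big1 ?addr0.
  by rewrite indicE mem_set// mulr1.
move=> i /eqP ih; rewrite indicE memNset ?mulr0// => /= hi.
by apply: ih; apply/val_inj.
Qed.

Lemma discretized_ge n w : cap tau t w <= discretized n w.
Proof. by rewrite le_min cap_le_id//= rgrid_ge. Qed.

Lemma cvg_discretized w : discretized n w @[n --> \oo] --> cap tau t w.
Proof.
apply: (@cvg_le_dist _ _ _ _ _ (@harmonic R)); last exact: cvg_harmonic.
move=> n; rewrite ger0_norm ?subr_ge0 ?discretized_ge//.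
rewrite lerBlDl (le_trans _ (rgrid_le n (c0 w)))//.
by rewrite /discretized ge_min lexx orbT.
Qed.

Lemma cvg_discretized_cadlag X w : cadlag X ->
  X (discretized n w) w @[n --> \oo] --> X (cap tau t w) w.
Proof.
move=> /(_ w _ (c0 w)) [Xr _].
apply: (@cvg_at_right_seq _ (X ^~ w) _ (fun n => discretized n w)) => //.
  by move=> n; exact: discretized_ge.
exact: cvg_discretized.
Qed.

Lemma F_level_t n i : F t (level n i).
Proof.
apply: (F_mono hF _ _ (F_level n i)); first by rewrite le_min t0 grid_ge0.
by rewrite ge_min lexx.
Qed.

Lemma measurable_wrt_discretized X n : adapted F X ->
  measurable_wrt (F t) (fun w => X (discretized n w) w).
Proof.
move=> aX; under eq_fun do rewrite discretized_sum.
apply: (measurable_wrt_sum hF) => // i; apply: (measurable_wrtM hF) => //.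
  apply: (measurable_wrt_mono hF _ _ (aX _ _)); first by rewrite le_min t0 grid_ge0.
    by rewrite ge_min lexx.
  by rewrite le_min t0 grid_ge0.
by apply: (measurable_wrt_indic hF) => //; exact: F_level_t.
Qed.

Lemma measurable_wrt_cap X : adapted F X -> cadlag X ->
  measurable_wrt (F t) (fun w => X (cap tau t w) w).
Proof.
move=> aX cX; apply: (measurable_wrt_cvg hF (f := fun n w => X (discretized n w) w)) => //.
  by move=> n; exact: measurable_wrt_discretized.
by move=> w; exact: cvg_discretized_cadlag.
Qed.

Lemma L1_discretized X n : martingale P F X ->
  L1 P (fun w => X (discretized n w) w).
Proof.
move=> /martingaleP[aX iX mX]; under eq_fun do rewrite discretized_sum.
apply: L1_sum => i; apply: L1_indic.
  by apply: (F_measurable hF t0); exact: F_level_t.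
by apply: iX; rewrite le_min t0 grid_ge0.
Qed.

(** Discrete optional stopping: on each level the rounded time is a constant at which [G] and the
    level are already decided, so the martingale identity replaces the value of [X] there by
    [X t]. *)
Lemma expect_discretized X n G : martingale P F X -> measurable G ->
  (forall i, F (Num.min t (grid n i)) (G `&` level n i)) ->
  expect P (fun w => X (discretized n w) w * \1_G w) =
  expect P (fun w => X t w * \1_G w).
Proof.
move=> /martingaleP[aX iX mX] mG FG.
have m0 i : 0 <= Num.min t (grid n i) by rewrite le_min t0 grid_ge0.
have mt i : Num.min t (grid n i) <= t by rewrite ge_min lexx.
have mL i : measurable (G `&` level n i) by apply: (F_measurable hF (m0 i)); exact: FG.
transitivity (\sum_(i < (grid_index n t).+1)
    expect P (fun w => X (Num.min t (grid n i)) w * \1_(G `&` level n i) w)).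
  rewrite -expect_sum; last by move=> i; apply: L1_indic => //; exact: iX.
  apply: eq_expect => w; rewrite discretized_sum mulr_suml.
  by apply: eq_bigr => i _; rewrite indicI /= -mulrA [\1_G w * _]mulrC.
transitivity (\sum_(i < (grid_index n t).+1)
    expect P (fun w => X t w * \1_(G `&` level n i) w)).
  by apply: eq_bigr => i _; rewrite -(mX _ _ _ (m0 i) (mt i) (FG i)).
rewrite -expect_sum; last by move=> i; apply: L1_indic => //; exact: iX.
apply: eq_expect => w; apply/esym.
rewrite {1}(discretized_sum (fun _ => X t) n w : X t w = _) mulr_suml.
by apply: eq_bigr => i _; rewrite indicI /= -mulrA [\1_G w * _]mulrC.
Qed.

(* Optional stopping on an event decided before [tau]: the time [cap tau t] is
   rounded up to a grid point, and the tails of the rounded values of [X] are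
   dominated by those of [X t]. *)
Lemma expect_cap X s G : cadlag X -> martingale P F X ->
  0 <= s -> s <= t -> F s G -> (forall w, G w -> (s%:E < tau w)%E) ->
  L1 P (fun w => X (cap tau t w) w * \1_G w) /\
  expect P (fun w => X (cap tau t w) w * \1_G w) = expect P (fun w => X t w * \1_G w).
Proof.
move=> cX mX s0 st FG Gtau; have mG := F_measurable hF s0 FG.
have [aX iX _] := (martingaleP X).1 mX.
have m0 n i : 0 <= Num.min t (grid n i) by rewrite le_min t0 grid_ge0.
have FGl n i : F (Num.min t (grid n i)) (G `&` level n i).
  (* At grid points before [s] the level misses [G], since [G] forces [s <= cap tau t]. *)
  have [si|] := boolP (s <= grid n i).
    apply: (F_setI hF) => //; last exact: F_level.
    by apply: (F_mono hF s0 _ FG); rewrite le_min st.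
  rewrite -ltNge => si; rewrite (_ : _ `&` _ = set0); first exact: (F_set0 hF).
  apply/seteqP; split => // w [/Gtau sw /= wi].
  have : s <= cap tau t w by rewrite -lee_fin capE// le_min lee_fin st ltW.
  by rewrite leNgt => /negP; apply; rewrite (le_lt_trans _ si)// -grid_index_le// wi.
apply: (@expect_uniformly_dominated _ _ _ P P_fin
  (fun n w => X (discretized n w) w * \1_G w) _ (fun w => X t w * \1_G w)).
- by apply: L1_indic => //; exact: iX.
- by move=> n; apply: L1_indic => //; exact: L1_discretized.
- by move=> w; apply: cvgM; [exact: cvg_discretized_cadlag|exact: cvg_cst].
- move=> n c c0'; pose Yn w := X (discretized n w) w.
  change (expect P (fun x => `|Yn x * \1_G x| * \1_[set x | c < `|Yn x * \1_G x|] x)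
    <= expect P (fun x => `|X t x * \1_G x| * \1_[set x | c < `|Yn x * \1_G x|] x)).
  have LYn : L1 P Yn by exact: L1_discretized.
  have mYn : measurable_fun setT Yn by exact: L1_measurable LYn.
  (* The tail event is split by sign, because on each half [|Yn|] is linear in [Yn]. Each half, cut
     by a level, is decided at the rounded time, so [Yn] may be exchanged for [X t] there. *)
  pose Hp := [set w | c < Yn w]; pose Hm := [set w | Yn w < - c].
  have mHp : measurable Hp.
    by have := mYn measurableT _ (measurable_itv `]c, +oo[); rewrite setTI;
      congr measurable; apply/seteqP; split => w /=; rewrite in_itv/= andbT.
  have mHm : measurable Hm.
    by have := mYn measurableT _ (measurable_itv `]-oo, - c[); rewrite setTI;
      congr measurable; apply/seteqP; split => w /=; rewrite in_itv/=.
  have FL (H : set R) i : measurable H ->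
      F (Num.min t (grid n i)) (G `&` [set w | H (Yn w)] `&` level n i).
    move=> mH; rewrite -setIA [[set _ | _] `&` _]setIC setIA.
    rewrite (_ : _ `&` _ = (G `&` level n i) `&` [set w | H (X (Num.min t (grid n i)) w)]).
      by apply: (F_setI hF) => //; exact: aX.
    by apply/seteqP; split => w /= [[Gw wi] Hw]; split => //; move: Hw;
      rewrite /Yn /discretized /rgrid wi.
  have Ep : expect P (fun w => Yn w * \1_(G `&` Hp) w) = expect P (fun w => X t w * \1_(G `&` Hp) w).
    apply: expect_discretized => //; first exact: measurableI.
    move=> i; have := FL `]c, +oo[%classic i (measurable_itv _); congr (F _ (_ `&` _ `&` _)).
    by apply/seteqP; split => w /=; rewrite in_itv/= andbT.
  have Em : expect P (fun w => Yn w * \1_(G `&` Hm) w) = expect P (fun w => X t w * \1_(G `&` Hm) w).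
    apply: expect_discretized => //; first exact: measurableI.
    move=> i; have := FL `]-oo, - c[%classic i (measurable_itv _); congr (F _ (_ `&` _ `&` _)).
  have LP : L1 P (fun w => Yn w * \1_(G `&` Hp) w) by apply: L1_indic => //; exact: measurableI.
  have LM : L1 P (fun w => Yn w * \1_(G `&` Hm) w) by apply: L1_indic => //; exact: measurableI.
  have LXP : L1 P (fun w => X t w * \1_(G `&` Hp) w).
    by apply: L1_indic; [exact: measurableI|exact: iX].
  have LXM : L1 P (fun w => X t w * \1_(G `&` Hm) w).
    by apply: L1_indic; [exact: measurableI|exact: iX].
  have mA : measurable [set x | c < `|Yn x * \1_G x|].
    apply: measurable_norm_gt; apply: measurable_funM => //; exact: measurable_indic.
  rewrite (@eq_expect _ _ _ _ _ (fun w => Yn w * \1_(G `&` Hp) w - Yn w * \1_(G `&` Hm) w)).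
    rewrite expectB// Ep Em -expectB//; apply: le_expect; first exact: L1B.
      apply: L1_indic => //; apply: L1_norm; apply: L1_indic => //; exact: iX.
    move=> w; rewrite !indicI/= !indicE.
    have [Gw|Gw] := boolP (w \in G); last by rewrite /= !(mul0r, mulr0) normr0 mul0r subrr.
    rewrite /= !mul1r !mulr1.
    have := ler_norm (X t w); have := ler_norm (- X t w); rewrite normrN => ? ?.
    have [Hpw|Hpw] := boolP (w \in Hp).
      have cw : c < Yn w by rewrite inE in Hpw.
      rewrite memNset; last by rewrite /Hm/=; lra.
      rewrite mem_set/= ?mulr1 ?mulr0 ?subr0//.
      by rewrite /= indicE Gw mulr1 gtr0_norm//; lra.
    have [Hmw|Hmw] := boolP (w \in Hm); last by rewrite /= !mulr0 subrr mulr_ge0.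
    have cw : Yn w < - c by rewrite inE in Hmw.
    rewrite mem_set/= ?mulr1 ?mulr0 ?sub0r//.
    by rewrite /= indicE Gw mulr1 ltr0_norm//; lra.
  move=> w; rewrite !indicI/= !indicE.
  have [Gw|Gw] := boolP (w \in G); last by rewrite /= !(mul0r, mulr0) normr0 mul0r subrr.
  rewrite /= !mul1r !mulr1.
  have [Hpw|Hpw] := boolP (w \in Hp).
    have cw : c < Yn w by rewrite inE in Hpw.
    have -> : (w \in Hm) = false by apply: memNset; rewrite /Hm/=; lra.
    rewrite mem_set/= ?mulr1 ?mulr0 ?subr0//; last first.
      by rewrite /= indicE Gw mulr1 gtr0_norm//; lra.
    by rewrite gtr0_norm//; lra.
  have [Hmw|Hmw] := boolP (w \in Hm).
    have cw : Yn w < - c by rewrite inE in Hmw.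
    rewrite mem_set/= ?mulr1 ?mulr0 ?sub0r//; last first.
      by rewrite /= indicE Gw mulr1 ltr0_norm//; lra.
    by rewrite ltr0_norm//; lra.
  rewrite memNset/= ?mulr0 ?subrr// indicE Gw mulr1.
  move: Hpw Hmw; rewrite !notin_setE /Hp /Hm/= => /negP; rewrite -leNgt => h1.
  move=> /negP; rewrite -leNgt => h2; apply/negP; rewrite -leNgt ler_norml; lra.
- by move=> n; apply: expect_discretized.
Qed.

End discretization.
End optional_stopping.

Lemma near_right_lee (R : realType) (t : R) (x : \bar R) : (t%:E < x)%E ->
  \forall s \near t^'+, (s%:E <= x)%E.
Proof.
case: x => [r| |]//; last by move=> _; near=> s; exact: leey.
rewrite lte_fin => tr; near=> s; rewrite lee_fin; apply: ltW; near: s.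
exact: nbhs_right_lt.
Unshelve. all: by end_near. Qed.

Lemma near_left_lee (R : realType) (t : R) (x : \bar R) : (x < t%:E)%E ->
  \forall s \near t^'-, (x <= s%:E)%E.
Proof.
case: x => [r| |]//; last by move=> _; near=> s; exact: leNye.
rewrite lte_fin => tr; near=> s; rewrite lee_fin; apply: ltW; near: s.
exact: nbhs_left_gt.
Unshelve. all: by end_near. Qed.

(** * Stopped processes and local martingales *)

Section stopped_processes.
Context {R : realType} {d : measure_display} {T : measurableType d}.
Variables (P : probability T R) (F : R -> set (set T)).
Hypothesis hF : usual_filtration P F.
Implicit Types (X Y : R -> T -> R) (tau sigma : T -> \bar R) (A B G : set T).

Lemma F_stopping_gt tau s : stopping_time F tau -> 0 <= s ->
  F s [set w | (s%:E < tau w)%E].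
Proof.
move=> [_ /(_ s)] h s0; rewrite (_ : [set _ | _] = ~` [set w | (tau w <= s%:E)%E]).
  by apply: (F_setC hF) => //; exact: h.
by apply/seteqP; split => w /=; [move=> ?; apply/negP; rewrite -ltNge|move/negP; rewrite -ltNge].
Qed.

Lemma stopped_adapted X tau : adapted F X -> cadlag X -> stopping_time F tau ->
  adapted F (stopped X tau).
Proof.
move=> aX cX htau t t0.
have -> : stopped X tau t = (fun w => X (cap tau t w) w * \1_[set w | (0 < tau w)%E] w).
  apply/funext => w; rewrite stoppedE indicE; case: ifPn => tau0.
    by rewrite mem_set// mulr1.
  by rewrite memNset ?mulr0//; apply/negP.
apply: (measurable_wrtM hF) => //; first exact: (measurable_wrt_cap hF).
apply: (measurable_wrt_indic hF) => //; apply: (F_mono hF _ t0) => //.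
exact: F_stopping_gt.
Qed.

Lemma stopped_cadlag X tau : cadlag X -> (forall w, (0 <= tau w)%E) ->
  cadlag (stopped X tau).
Proof.
move=> cX tau0 w t t0.
have [tw|tw] := boolP (0 < tau w)%E; last first.
  have -> : (fun s => stopped X tau s w) = (fun=> 0).
    by apply/funext => s; rewrite stoppedE (negbTE tw).
  rewrite stoppedE (negbTE tw); split; first exact: cvg_cst.
  by move=> _; exact: is_cvg_cst.
have -> : (fun s => stopped X tau s w) = (fun s => X (cap tau s w) w).
  by apply/funext => s; rewrite stoppedE tw.
rewrite stoppedE tw.
have [Xr Xl] := cX w t t0; split.
  have [th|] := boolP (t%:E < tau w)%E.
    rewrite cap_id ?(ltW th)//.
    apply: cvg_trans Xr; apply: near_eq_cvg; near=> s.
    by rewrite cap_id//; near: s; exact: near_right_lee.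
  rewrite -leNgt => th.
  rewrite (cap_const th).
  apply: cvg_trans (_ : (fun=> X (fine (tau w)) w) s @[s --> t^'+] --> X (fine (tau w)) w); last exact: cvg_cst.
  apply: near_eq_cvg; near=> s; rewrite cap_const// (le_trans th)// lee_fin.
  by apply: ltW; near: s; exact: nbhs_right_gt.
move=> tp.
have [th|] := boolP (t%:E <= tau w)%E.
  apply/cvg_ex; have /cvg_ex[l Xl'] := Xl tp; exists l.
  apply: cvg_trans Xl'; apply: near_eq_cvg; near=> s.
  rewrite cap_id// (le_trans _ th)// lee_fin.
  by apply: ltW; near: s; exact: nbhs_left_lt.
rewrite -ltNge => th; apply/cvg_ex; exists (X (fine (tau w)) w).
apply: cvg_trans (_ : (fun=> X (fine (tau w)) w) s @[s --> t^'-] --> X (fine (tau w)) w); last exact: cvg_cst.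
by apply: near_eq_cvg; near=> s; rewrite cap_const//; near: s; exact: near_left_lee.
Unshelve. all: by end_near. Qed.

(** An event [A] of [F s] is split at [s < tau]. On the part [G] where [tau] is still to come,
    optional stopping applies at both times; on the rest the stopped process is frozen from [s]
    on. *)
Lemma martingale_stopped X tau : cadlag X -> martingale P F X ->
  stopping_time F tau -> martingale P F (stopped X tau).
Proof.
move=> cX mX htau; have [aX iX EX] := (martingaleP hF X).1 mX.
have tau0 w : (0 <= tau w)%E by case: htau.
have stopped_indic t : stopped X tau t =
    (fun w => X (cap tau t w) w * \1_[set w | (0 < tau w)%E] w).
  apply/funext => w; rewrite stoppedE indicE; case: ifPn => tw.
    by rewrite mem_set// mulr1.
  by rewrite memNset ?mulr0//; apply/negP.
have iS t : 0 <= t -> L1 P (stopped X tau t).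
  move=> t0; rewrite stopped_indic.
  apply: (proj1 (expect_cap hF htau t0 cX mX (lexx 0) t0 _ _)) => //.
  exact: F_stopping_gt.
apply/(martingaleP hF); split; [exact: stopped_adapted|exact: iS|].
move=> s t A s0 st FA; have t0 := le_trans s0 st.
pose G := A `&` [set w | (s%:E < tau w)%E].
have FG : F s G by apply: (F_setI hF) => //; exact: F_stopping_gt.
have mA := F_measurable hF s0 FA; have mG := F_measurable hF s0 FG.
have mAG : measurable (A `\` G) by exact: measurableD.
have Gtau w : G w -> (s%:E < tau w)%E by case.
have [Lt Et] := expect_cap hF htau t0 cX mX s0 st FG Gtau.
have [Ls Es] := expect_cap hF htau s0 cX mX s0 (lexx s) FG Gtau.
have decomp r : s <= r -> (fun w => stopped X tau r w * \1_A w) =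
    (fun w => X (cap tau r w) w * \1_G w + stopped X tau s w * \1_(A `\` G) w).
  move=> sr; apply/funext => w; rewrite !indicE in_setD.
  have [Aw|Aw] := boolP (w \in A); last first.
    rewrite (_ : (w \in G) = false) /= ?mulr0 ?addr0//.
    by apply: memNset => -[Aw' _]; rewrite mem_set in Aw.
  rewrite /= mulr1; have [sw|sw] := boolP (s%:E < tau w)%E.
    rewrite (_ : (w \in G) = true) ?mulr0 ?mulr1 ?addr0; last first.
      by apply: mem_set; split => //; rewrite inE in Aw.
    by rewrite stoppedE (le_lt_trans _ sw).
  rewrite (_ : (w \in G) = false) ?mulr0 ?mulr1 ?add0r; last first.
    by apply: memNset => -[_ /= sw']; rewrite sw' in sw.
  rewrite -leNgt in sw; rewrite !stoppedE !cap_const//.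
  by rewrite (le_trans sw)// lee_fin.
rewrite (decomp t st) (decomp s (lexx s)).
have L2 : L1 P (fun w => stopped X tau s w * \1_(A `\` G) w).
  by apply: L1_indic => //; exact: iS.
rewrite expectD; [|exact: Lt|exact: L2].
by rewrite expectD; [rewrite Et Es (EX _ _ _ s0 st FG)|exact: Ls|exact: L2].
Qed.

Lemma stopping_time_min tau sigma : stopping_time F tau -> stopping_time F sigma ->
  stopping_time F (fun w => mine (tau w) (sigma w)).
Proof.
move=> [t0 ht] [s0 hs]; split => [w|t tt]; first by rewrite le_min t0 s0.
rewrite (_ : [set _ | _] = [set w | (tau w <= t%:E)%E] `|` [set w | (sigma w <= t%:E)%E]).
  by apply: (F_setU hF) => //; [exact: ht|exact: hs].
by apply/seteqP; split => w /=; rewrite ge_min => /orP.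
Qed.

Lemma cap_cap tau sigma t w : (0 <= tau w)%E -> (0 <= sigma w)%E ->
  cap tau (cap sigma t w) w = cap (fun w => mine (tau w) (sigma w)) t w.
Proof.
move=> tau0 sigma0; apply: (@EFin_inj R).
by rewrite !capE ?le_min ?tau0 ?sigma0// -minA (minC (sigma w)).
Qed.

Lemma stopped_stopped X tau sigma : (forall w, (0 <= tau w)%E) ->
  (forall w, (0 <= sigma w)%E) ->
  stopped (stopped X tau) sigma = stopped X (fun w => mine (tau w) (sigma w)).
Proof.
move=> tau0 sigma0; apply/funext => t; apply/funext => w.
rewrite !stoppedE lt_min; case: (boolP (0 < sigma w)%E) => _; last by rewrite andbF.
by rewrite andbT cap_cap.
Qed.

Lemma stopped_lin X Y k tau : stopped (fun t w => X t w + k * Y t w) tau =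
  (fun t w => stopped X tau t w + k * stopped Y tau t w).
Proof.
apply/funext => t; apply/funext => w; rewrite !stoppedE.
by case: ifP => // _; rewrite mulr0 addr0.
Qed.

Lemma adapted_lin X Y k : adapted F X -> adapted F Y ->
  adapted F (fun t w => X t w + k * Y t w).
Proof.
move=> aX aY t t0; apply: (measurable_wrtD hF) => //; first exact: aX.
by apply: (measurable_wrtM hF) => //; [exact: (measurable_wrt_cst hF)|exact: aY].
Qed.

Lemma cadlag_lin X Y k : cadlag X -> cadlag Y ->
  cadlag (fun t w => X t w + k * Y t w).
Proof.
move=> cX cY w t t0; have [Xr Xl] := cX w t t0; have [Yr Yl] := cY w t t0; split.
  by apply: cvgD => //; apply: cvgM => //; exact: cvg_cst.
move=> tp; apply: is_cvgD; first exact: Xl.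
by apply: is_cvgM; [exact: is_cvg_cst|exact: Yl].
Qed.

Lemma cadlagM X Y : cadlag X -> cadlag Y -> cadlag (fun t w => X t w * Y t w).
Proof.
move=> cX cY w t t0; have [Xr Xl] := cX w t t0; have [Yr Yl] := cY w t t0; split.
  exact: cvgM.
by move=> tp; apply: is_cvgM; [exact: Xl|exact: Yl].
Qed.

Lemma adaptedM X Y : adapted F X -> adapted F Y -> adapted F (fun t w => X t w * Y t w).
Proof. by move=> aX aY t t0; apply: (measurable_wrtM hF) => //; [exact: aX|exact: aY]. Qed.

Lemma martingale_lin X Y k : martingale P F X -> martingale P F Y ->
  martingale P F (fun t w => X t w + k * Y t w).
Proof.
move=> /(martingaleP hF)[aX iX EX] /(martingaleP hF)[aY iY EY].
apply/(martingaleP hF); split; first exact: adapted_lin.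
  by move=> t t0; apply: L1D; [exact: iX|apply: L1Z; exact: iY].
move=> s t A s0 st FA; have t0 := le_trans s0 st.
have mA := F_measurable hF s0 FA.
have E r : 0 <= r -> expect P (fun w => (X r w + k * Y r w) * \1_A w) =
    expect P (fun w => X r w * \1_A w) + k * expect P (fun w => Y r w * \1_A w).
  move=> r0; under eq_expect do rewrite mulrDl -mulrA.
  rewrite expectD ?expectZ//.
  - by apply: L1_indic => //; exact: iY.
  - by apply: L1_indic => //; exact: iX.
  - by apply: L1Z; apply: L1_indic => //; exact: iY.
by rewrite !E// (EX _ _ _ s0 st FA) (EY _ _ _ s0 st FA).
Qed.

(** The minima of the two localizing times serve both processes, since a stopped martingale stopped
    once more remains a martingale. *)
Lemma local_martingale_lin X Y k : local_martingale P F X -> local_martingale P F Y ->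
  local_martingale P F (fun t w => X t w + k * Y t w).
Proof.
move=> [aX cX [tau [st nd too mX]]] [aY cY [sg [ss ns soo mY]]].
have t0 n w : (0 <= tau n w)%E by case: (st n).
have s0 n w : (0 <= sg n w)%E by case: (ss n).
split; [exact: adapted_lin|exact: cadlag_lin|].
exists (fun n w => mine (tau n w) (sg n w)); split.
- by move=> n; exact: stopping_time_min.
- move=> w n m nm; rewrite le_min !ge_min (nd w n m nm) (ns w n m nm) orbT//.
- apply: filterS2 too soo => w /cvgeyPge hw /cvgeyPge hs; apply/cvgeyPge => A.
  by near=> n; rewrite le_min; apply/andP; split; near: n; [exact: hw|exact: hs].
- move=> n; rewrite stopped_lin; apply: martingale_lin.
    rewrite -(stopped_stopped _ (t0 n) (s0 n)).
    exact: martingale_stopped (stopped_cadlag cX (t0 n)) (mX n) (ss n).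
  have -> : (fun w => mine (tau n w) (sg n w)) = (fun w => mine (sg n w) (tau n w)).
    by apply/funext => w; rewrite minC.
  rewrite -(stopped_stopped _ (s0 n) (t0 n)).
  exact: martingale_stopped (stopped_cadlag cY (s0 n)) (mY n) (st n).
Unshelve. all: by end_near. Qed.

End stopped_processes.

Section ae.
Context {d : measure_display} {T : measurableType d} {R : realType}.
Variable mu : {measure set T -> \bar R}.
Implicit Types (f g : T -> R).

Lemma L1_ae f g : L1 mu f -> measurable_fun setT g ->
  {ae mu, forall x, f x = g x} -> L1 mu g /\ expect mu g = expect mu f.
Proof.
move=> f1 mg fg; have mf := L1_measurable f1.
have mf' : measurable_fun setT (EFin \o f) by exact/measurable_EFinP.
have mg' : measurable_fun setT (EFin \o g) by exact/measurable_EFinP.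
have E : (\int[mu]_x (f x)%:E = \int[mu]_x (g x)%:E)%E.
  apply: (@ae_eq_integral _ _ _ mu setT (EFin \o g) (EFin \o f)) => //.
  by apply: filterS fg => x fgx _ /=; rewrite fgx.
split; last by rewrite /expect /Rintegral E.
apply/integrableP; split => //; move/integrableP : f1 => [_].
rewrite (@ae_eq_integral _ _ _ mu setT (abse \o (EFin \o g)) (abse \o (EFin \o f)))//.
- exact: measurableT_comp.
- exact: measurableT_comp.
- by apply: filterS fg => x fgx _ /=; rewrite fgx.
Qed.

End ae.

(** * Indistinguishability, continuity and hitting times *)

Section local_martingales.
Context {R : realType} {d : measure_display} {T : measurableType d}.
Variables (P : probability T R) (F : R -> set (set T)).
Hypothesis hF : usual_filtration P F.
Implicit Types (X Y Z : R -> T -> R) (tau sigma : T -> \bar R) (A B G : set T).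

(** The localizing times of [X] also localize [Y]. Cadlag paths are demanded everywhere, so an
    almost sure equality cannot transfer them and they are assumed of [Y]. *)
Lemma local_martingale_indistinguishable X Y : local_martingale P F X ->
  adapted F Y -> cadlag Y -> {ae P, forall w, forall t, 0 <= t -> X t w = Y t w} ->
  local_martingale P F Y.
Proof.
move=> [aX cX [tau [st nd too mX]]] aY cY XY; split; [exact: aY|exact: cY|exists tau].
split; [exact: st|exact: nd|exact: too|move=> n].
have [aS iS ES] := (martingaleP hF _).1 (mX n).
have aSY := stopped_adapted hF aY cY (st n).
have XYS t : 0 <= t -> {ae P, forall w, stopped X (tau n) t w = stopped Y (tau n) t w}.
  move=> t0; apply: filterS XY => w XY; rewrite !stoppedE; case: ifPn => // h.
  by rewrite XY// cap_ge0// ltW.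
have XYA t A : 0 <= t -> measurable A ->
    {ae P, forall w, stopped X (tau n) t w * \1_A w = stopped Y (tau n) t w * \1_A w}.
  by move=> t0 mA; apply: filterS (XYS t t0) => w ->.
have mSY t : 0 <= t -> measurable_fun setT (stopped Y (tau n) t).
  by move=> t0; exact: (adapted_measurable hF aSY).
apply/(martingaleP hF); split; first exact: aSY.
  by move=> t t0; apply: (proj1 (L1_ae (iS t t0) (mSY t t0) (XYS t t0))).
move=> s t A s0 sle FA; have t0 := le_trans s0 sle; have mA := F_measurable hF s0 FA.
have E r : 0 <= r -> expect P (fun w => stopped Y (tau n) r w * \1_A w) =
    expect P (fun w => stopped X (tau n) r w * \1_A w).
  move=> r0; apply: (proj2 (L1_ae _ _ (XYA r A r0 mA))).
    by apply: L1_indic => //; exact: iS.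
  by apply: measurable_funM; [exact: mSY|exact: measurable_indic].
by rewrite (E t t0) (E s s0); exact: ES.
Qed.

Lemma martingale_local_martingale X : cadlag X -> martingale P F X ->
  local_martingale P F X.
Proof.
move=> cX mX; have [aX _ _] := mX; split; [exact: aX|exact: cX|].
exists (fun _ _ => +oo%E); split.
- move=> _; split => [w|t t0]; first exact: leey.
  rewrite (_ : [set _ | _] = set0); first exact: (F_set0 hF).
  by apply/seteqP; split => w.
- by move=> w n1 n2 _; exact: lexx.
- by apply: aeW => w; exact: cvg_cst.
- move=> _; rewrite (_ : stopped _ _ = X); first exact: mX.
  apply/funext => t; apply/funext => w; rewrite stoppedE ltry.
  by rewrite cap_id// leey.
Qed.

Lemma continuous_process_cvg X (w : T) (t : R) (u : nat -> R) : continuous_process X -> 0 <= t ->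
  (forall n, 0 <= u n) -> u n @[n --> \oo] --> t -> X (u n) w @[n --> \oo] --> X t w.
Proof.
move=> /(_ w) cX t0 u0 ut.
have /continuous_within_itvcyP[cin c0] := cX.
have /cvgrPdist_le H : X s w @[s --> t^'+] --> X t w.
  move: t0; rewrite le_eqVlt => /predU1P[<-//|t0].
  apply: cvg_at_right_filter; apply: cin; rewrite in_itv/= t0//.
apply/cvgrPdist_le => e e0; have [r /= r0 Hr] := H e e0.
have [r' r'0 Hr'] : exists2 r' : R, 0 < r' & forall s, 0 <= s -> `|t - s| < r' ->
    s < t -> `|X t w - X s w| <= e.
  move: t0; rewrite le_eqVlt => /predU1P[<-|t0].
    by exists 1 => // s s0 _; rewrite ltNge s0.
  have /cvgrPdist_le/(_ e e0) : {for t, continuous (X ^~ w)}.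
    by apply: cin; rewrite in_itv/= t0.
  by move=> [r' /= r'0 Hr']; exists r' => // s _ ts _; exact: Hr'.
move/cvgrPdist_lt : ut => ut; near=> n.
have un : `|t - u n| < Num.min r r' by near: n; apply: ut; rewrite lt_min r0 r'0.
move: un; rewrite lt_min => /andP[un1 un2].
have [tu|] := boolP (t < u n); first exact: Hr.
rewrite -leNgt le_eqVlt => /predU1P[->|]; first by rewrite subrr normr0 ltW.
exact: Hr'.
Unshelve. all: by end_near. Qed.

Lemma continuous_process_cadlag X : continuous_process X -> cadlag X.
Proof.
move=> cX w t t0; have /continuous_within_itvcyP[cin c0] := cX w.
split.
  move: t0; rewrite le_eqVlt => /predU1P[<-//|t0].
  by apply: cvg_at_right_filter; apply: cin; rewrite in_itv/= t0.
move=> tp; apply/cvg_ex; exists (X t w).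
by apply: cvg_at_left_filter; apply: cin; rewrite in_itv/= tp.
Qed.

(** The infimum of the empty set is [+oo]: a path that never reaches [c] is never stopped. *)
Definition hitting_time Z (c : R) w : \bar R :=
  ereal_inf [set s%:E | s in [set s | 0 <= s /\ c <= Z s w]].

Definition nondecreasing_process Z := forall w s t, 0 <= s -> s <= t -> Z s w <= Z t w.

Lemma hitting_time_ge0 Z c w : (0 <= hitting_time Z c w)%E.
Proof. by apply: le_ereal_inf_tmp => _ [s [s0 _] <-]; rewrite lee_fin. Qed.

Lemma hitting_time_lt Z c w s : 0 <= s -> (s%:E < hitting_time Z c w)%E -> Z s w < c.
Proof.
move=> s0; apply: contraTT; rewrite -!leNgt => cZ.
by apply: ereal_inf_lbound; exists s.
Qed.

Lemma hitting_time_ge Z c w s : nondecreasing_process Z -> 0 <= s -> Z s w < c ->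
  (s%:E <= hitting_time Z c w)%E.
Proof.
move=> Znd s0 Zc; apply: le_ereal_inf_tmp => _ [r [r0 cZ] <-]; rewrite lee_fin leNgt.
by apply/negP => rs; have := Znd w r s r0 (ltW rs); rewrite leNgt (lt_le_trans Zc).
Qed.

(** For a monotone path, being stopped by time [t] means having reached [c] at every time after [t].
    This is known just after [t], hence at [t] by right-continuity of the filtration. Monotonicity
    suffices on the side of [Z], which spares a proof that running suprema are right-continuous. *)
Lemma hitting_time_stopping Z c : adapted F Z -> nondecreasing_process Z ->
  stopping_time F (hitting_time Z c).
Proof.
move=> aZ Znd; split => [w|t t0]; first exact: hitting_time_ge0.
apply: (F_right hF) => // s ts; have s0 : 0 <= s by rewrite (le_trans t0)// ltW.
(* Discarding the first [k] times keeps the whole intersection inside [F s]. *)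
have [k tk] : exists k : nat, t + k.+1%:R^-1 <= s.
  have [k _ Hk] : \forall k \near \oo, k.+1%:R^-1 <= s - t.
    have := @cvg_harmonic R; move/cvgr0Pnorm_le => /(_ (s - t)); rewrite subr_gt0 => /(_ ts).
    by apply: filterS => k; apply: le_trans; exact: ler_norm.
  by exists k; have := Hk k (leqnn k); rewrite /= lerBrDl.
have tj0 j : 0 <= t + (k + j).+1%:R^-1 by rewrite addr_ge0.
rewrite (_ : [set _ | _] = \bigcap_j ~` [set w | Z (t + (k + j).+1%:R^-1) w < c]).
  apply: (F_bigcap hF) => // j; apply: (F_setC hF) => //.
  have tjs : t + (k + j).+1%:R^-1 <= s.
    by apply: le_trans tk; rewrite lerD2l lef_pV2 ?posrE// ler_nat ltnS leq_addr.
  have := measurable_wrt_mono hF (tj0 j) tjs (aZ _ (tj0 j)).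
  move=> /(_ _ (measurable_itv `]-oo, c[)); congr (F s _).
apply/seteqP; split => w /=.
  move=> ht j _ /= Zc; have := hitting_time_ge Znd (tj0 j) Zc.
  by move=> /le_trans /(_ ht); rewrite lee_fin leNgt ltrDl invr_gt0 ltr0n.
move=> H; rewrite leNgt; apply/negP => th.
have [r tr rh] : exists2 r : R, t < r & (r%:E <= hitting_time Z c w)%E.
  case: (hitting_time Z c w) th => [r| |]//; first by rewrite lte_fin => ?; exists r.
  by exists (t + 1); [rewrite ltrDl|exact: leey].
have [j _ Hj] : \forall j \near \oo, j.+1%:R^-1 < r - t.
  have := @cvg_harmonic R; move/cvgr0Pnorm_lt => /(_ (r - t)); rewrite subr_gt0 => /(_ tr).
  by apply: filterS => j; apply: le_lt_trans; exact: ler_norm.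
apply: (H j I); apply: hitting_time_lt => //; apply: lt_le_trans rh; rewrite lte_fin.
by rewrite -ltrBrDl; exact: (Hj (k + j)%N (leq_addl _ _)).
Qed.

Lemma hitting_time_nd Z w : nondecreasing_seq (fun n => hitting_time Z n%:R w).
Proof.
move=> n m nm; apply: le_ereal_inf_tmp => _ [r [r0 cZ] <-].
by apply: ereal_inf_lbound; exists r => //; split => //; rewrite (le_trans _ cZ)// ler_nat.
Qed.

Lemma hitting_time_cvg Z w : nondecreasing_process Z ->
  hitting_time Z n%:R w @[n --> \oo] --> +oo%E.
Proof.
move=> Znd; apply/cvgeyPge => A; near=> n.
apply: (@le_trans _ _ (Num.max 0 A)%:E); first by rewrite lee_fin le_max lexx orbT.
apply: hitting_time_ge => //; first by rewrite le_max lexx.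
by near: n; exact: nbhs_infty_gtr.
Unshelve. all: by end_near. Qed.

End local_martingales.

(** * Variation and predictable processes *)

Lemma cvg_sumr (R : realType) (I : Type) (r : seq I) (u : I -> nat -> R) (l : I -> R) :
  (forall i, u i n @[n --> \oo] --> l i) ->
  \sum_(i <- r) u i n @[n --> \oo] --> \sum_(i <- r) l i.
Proof.
move=> ul; elim: r => [|i r ih].
  by under eq_fun do rewrite big_nil; rewrite big_nil; exact: cvg_cst.
by under eq_fun do rewrite big_cons; rewrite big_cons; exact: cvgD.
Qed.

(** * Variation along time grids *)

Section grid_sums.
Context {R : realType}.
Implicit Types (s t : R) (n i : nat).

(** The number of cells of mesh [1/(n+1)] up to time [n+1]. The mesh shrinks while the horizon
    grows, so sums of a length independent of [t] serve every [t]; clipping at [t] makes the later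
    increments vanish. *)
Definition gsize n := (n.+1 * n.+1)%N.

Definition clip n t i : R := Num.min t (grid n i).

Lemma grid_gsize n : grid n (gsize n) = n.+1%:R :> R.
Proof. by rewrite /grid /gsize natrM mulfK. Qed.

Lemma clip0 n t : 0 <= t -> clip n t 0 = 0.
Proof. by move=> t0; rewrite /clip grid0 min_r. Qed.

Lemma clip_ge0 n t i : 0 <= t -> 0 <= clip n t i.
Proof. by move=> t0; rewrite le_min t0 grid_ge0. Qed.

Lemma clip_le n t i : clip n t i <= t.
Proof. by rewrite ge_min lexx. Qed.

Lemma le_clip n t i j : (i <= j)%N -> clip n t i <= clip n t j.
Proof. by move=> ij; rewrite le_min !ge_min lexx/= le_grid ij orbT. Qed.

Lemma clip_gsize n t : t <= n.+1%:R -> clip n t (gsize n) = t.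
Proof. by move=> tn; rewrite /clip grid_gsize min_l. Qed.

Lemma clip_gsize_near t : \forall n \near \oo, clip n t (gsize n) = t.
Proof.
near=> n; apply: clip_gsize; apply: (@le_trans _ _ n%:R); last by rewrite ler_nat.
by near: n; exact: nbhs_infty_ger.
Unshelve. all: by end_near. Qed.

End grid_sums.

Section total_variation.
Context {R : realType}.
Variable f : R -> R.
Hypothesis f_right : forall t, 0 <= t -> f x @[x --> t^'+] --> f t.
Hypothesis f_bv : forall t, 0 <= t -> bounded_variation 0 t f.
Implicit Types (s t : R) (n i : nat).

Definition tv t : R := fine (total_variation 0 t f).

Lemma tvE t : 0 <= t -> (tv t)%:E = total_variation 0 t f.
Proof. by move=> t0; rewrite fineK//; apply/bounded_variationP => //; exact: f_bv. Qed.

Lemma tv0 : tv 0 = 0.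
Proof. by rewrite /tv total_variationxx. Qed.

Lemma tv_increment s t : 0 <= s -> s <= t -> `|f t - f s| <= tv t - tv s.
Proof.
move=> s0 st; rewrite -lee_fin EFinB (tvE s0) (tvE (le_trans s0 st)).
rewrite (total_variationD f s0 st) addeAC subee ?add0e ?total_variation_ge//.
by rewrite -(tvE s0).
Qed.

Lemma tv_nd s t : 0 <= s -> s <= t -> tv s <= tv t.
Proof. by move=> s0 st; rewrite -subr_ge0 (le_trans _ (tv_increment s0 st)). Qed.

Lemma tv_right t : 0 <= t -> tv x @[x --> t^'+] --> tv t.
Proof.
move=> t0; apply: (@total_variation_right_continuous _ 0 (t + 1) t f) => //.
- by rewrite ltrDl.
- exact: f_right.
- by apply: f_bv; rewrite addr_ge0.
Qed.

Definition grid_variation n t :=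
  \sum_(0 <= i < gsize n) `|f (clip n t i.+1) - f (clip n t i)|.

Lemma sum_increments_le n t j : 0 <= t ->
  \sum_(0 <= i < j) `|f (clip n t i.+1) - f (clip n t i)| <= tv (clip n t j).
Proof.
move=> t0; have -> : tv (clip n t j) = tv (clip n t j) - tv (clip n t 0).
  by rewrite clip0// tv0 subr0.
rewrite -(telescope_sumr (fun i => tv (clip n t i)))//.
by apply: ler_sum => i _; apply: tv_increment; rewrite ?clip_ge0// le_clip.
Qed.

Lemma grid_variation_le n t : 0 <= t -> grid_variation n t <= tv t.
Proof.
move=> t0; apply: (le_trans (sum_increments_le _ _ t0)).
by rewrite tv_nd ?clip_ge0 ?clip_le.
Qed.

(** Rounded up to the grid, a partition becomes a coarsening of the grid, so each of its increments
    telescopes over grid cells. *)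
Lemma variation_grid_le n t s (l : seq R) : 0 <= t -> 0 <= s -> path <%R s l ->
  \sum_(x <- zip l (s :: l)) `|f (clip n t (grid_index n x.1)) - f (clip n t (grid_index n x.2))|
  <= \sum_(grid_index n s <= i < grid_index n (last s l)) `|f (clip n t i.+1) - f (clip n t i)|.
Proof.
move=> t0; elim: l s => [s s0 _|x l ih s s0 /= /andP[sx xl]].
  by rewrite big_nil big_geq.
have x0 : 0 <= x by rewrite (le_trans s0)// ltW.
have sxi := le_grid_index n s0 (ltW sx).
have xli : (grid_index n x <= grid_index n (last x l))%N.
  apply: le_grid_index => //; elim: l {ih sxi} x {sx} x0 xl => //= y l ih x x0 /andP[xy yl].
  by rewrite (le_trans (ltW xy))// ih// (le_trans x0)// ltW.
rewrite big_cons/= (big_cat_nat sxi xli)/= lerD ?ih//.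
rewrite -(telescope_sumr (fun i => f (clip n t i)))//.
exact: ler_norm_sum.
Qed.

(** By right-continuity, rounding the points of a near-optimal partition up to the grid changes its
    variation little. The supremum over all partitions thus becomes a sequential limit, which is
    what makes the variation process adapted. *)
Lemma cvg_grid_variation t : 0 <= t -> grid_variation n t @[n --> \oo] --> tv t.
Proof.
move=> t0; apply/cvgrPdist_le => e e0.
have Vfin : ereal_sup [set x%:E | x in variations 0 t f] \is a fin_num.
  by rewrite -[ereal_sup _]/(total_variation 0 t f) -tvE.
have [_ [_ [l tl <-] <-]] := ub_ereal_sup_adherent (divr_gt0 e0 (ltr0n R 2)) Vfin.
rewrite -[ereal_sup _]/(total_variation 0 t f) -tvE// -EFinB lte_fin => Vl.
have cl : \sum_(x <- zip l (0 :: l)) `|f (clip n t (grid_index n x.1))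
      - f (clip n t (grid_index n x.2))| @[n --> \oo] --> variation 0 t f l.
  under eq_fun do rewrite -(variation_zip (fun x => f (clip _ t (grid_index _ x))) tl).
  have cx x : 0 <= x <= t -> f (clip n t (grid_index n x)) @[n --> \oo] --> f x.
    move=> /andP[x0 xt]; apply: (@cvg_at_right_seq _ f x (fun n => clip n t (grid_index n x))).
    - exact: f_right.
    - by move=> n; rewrite le_min xt rgrid_ge.
    - apply: (@cvg_le_dist _ _ _ _ _ (@harmonic R)); last exact: cvg_harmonic.
      move=> n; rewrite ger0_norm ?subr_ge0 ?le_min ?xt ?rgrid_ge//.
      by rewrite lerBlDl (le_trans _ (rgrid_le n x0))// ge_min lexx orbT.
  have hk k : 0 <= nth t (0 :: l) k <= t.
    have [kl|kl] := boolP (k < (size l).+1)%N.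
      by rewrite (itv_partition_nth_ge kl tl) (itv_partition_nth_le kl tl).
    by rewrite nth_default ?t0 ?lexx// leqNgt.
  apply: cvg_sumr => k; apply: cvg_norm; apply: cvgB; apply: cx.
    exact: (hk k.+1).
  exact: (hk k).
move/cvgrPdist_le : cl => /(_ (e / 2)) => cl.
near=> n.
have : grid_variation n t <= tv t by exact: grid_variation_le.
have : \sum_(x <- zip l (0 :: l)) `|f (clip n t (grid_index n x.1))
      - f (clip n t (grid_index n x.2))| <= grid_variation n t.
  have [l1 /eqP l2] := tl.
  apply: (le_trans (variation_grid_le n t0 (lexx 0) l1)).
  rewrite l2 /grid_variation (@big_cat_nat _ _ _ (grid_index n t) 0 (gsize n))//=; last first.
    rewrite grid_index_le// grid_gsize (@le_trans _ _ n%:R) ?ler_nat//.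
    by near: n; exact: nbhs_infty_ger.
  rewrite (_ : grid_index n 0 = 0)%N; last first.
    by apply/eqP; rewrite -leqn0 grid_index_le// grid0.
  by rewrite lerDl sumr_ge0.
have : `|variation 0 t f l - \sum_(x <- zip l (0 :: l)) `|f (clip n t (grid_index n x.1))
      - f (clip n t (grid_index n x.2))| | <= e / 2.
  by near: n; apply: cl; rewrite divr_gt0.
rewrite ler_norml => /andP[h1 h2] h3 h4; rewrite ger0_norm ?subr_ge0//; lra.
Unshelve. all: by end_near. Qed.

(** The grid increments ending before [t] contribute at most [c] together. A single further one
    reaches [t]; it costs at most [|f t|] plus the value of [|f|] just before, itself at most
    [c + |f 0|]. *)
Lemma tv_jump t c : 0 <= t -> 0 <= c -> (forall s, 0 <= s -> s < t -> tv s <= c) ->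
  tv t <= 2 * c + `|f t| + `|f 0|.
Proof.
move=> t0 c0 sc.
have fc s : 0 <= s -> s < t -> `|f s| <= c + `|f 0|.
  move=> s0 st; have := tv_increment (lexx 0) s0; rewrite tv0 subr0 => h.
  rewrite -[f s](subrK (f 0)) (le_trans (ler_normD _ _))// lerD2r (le_trans h)//.
  exact: sc.
have H n j : \sum_(0 <= i < j) `|f (clip n t i.+1) - f (clip n t i)| <=
    if grid n j < t then c else 2 * c + `|f t| + `|f 0|.
  case: ifPn => [jt|].
    rewrite (le_trans (sum_increments_le _ _ t0))// /clip (min_r (ltW jt)).
    by apply: sc => //; exact: grid_ge0.
  elim: j => [|j ih]; first by rewrite big_geq// => _; rewrite !addr_ge0// mulr_ge0.
  rewrite -leNgt => tj; rewrite big_nat_recr//=.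
  have [jt|jt] := boolP (grid n j < t); last first.
    rewrite -leNgt in jt; rewrite /clip !min_l// subrr normr0 addr0.
    by apply: ih; rewrite -leNgt.
  have c1 : clip n t j.+1 = t by rewrite /clip min_l.
  have c2 : clip n t j = grid n j by rewrite /clip (min_r (ltW jt)).
  have h := le_trans (sum_increments_le n j t0) (_ : tv (clip n t j) <= c).
  rewrite c1 c2 in h *; have {}h := h (sc _ (grid_ge0 _ _) jt).
  have := fc _ (grid_ge0 n j) jt; have := ler_normB (f t) (f (grid n j)); lra.
have /cvg_lim <- // := cvg_grid_variation t0.
apply: limr_le; first by apply/cvg_ex; exists (tv t); exact: cvg_grid_variation.
apply: nearW => n; apply: (le_trans (H n (gsize n))); case: ifP => // _.
have := normr_ge0 (f t); have := normr_ge0 (f 0); lra.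
Qed.

End total_variation.

Lemma nondecreasing_left_limit (R : realType) (f : R -> R) (t : R) :
  (forall r s, 0 <= r -> r <= s -> s <= t -> f r <= f s) -> 0 < t ->
  cvg (f s @[s --> t^'-]).
Proof.
move=> fnd t0; apply: nondecreasing_at_left_is_cvgr.
  apply: (filterS (P := fun x : R => 0 <= x)); last exact: nbhs_left_ge.
  move=> x x0 r s; rewrite !in_itv/= => /andP[xr _] /andP[xs st] rs.
  by apply: fnd => //; [rewrite (le_trans x0)// ltW|exact: ltW].
apply: (filterS (P := fun x : R => 0 <= x)); last exact: nbhs_left_ge.
move=> x x0; exists (f t) => y [r /=]; rewrite in_itv/= => /andP[xr rt] <-.
by apply: fnd; rewrite ?(ltW rt)// (le_trans x0)// ltW.
Qed.

Section finite_variation.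
Context {R : realType} {d : measure_display} {T : measurableType d}.
Variables (P : probability T R) (F : R -> set (set T)).
Hypothesis hF : usual_filtration P F.
Implicit Types (X Y Z v : R -> T -> R) (w : T) (s t : R).

Definition variation_process v t w : R := tv (v ^~ w) t.

Section variation_process.
Variable v : R -> T -> R.
Hypothesis hv : finite_variation_process F v.

Let vr w t : 0 <= t -> v x w @[x --> t^'+] --> v t w.
Proof. by case: hv => _ cv _ _ t0; have [] := cv w t t0. Qed.

Let vbv w t : 0 <= t -> bounded_variation 0 t (v ^~ w).
Proof. by case: hv => _ _ _ + t0; apply. Qed.

Lemma variation_process0 w : variation_process v 0 w = 0.
Proof. exact: tv0. Qed.

Lemma variation_process_nd : nondecreasing_process (variation_process v).
Proof. by move=> w s t s0 st; apply: tv_nd => //; exact: vbv. Qed.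

Lemma variation_process_increment w s t : 0 <= s -> s <= t ->
  `|v t w - v s w| <= variation_process v t w - variation_process v s w.
Proof. by move=> s0 st; apply: (@tv_increment _ (v ^~ w)) => //; exact: vbv. Qed.

Lemma norm_le_variation_process w t : 0 <= t -> `|v t w| <= variation_process v t w.
Proof.
move=> t0; have := variation_process_increment w (lexx 0) t0.
by case: hv => _ _ -> _; rewrite variation_process0 !subr0.
Qed.

Lemma variation_process_cadlag : cadlag (variation_process v).
Proof.
move=> w t t0; split; first by apply: tv_right => //; [exact: vr|exact: vbv].
by move=> tp; apply: nondecreasing_left_limit => // r s r0 rs _; exact: variation_process_nd.
Qed.

Lemma variation_process_adapted : adapted F (variation_process v).
Proof.
move=> t t0; apply: (measurable_wrt_cvg hF
  (f := fun n w => grid_variation (v ^~ w) n t)) => // [n|w].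
  apply: (measurable_wrt_sum hF) => // i; apply: (measurable_wrt_norm hF) => //.
  have av : adapted F v by case: hv.
  have mclip j : measurable_wrt (F t) (v (clip n t j)).
    by apply: (measurable_wrt_mono hF _ _ (av _ _)); rewrite ?clip_ge0 ?clip_le.
  exact: (measurable_wrtB hF).
by apply: cvg_grid_variation => //; [exact: vr|exact: vbv].
Qed.

(** With [V] the variation process, [v = V - (V - v)] is the decomposition into nondecreasing
    processes used from here on; the form [+ -1 *] matches the linearity lemmas. *)
Lemma variation_process_sub_nd :
  nondecreasing_process (fun t w => variation_process v t w + -1 * v t w).
Proof.
move=> w s t s0 st; have := variation_process_increment w s0 st.
rewrite ler_norml => /andP[_]; lra.
Qed.

End variation_process.

Lemma finite_variation_processD (v w : R -> T -> R) : finite_variation_process F v ->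
  finite_variation_process F w -> finite_variation_process F (fun t o => v t o + w t o).
Proof.
move=> [av cv v0 bv] [aw cw w0 bw]; split.
- by have := adapted_lin hF 1 av aw; under eq_fun do under eq_fun do rewrite mul1r.
- by have := cadlag_lin 1 cv cw; under eq_fun do under eq_fun do rewrite mul1r.
- by move=> o; rewrite v0 w0 addr0.
- move=> o t; rewrite le_eqVlt => /predU1P[<-|t0]; first exact: bounded_variationxx.
  by apply: bounded_variationD => //; [apply: bv|apply: bw]; exact: ltW.
Qed.

Lemma finite_variation_processB (v w : R -> T -> R) : finite_variation_process F v ->
  finite_variation_process F w -> finite_variation_process F (fun t o => v t o - w t o).
Proof.
move=> fv [aw cw w0 bw]; apply: finite_variation_processD => //.
have wE : (fun t o => - w t o) = (fun t o => w t o + -2 * w t o).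
  by apply/funext => t; apply/funext => o; lra.
split.
- by rewrite wE; exact: (adapted_lin hF).
- by rewrite wE; exact: cadlag_lin.
- by move=> o; rewrite w0 oppr0.
- by move=> o t t0; apply/bounded_variationN; exact: bw.
Qed.

End finite_variation.

(** * The predictable sigma-algebra *)

Section predictable.
Context {R : realType} {d : measure_display} {T : measurableType d}.
Variables (P : probability T R) (F : R -> set (set T)).
Hypothesis hF : usual_filtration P F.
Implicit Types (X Y Z v : R -> T -> R) (w : T) (s t : R).

Let E : set (R * T) := [set z | 0 <= z.1].

(** The sets whose trace on nonnegative times is predictable. They form a sigma-algebra on all of
    [R * T], for which predictability is plain measurability whatever the values at negative
    times. *)
Definition predictable_sets : set (set (R * T)) :=
  [set B | <<s E, predictable_rectangle F >> (E `&` B)].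

Lemma predictable_sigma_algebra : sigma_algebra setT predictable_sets.
Proof.
have sG := smallest_sigma_algebra E (predictable_rectangle F).
case: sG => G0 GC GU; split.
- by rewrite /predictable_sets/= setI0.
- move=> A; rewrite /predictable_sets/= => /GC; congr (<<s E, _ >> _).
  by rewrite setTD; apply/seteqP; split => z /= [Ez]; [move=> h|]; split => //; [move=> Az; apply: h|case].
- move=> A /= GA; rewrite /predictable_sets/= setI_bigcupr; exact: GU.
Qed.

Lemma predictableP X : predictable F X <->
  measurable_wrt predictable_sets (fun z : R * T => X z.1 z.2).
Proof. by []. Qed.

Lemma measurable_domain : measurable E.
Proof.
have := @measurable_fst _ _ R T measurableT _ (measurable_itv `[0, +oo[).
by rewrite setTI; congr measurable; apply/seteqP; split => z /=; rewrite in_itv/= andbT.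
Qed.

Lemma predictable_rectangle_measurable : predictable_rectangle F `<=` measurable.
Proof.
move=> _ [[A FA ->]|[s [t [A [s0 st FA ->]]]]]; apply: measurableX => //.
- exact: (F_measurable hF _ FA).
- exact: (F_measurable hF _ FA).
Qed.

Lemma predictable_measurable B : predictable_sets B -> measurable (E `&` B).
Proof.
have sE : sigma_algebra E (measurable : set (set (R * T))).
  split; first exact: measurable0.
  - by move=> A mA; apply: measurableD => //; exact: measurable_domain.
  - by move=> A mA; exact: bigcupT_measurable.
exact: (smallest_sub sE predictable_rectangle_measurable).
Qed.

Lemma predictable_set0X A : F 0 A -> predictable_sets ([set 0] `*` A).
Proof.
move=> FA; apply: sub_sigma_algebra; left; exists A => //.
apply/seteqP; split => -[r z] /=; first by case.
by case=> -> Az; split => //; rewrite /E/=.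
Qed.

Lemma predictable_itvX s t A : 0 <= s -> s <= t -> F s A ->
  predictable_sets (`]s, t] `*` A).
Proof.
move=> s0 st FA; apply: sub_sigma_algebra; right; exists s, t, A; split => //.
apply/seteqP; split => z /=; first by case=> _.
rewrite in_itv/= => -[/andP[sz zt] Az]; split; last by rewrite sz zt.
by rewrite /E/= (le_trans s0)// ltW.
Qed.

Lemma predictable_setU A B : predictable_sets A -> predictable_sets B ->
  predictable_sets (A `|` B).
Proof.
move=> GA GB; have [G0 _ GU] := predictable_sigma_algebra.
by rewrite -bigcup2E; apply: GU => -[|[|n]].
Qed.

Lemma predictable_ext X Y : predictable F X ->
  (forall t w, 0 <= t -> X t w = Y t w) -> predictable F Y.
Proof.
move=> pX XY; apply/predictableP => B mB; have := pX B mB; congr (<<s _, _ >> _).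
by apply/seteqP; split => -[t w] /= [t0]; rewrite /E/= => h; split => //; rewrite ?XY// -XY.
Qed.

Lemma predictable_lin X Y k : predictable F X -> predictable F Y ->
  predictable F (fun t w => X t w + k * Y t w).
Proof.
have sG := predictable_sigma_algebra.
move=> /predictableP /(measurable_wrtP _ sG) mX /predictableP /(measurable_wrtP _ sG) mY.
apply/predictableP/(measurable_wrtP _ sG); apply: measurable_funD => //.
by apply: measurable_funM => //; exact: measurable_cst.
Qed.

Lemma predictableM X Y : predictable F X -> predictable F Y ->
  predictable F (fun t w => X t w * Y t w).
Proof.
have sG := predictable_sigma_algebra.
move=> /predictableP /(measurable_wrtP _ sG) mX /predictableP /(measurable_wrtP _ sG) mY.
by apply/predictableP/(measurable_wrtP _ sG); exact: measurable_funM.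
Qed.

Lemma predictable_cst (c : R) : predictable F (fun _ _ => c).
Proof.
have sG := predictable_sigma_algebra.
by apply/predictableP/(measurable_wrtP _ sG); exact: measurable_cst.
Qed.

Lemma predictable_cvg (X : nat -> R -> T -> R) Y : (forall n, predictable F (X n)) ->
  (forall t w, 0 <= t -> X n t w @[n --> \oo] --> Y t w) -> predictable F Y.
Proof.
have sG := predictable_sigma_algebra.
(* Convergence is only known at nonnegative times, so all processes are set to 0 at the others. *)
move=> pX XY; pose Z n t w := if 0 <= t then X n t w else 0.
pose Z' t w := if 0 <= t then Y t w else 0.
apply: (@predictable_ext Z'); last by move=> t w t0; rewrite /Z' t0.
apply/predictableP/(measurable_wrtP _ sG).
apply: (@measurable_fun_cvg _ (g_sigma_algebraType predictable_sets) R setT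
  (fun n z => Z n z.1 z.2)) => [n|z _].
  apply/(measurable_wrtP _ sG)/predictableP; apply: (predictable_ext (pX n)).
  by move=> t w t0; rewrite /Z t0.
by rewrite /Z /Z'; case: ifPn => z0; [exact: XY|exact: cvg_cst].
Qed.

Lemma predictable_sum (I : Type) (r : seq I) (X : I -> R -> T -> R) :
  (forall i, predictable F (X i)) -> predictable F (fun t w => \sum_(i <- r) X i t w).
Proof.
move=> pX; elim: r => [|i r ih].
  apply: (@predictable_ext (fun _ _ => 0)); first exact: predictable_cst.
  by move=> t w _; rewrite big_nil.
apply: (@predictable_ext (fun t w => X i t w + 1 * \sum_(j <- r) X j t w)).
  exact: predictable_lin.
by move=> t w _; rewrite big_cons mul1r.
Qed.

(** On each cell, open on the left, the sample is frozen at a value known at the left end, so a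
    preimage is a countable union of predictable rectangles. Time 0 is a separate slice, where
    [lgrid n 0 = 0]. *)
Lemma predictable_left_grid X n : adapted F X ->
  predictable F (fun s w => X (lgrid n s) w).
Proof.
move=> aX; apply/predictableP => B mB.
have [G0 _ GU] := predictable_sigma_algebra.
have H : predictable_sets (([set 0] `*` (X 0 @^-1` B)) `|`
   \bigcup_i (`]grid n i, grid n i.+1] `*` (X (grid n i) @^-1` B))).
  apply: predictable_setU; first by apply: predictable_set0X; exact: aX.
  apply: GU => i; apply: predictable_itvX; rewrite ?grid_ge0 ?le_grid//.
  by apply: aX => //; exact: grid_ge0.
move: H; rewrite /predictable_sets/=; congr (<<s _, _ >> _).
apply/seteqP; split => -[s w]; rewrite /E/= => -[s0 h]; split => //.
  case: h => [[-> h]|[i _ /= [+ h]]]; first by rewrite lgrid0.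
  rewrite in_itv/= => /andP[gs sg]; rewrite /lgrid (_ : grid_index n s = i.+1)//.
  by apply/eqP; rewrite eqn_leq grid_index_le// sg grid_index_gt.
move: s0; rewrite le_eqVlt => /predU1P[s0|s0].
  by left; rewrite -s0; split => //; move: h; rewrite -s0 lgrid0.
right; exists (grid_index n s).-1 => //; split => //=.
rewrite in_itv/= -/(lgrid n s) lgrid_lt//= prednK ?grid_index_gt0//.
by rewrite -/(rgrid n s) rgrid_ge// ltW.
Qed.

Lemma predictable_left_limit X Y : adapted F X ->
  (forall t w, 0 <= t -> X (lgrid n t) w @[n --> \oo] --> Y t w) -> predictable F Y.
Proof. by move=> aX; apply: predictable_cvg => n; exact: predictable_left_grid. Qed.

Lemma continuous_predictable X : adapted F X -> continuous_process X -> predictable F X.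
Proof.
move=> aX cX; apply: (predictable_left_limit aX) => t w t0.
apply: continuous_process_cvg => //; last exact: cvg_lgrid.
by move=> n; exact: lgrid_ge0.
Qed.

Lemma predictable_le_cst (c : R) : 0 <= c -> predictable F (fun s _ => (s <= c)%O%:R).
Proof.
move=> c0; have sG := predictable_sigma_algebra.
apply/predictableP; have -> : (fun z : R * T => (z.1 <= c)%O%:R) = \1_[set z : R * T | z.1 <= c] :> (_ -> R).
  by apply/funext => z; rewrite indicE; case: (boolP (z.1 <= c)) => h; [rewrite mem_set|rewrite memNset//; apply/negP].
apply/(measurable_wrtP _ sG)/measurable_indic; rewrite measurable_g_measurableTypeE//.
have H : predictable_sets (([set 0] `*` setT) `|` (`]0, c] `*` setT)).
  apply: predictable_setU; first by apply: predictable_set0X; exact: (F_setT hF).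
  by apply: predictable_itvX => //; exact: (F_setT hF).
move: H; rewrite /predictable_sets/=; congr (<<s _, _ >> _).
apply/seteqP; split => -[s w]; rewrite /E/= => -[s0 h]; split => //.
  by case: h => -[+ _]; [move=> ->|rewrite in_itv/= => /andP[]].
by move: s0; rewrite le_eqVlt => /predU1P[<-|s0]; [left|right; rewrite in_itv/= s0].
Qed.

(** Up to [c] this is [X] itself. After [c] it is the fixed variable [X c], a limit of left-grid
    samples that are cut at [c]. Applied at grid points, it makes Riemann sums predictable as
    functions of their upper limit. *)
Lemma predictable_min X (c : R) : 0 <= c -> adapted F X -> predictable F X ->
  predictable F (fun s w => X (Num.min s c) w).
Proof.
move=> c0 aX pX.
have pc : predictable F (fun s w => (s <= c)%O%:R * X s w).
  by apply: predictableM => //; exact: predictable_le_cst.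
have pX0 : predictable F (fun s w => X c w * (1 + -1 * (s <= c)%O%:R)).
  apply: (@predictable_cvg (fun n s w =>
     X (Num.min c (lgrid n s)) w * (1 + -1 * (s <= c)%O%:R))).
    move=> n; apply: predictableM; last first.
      by apply: predictable_lin; [exact: predictable_cst|exact: predictable_le_cst].
    apply: (@predictable_left_grid (fun s w => X (Num.min c s) w)) => t t0.
    by apply: (measurable_wrt_mono hF _ _ (aX _ _)); rewrite ?le_min ?c0 ?t0// ge_min lexx orbT.
  move=> t w t0; have [tc|] := boolP (t <= c).
    by rewrite mulN1r subrr mulr0; under eq_fun do rewrite mulr0; exact: cvg_cst.
  rewrite -ltNge => ct; rewrite mulr0 addr0 mulr1.
  apply: cvg_trans (_ : (fun=> X c w) n @[n --> \oo] --> X c w); last exact: cvg_cst.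
  apply: near_eq_cvg; near=> n; rewrite mulr1 min_l//; apply: ltW; near: n.
  exact: (cvgr_gt t (cvg_lgrid t0)).
apply: (predictable_ext (predictable_lin 1 pc pX0)) => t w t0; rewrite (mul1r (_ * _)).
have [tc|] := boolP (t <= c); first by rewrite min_l// mul1r mulN1r subrr mulr0 addr0.
by rewrite -ltNge => ct; rewrite min_r ?(ltW ct)// mul0r mulr0 addr0 mulr1 add0r.
Unshelve. all: by end_near. Qed.

End predictable.

(** * Predictable local martingales of finite variation *)

Section image_measure.
Context {d1 d2 : measure_display} {T1 : measurableType d1} {T2 : measurableType d2}.
Context {R : realType}.

Definition image_measure (m : {measure set T1 -> \bar R}) (f : T1 -> T2)
    (mf : measurable_fun setT f) : {measure set T2 -> \bar R} :=
  measure_function_pushforward__canonical__measure_function_Measure m mf.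

End image_measure.

Lemma indic_itvoc (R : realType) (r s x : R) :
  \1_(`]r, s]%classic : set R) x = ((r < x)%O && (x <= s)%O)%:R :> R.
Proof.
rewrite indicE; case: (boolP (_ && _)) => h; first by rewrite mem_set//= in_itv.
by rewrite memNset//= in_itv; apply/negP.
Qed.

(** * The Doleans measure of an increasing process *)

Section increasing_measure.
Context {R : realType} {d : measure_display} {T : measurableType d}.
Variable P : probability T R.
Variables (a : R -> T -> R) (t : R).
Hypothesis t0 : 0 <= t.
Hypothesis ma : forall s, 0 <= s -> measurable_fun setT (a s).
Hypothesis nda : nondecreasing_process a.
Hypothesis ca : cadlag a.
Hypothesis a0 : forall w, a 0 w = 0.
Implicit Types (w : T) (u s r : R).

(** The generalized inverse of the path on [[0, t]]; adjoining the point [t] keeps the set nonempty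
    for levels above [a t w]. *)
Definition first_passage w u : R :=
  inf [set s | 0 <= s <= t /\ (u <= a s w \/ s = t)].

Let hlb w u : has_lbound [set s | 0 <= s <= t /\ (u <= a s w \/ s = t)].
Proof. by exists 0 => s [/andP[]]. Qed.

Let neS w u : [set s | 0 <= s <= t /\ (u <= a s w \/ s = t)] !=set0.
Proof. by exists t; rewrite /= t0 lexx; split => //; right. Qed.

Lemma first_passage_ge0 w u : 0 <= first_passage w u.
Proof. by apply: lb_le_inf => // s [/andP[]]. Qed.

Lemma first_passage_le w u : first_passage w u <= t.
Proof. by apply: ge_inf => //=; rewrite t0 lexx; split => //; right. Qed.

(** If [a s w < u], right-continuity keeps the path below [u] a little beyond [s], which pushes the
    infimum strictly past [s]. The case [s = t] is excluded because [t] belongs to the set at every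
    level. *)
Lemma first_passage_leP w u s : 0 <= s -> s < t ->
  (first_passage w u <= s) = (u <= a s w).
Proof.
move=> s0 st; apply/idP/idP; last first.
  by move=> us; apply: ge_inf => //=; rewrite s0 ltW//; split => //; left.
apply: contraTT; rewrite -!ltNge => asu.
have [ar _] := ca w s0.
have [e /= e0 He] : \forall x \near s^'+, a x w < u.
  by move/cvgrPdist_lt : ar => /(_ (u - a s w)); rewrite subr_gt0 => /(_ asu);
    apply: filterS => x; rewrite ltr_distlC => /andP[_]; rewrite addrC subrK.
pose q := Num.min t (s + e / 2).
have sq : s < q by rewrite lt_min st/= ltrDl divr_gt0.
apply: (lt_le_trans sq); apply: lb_le_inf => // x [/andP[x0 xt] [ux|->]]; last by rewrite ge_min lexx.
rewrite leNgt; apply/negP => xq.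
have [xs|sx] := boolP (x <= s).
  by have := nda w x0 xs; rewrite leNgt (lt_le_trans asu).
rewrite -ltNge in sx.
have xse : x < s + e / 2 by apply: lt_le_trans xq _; rewrite ge_min lexx orbT.
have h : `|s - x| < e by rewrite ltr0_norm ?subr_lt0// opprB; lra.
by have := He x h sx; rewrite ltNge ux.
Qed.

Let TR := (T * measurableTypeR R)%type.

Definition below s : set TR := [set z | z.2 <= a s z.1].

Lemma measurable_below s : 0 <= s -> measurable (below s).
Proof.
move=> s0.
have mf : measurable_fun [set: TR] (fun z => a s z.1 - z.2).
  by apply: measurable_funB; [apply: measurableT_comp => //; exact: ma|exact: measurable_snd].
have := mf measurableT _ (measurable_itv `[0, +oo[); rewrite setTI; congr measurable.
by apply/seteqP; split => z /=; rewrite in_itv/= andbT subr_ge0.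
Qed.

Definition subgraph : set TR := [set z | 0 < z.2] `&` below t.

Lemma measurable_subgraph : measurable subgraph.
Proof.
apply: measurableI; last exact: measurable_below.
have := @measurable_snd _ _ T (measurableTypeR R) measurableT _ (measurable_itv `]0, +oo[).
by rewrite setTI; congr measurable; apply/seteqP; split => z /=; rewrite in_itv/= andbT.
Qed.

Lemma first_passage_subgraph z s : subgraph z -> 0 <= s -> s <= t ->
  (first_passage z.1 z.2 <= s) = (z.2 <= a s z.1).
Proof.
move=> [_ zt] s0; rewrite le_eqVlt => /predU1P[->|st]; last exact: first_passage_leP.
by rewrite first_passage_le zt.
Qed.

(* Outside the subgraph the image point is sent out of the time domain. *)
Definition passage_map (z : TR) : R * T :=
  (if z \in subgraph then first_passage z.1 z.2 else -1, z.1).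

Lemma measurable_passage_map : measurable_fun setT passage_map.
Proof.
apply/measurable_fun_pairP; split; last exact: measurable_fst.
apply: (measurability (@RGenOInfty.G R)) => [|/= _ [_ [c ->] <-]].
  exact: RGenOInfty.measurableE.
rewrite setTI.
have [c1|c1] := boolP (c < -1).
  rewrite (_ : _ @^-1` _ = setT)//; apply/seteqP; split => // z _ /=.
  rewrite in_itv/= andbT; case: ifP => _ //.
  by have := first_passage_ge0 z.1 z.2; lra.
rewrite -leNgt in c1.
(* For [-1 <= c < 0] the preimage is the whole subgraph, since only points outside it get a negative
   time. *)
rewrite (_ : _ @^-1` _ = if 0 <= c then if c < t then subgraph `\` below c else set0 else subgraph).
  case: ifP => [c0|_]; last exact: measurable_subgraph.
  case: ifP => // _.
  by apply: measurableD; [exact: measurable_subgraph|exact: measurable_below].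
apply/seteqP; split => z /=; rewrite in_itv/= andbT.
  case: ifPn => [zs zc|zs]; last by rewrite ltNge c1.
  rewrite inE in zs; case: ifPn => // c0; case: ifPn => [ct|].
    by split => //; rewrite /below/= -(first_passage_leP _ _ c0 ct); apply/negP; rewrite -ltNge.
  by rewrite -leNgt => tc; move: zc; rewrite ltNge (le_trans (first_passage_le _ _)).
case: ifPn => [c0|]; last first.
  rewrite -ltNge => c0 zs; rewrite mem_set//.
  by rewrite (lt_le_trans c0)// first_passage_ge0.
case: ifPn => // ct [zs /negP zc]; rewrite mem_set//.
by rewrite ltNge first_passage_leP.
Qed.

(* The measure [P(dw) da(w)] on [`]0, t] `*` T]: [u |-> first_passage w u] carries the
   Lebesgue measure of [`]0, a t w]] to the Stieltjes measure of [a ^~ w]. *)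
Definition increasing_measure : {measure set (R * T) -> \bar R} :=
  image_measure (P \x (@lebesgue_measure R))%E measurable_passage_map.

Let E : set (R * T) := [set z | 0 <= z.1].

Lemma passage_map_domain : passage_map @^-1` E = subgraph.
Proof.
apply/seteqP; split => z; rewrite /E/=.
  by case: ifPn => [|_]; [rewrite inE|lra].
by move=> zs; rewrite mem_set// first_passage_ge0.
Qed.

Lemma passage_map_itv (z : TR) r s : subgraph z -> 0 <= r -> r <= s -> s <= t ->
  \1_(`]r, s]%classic : set R) (passage_map z).1 = \1_(`]a r z.1, a s z.1]%classic : set R) z.2 :> R.
Proof.
move=> zs r0 rs st; rewrite !indic_itvoc /passage_map/= mem_set//=.
by rewrite ltNge !first_passage_subgraph// ?(le_trans rs)// ?(le_trans r0)// -ltNge.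
Qed.

(** Fubini: for fixed [w], the levels whose first passage falls in []r, s]] are those of []a r w, a
    s w]], an interval of length [a s w - a r w]. *)
Lemma integral_increasing_measure (Y : T -> R) r s : measurable_fun setT Y ->
  (forall w, 0 <= Y w) -> 0 <= r -> r <= s -> s <= t ->
  (\int[increasing_measure]_(z in E) (Y z.2 * \1_(`]r, s]%classic : set R) z.1)%:E =
   \int[P]_w (Y w * (a s w - a r w))%:E)%E.
Proof.
move=> mY Y0 r0 rs st.
have s0 := le_trans r0 rs.
have mE : measurable E by exact: measurable_domain.
rewrite ge0_integral_pushforward//.
- rewrite passage_map_domain.
  rewrite integral_mkcond.
  transitivity (\int[P \x (@lebesgue_measure R)]_z
      (Y z.1 * \1_(`]a r z.1, a s z.1]%classic : set R) z.2)%:E)%E.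
    apply: eq_integral => z _; rewrite patchE; case: ifPn => zs.
      by rewrite /= passage_map_itv//; rewrite inE in zs.
    rewrite indic_itvoc; case: (boolP (_ && _)) => [/andP[h1 h2]|]; last by rewrite mulr0.
    exfalso; move: zs; rewrite notin_setE; apply; split => /=.
      by apply: le_lt_trans h1; rewrite -(a0 z.1) nda.
    by rewrite /below/= (le_trans h2)// nda.
  rewrite fubini_tonelli1//.
  + apply: eq_integral => w _; rewrite /fubini_F/=.
    under eq_integral do rewrite EFinM.
    rewrite ge0_integralZl_EFin//.
    * rewrite integral_indic// setIT.
      rewrite -[X in (_ * X)%E]/(@lebesgue_measure R `]a r w, a s w]%classic) lebesgue_measure_itv/= lte_fin.
      rewrite EFinM; congr (_ * _)%E; case: ifPn => //.
      by rewrite -leNgt => h; have := nda w r0 rs => h'; congr EFin; lra.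
    * by apply/measurable_EFinP; exact: measurable_indic.
  + apply/measurable_EFinP; apply: measurable_funM.
      by apply: measurableT_comp => //; exact: measurable_fst.
    rewrite (_ : (fun z : TR => _) = \1_(below s `\` below r)).
      by apply: measurable_indic; apply: measurableD; apply: measurable_below.
    apply/funext => z; rewrite indic_itvoc indicE; case: (boolP (_ && _)) => [/andP[h1 h2]|h].
      by rewrite mem_set//; split => //; rewrite /below/=; apply/negP; rewrite -ltNge.
    rewrite memNset// => -[h1 /negP]; rewrite /below/= -ltNge => h2.
    by move: h; rewrite h2/= h1.
  + by move=> z; rewrite lee_fin mulr_ge0.
- exact: measurable_passage_map.
- apply/measurable_EFinP; apply: measurable_funM.
    by apply: measurableT_comp; [exact: mY|apply: measurable_funTS; exact: measurable_snd].
  by apply: measurableT_comp; [exact: measurable_indic|apply: measurable_funTS; exact: measurable_fst].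
- by move=> z _; rewrite lee_fin mulr_ge0.
Qed.

Lemma increasing_measure_itvX r s A : measurable A -> 0 <= r -> r <= s -> s <= t ->
  increasing_measure (`]r, s] `*` A) = (\int[P]_w (\1_A w * (a s w - a r w))%:E)%E.
Proof.
move=> mA r0 rs st; rewrite -integral_increasing_measure//.
have mE : measurable E by exact: measurable_domain.
have mX : measurable (`]r, s]%classic `*` A : set (R * T)) by apply: measurableX.
transitivity (\int[increasing_measure]_(z in E) (\1_(`]r, s]%classic `*` A) z)%:E)%E.
  rewrite integral_indic// setIidl// => z /= [+ _]; rewrite in_itv/= => /andP[rz _].
  by rewrite /E/= (le_trans r0)// ltW.
apply: eq_integral => z _; rewrite !indicE in_setX/= mulrC -natrM mulnb//.
Qed.

(** No mass lies at times after [t], so a rectangle reaching beyond [t] may be cut there; the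
    formula for rectangles is only available up to [t]. *)
Lemma increasing_measure_clip r s A :
  increasing_measure (`]r, s] `*` A) =
  increasing_measure (`]Num.min r t, Num.min s t] `*` A).
Proof.
rewrite /increasing_measure /image_measure/= /pushforward; congr (_ _).
apply/seteqP; split => z /=; rewrite !in_itv/=; case: ifPn => zs.
- move=> [/andP[h1 h2] Az]; split => //.
  by rewrite gt_min h1 le_min h2 first_passage_le.
- move=> [/andP[h1 h2] Az]; split => //.
  by rewrite gt_min h1 le_min h2 (le_trans _ t0)// oppr_le0.
- move=> [/andP[h1 h2] Az]; split => //; move: h1 h2.
  rewrite gt_min le_min => /orP[->/= /andP[]//|]; last by rewrite ltNge first_passage_le.
- move=> [/andP[h1 h2] Az]; split => //; move: h1 h2.
  rewrite gt_min le_min => /orP[->/= /andP[]//|]; last first.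
  by move=> /(le_lt_trans t0); rewrite oppr_gt0 ltr10.
Qed.

Lemma increasing_measure_domain :
  increasing_measure E = increasing_measure (`]0, t] `*` setT).
Proof.
rewrite /increasing_measure /image_measure/= /pushforward; congr (_ _).
rewrite passage_map_domain; apply/seteqP; split => z /=; last first.
  rewrite in_itv/=; case: ifPn => [|_]; first by rewrite inE.
  by move=> [/andP[]]; rewrite oppr_gt0 ltr10.
move=> zs; rewrite mem_set// in_itv/= first_passage_le andbT; split => //.
rewrite ltNge first_passage_subgraph// a0 -ltNge.
by case: zs.
Qed.

Lemma increasing_measure_0X A : increasing_measure ([set 0] `*` A) = 0%E.
Proof.
rewrite /increasing_measure /image_measure/= /pushforward.
rewrite (_ : _ @^-1` _ = set0) ?measure0//; apply/seteqP; split => // z /= [].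
case: ifPn => [|_]; last by move=> h; exfalso; lra.
rewrite inE => zs; move=> z0 _.
have : first_passage z.1 z.2 <= 0 by rewrite z0.
rewrite first_passage_subgraph// a0; case: zs => /= h _; rewrite leNgt h//.
Qed.

End increasing_measure.

(** * A bounded substitute for the square *)

Section bounded_chain_rule.
Context {R : realType}.
Implicit Types (x y : R).

(* A bounded function vanishing only at 0, with difference quotient bounded
   by 1: a substitute for the square that requires no moments. *)
Definition bounded_square x := x ^+ 2 / (1 + x ^+ 2).

(** The difference quotient of [bounded_square] in closed form, hence continuous also across
    [x = y], where it is the derivative. Jumps and continuous motion are thus treated by one
    formula. *)
Definition bounded_slope x y := (x + y) * ((1 + x ^+ 2)^-1 * (1 + y ^+ 2)^-1).

Lemma one_sqr_gt0 x : 0 < 1 + x ^+ 2.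
Proof. by rewrite ltr_pwDl// sqr_ge0. Qed.

Lemma bounded_slopeE x y :
  bounded_square y - bounded_square x = bounded_slope x y * (y - x).
Proof.
rewrite /bounded_square /bounded_slope.
have := one_sqr_gt0 x; have := one_sqr_gt0 y => /lt0r_neq0 hy /lt0r_neq0 hx.
by field; rewrite hx hy.
Qed.

Lemma bounded_slope_le1 x y : `|bounded_slope x y| <= 1.
Proof.
rewrite /bounded_slope -invfM ler_norml ler_pdivlMr ?ler_pdivrMr ?mulr_gt0 ?one_sqr_gt0//.
(* These squares give [|x| <= x^2 + 1/4] and the same for [y], so [|x + y|] is below
   [1 + x^2 + y^2 + x^2 y^2]. *)
have := sqr_ge0 (x - 2^-1); have := sqr_ge0 (y - 2^-1).
have := sqr_ge0 (x + 2^-1); have := sqr_ge0 (y + 2^-1).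
have := sqr_ge0 (x * y).
rewrite !expr2; nra.
Qed.

Lemma bounded_square_ge0 x : 0 <= bounded_square x.
Proof. by rewrite mulr_ge0 ?sqr_ge0// invr_ge0 ltW// one_sqr_gt0. Qed.

Lemma bounded_square_le1 x : bounded_square x <= 1.
Proof. by rewrite ler_pdivrMr ?one_sqr_gt0// mul1r lerDr. Qed.

Lemma bounded_square_eq0 x : bounded_square x = 0 -> x = 0.
Proof.
move=> /eqP; rewrite mulf_eq0 invr_eq0 (gt_eqF (one_sqr_gt0 x)) orbF.
by rewrite sqrf_eq0 => /eqP.
Qed.

Lemma bounded_square0 : bounded_square 0 = 0.
Proof. by rewrite /bounded_square expr0n mul0r. Qed.

Lemma continuous_inv_one_sqr : continuous (fun x => (1 + x ^+ 2)^-1 : R).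
Proof.
move=> x; apply: cvgV; first by rewrite gt_eqF// one_sqr_gt0.
by apply: cvgD; [exact: cvg_cst|exact: exprn_continuous].
Qed.

Lemma bounded_slope_cvg (u v : nat -> R) (x y : R) :
  u n @[n --> \oo] --> x -> v n @[n --> \oo] --> y ->
  bounded_slope (u n) (v n) @[n --> \oo] --> bounded_slope x y.
Proof.
have cinv (z : nat -> R) (r : R) : z n @[n --> \oo] --> r ->
    (1 + z n ^+ 2)^-1 @[n --> \oo] --> (1 + r ^+ 2)^-1.
  move=> zr; apply: cvgV; first by rewrite gt_eqF// one_sqr_gt0.
  by apply: cvgD; [exact: cvg_cst|rewrite expr2; under eq_fun do rewrite expr2; exact: cvgM].
move=> ux vy; apply: cvgM; first exact: cvgD.
by apply: cvgM; exact: cinv.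
Qed.

Lemma measurable_bounded_slope d (S : measurableType d) (f g : S -> R) :
  measurable_fun setT f -> measurable_fun setT g ->
  measurable_fun setT (fun z => bounded_slope (f z) (g z)).
Proof.
have mi : measurable_fun setT (fun x : R => (1 + x ^+ 2)^-1).
  by apply: continuous_measurable_fun; exact: continuous_inv_one_sqr.
move=> mf mg; apply: measurable_funM; first exact: measurable_funD.
by apply: measurable_funM; [exact: (measurableT_comp mi mf)|exact: (measurableT_comp mi mg)].
Qed.

Lemma measurable_bounded_square d (S : measurableType d) (f : S -> R) :
  measurable_fun setT f -> measurable_fun setT (fun z => bounded_square (f z)).
Proof.
have mi : measurable_fun setT (fun x : R => (1 + x ^+ 2)^-1).
  by apply: continuous_measurable_fun; exact: continuous_inv_one_sqr.
move=> mf; apply: measurable_funM; first exact: measurable_funX.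
exact: (measurableT_comp mi mf).
Qed.

End bounded_chain_rule.

(** * Measures compared on predictable sets *)

Section predictable_measures.
Context {R : realType} {d : measure_display} {T : measurableType d}.
Variables (P : probability T R) (F : R -> set (set T)).
Hypothesis hF : usual_filtration P F.
Let E : set (R * T) := [set z | 0 <= z.1].
Variables m1 m2 : {measure set (R * T) -> \bar R}.
Hypothesis m1E : (m1 E < +oo)%E.
Hypothesis m12E : m1 E = m2 E.
Hypothesis m12 : forall B, predictable_rectangle F B -> m1 B = m2 B.

Let rect_sub B : predictable_rectangle F B -> B `<=` E.
Proof.
case=> [[A _ ->]|[s [t [A [s0 _ _ ->]]]]] z /= [].
  by rewrite /E/= => ->.
by rewrite in_itv/= => /andP[sz _] _; rewrite /E/= (le_trans s0)// ltW.
Qed.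

Lemma predictable_rectangle_setI : setI_closed (predictable_rectangle F).
Proof.
move=> A B [[A' FA ->]|[s [t [A' [s0 st FA ->]]]]] [[B' FB ->]|[s' [t' [B' [s0' st' FB ->]]]]].
- left; exists (A' `&` B'); first exact: (F_setI hF).
  by apply/seteqP; split => z /=; [move=> [[-> ?] [_ ?]]|move=> [-> [? ?]]].
- left; exists set0; first exact: (F_set0 hF).
  apply/seteqP; split => z /=; last by case.
  by move=> [[-> _] []]; rewrite in_itv/= ltNge s0'.
- left; exists set0; first exact: (F_set0 hF).
  apply/seteqP; split => z /=; last by case.
  by move=> [[+ _] [z0 _]]; rewrite z0 in_itv/= ltNge s0.
- have [h|h] := boolP (Num.max s s' <= Num.min t t'); last first.
    left; exists set0; first exact: (F_set0 hF).
    apply/seteqP; split => z /=; last by case.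
    rewrite !in_itv/= => -[[/andP[h1 h2] _] [/andP[h3 h4] _]]; exfalso.
    move: h; apply/negP; rewrite negbK ge_max !le_min; apply/andP; split; apply/andP; split.
    + exact: ltW (lt_le_trans h1 h2).
    + exact: ltW (lt_le_trans h1 h4).
    + exact: ltW (lt_le_trans h3 h2).
    + exact: ltW (lt_le_trans h3 h4).
  right; exists (Num.max s s'), (Num.min t t'), (A' `&` B'); split => //.
  + by rewrite le_max s0.
  + have ss : 0 <= Num.max s s' by rewrite le_max s0.
    apply: (F_setI hF) => //.
      by apply: (F_mono hF _ _ FA) => //; rewrite le_max lexx.
    by apply: (F_mono hF _ _ FB) => //; rewrite le_max lexx orbT.
  + apply/seteqP; split => z /=; rewrite !in_itv/= gt_max le_min.
      by move=> [[/andP[-> ->] ?] [/andP[-> ->] ?]].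
    by move=> [/andP[/andP[-> ->] /andP[-> ->]] [? ?]].
Qed.

(** Rectangles are closed under intersection, a slice at time 0 and an interval []s, t]] being
    disjoint. [E] is not itself a rectangle, so equality of the finite total masses is supplied
    separately. *)
Lemma predictable_measure_unique B : predictable_sets F B -> m1 (E `&` B) = m2 (E `&` B).
Proof.
have mE : measurable E by exact: measurable_domain.
have GE : [set X | predictable_rectangle F X /\ X `<=` E] = predictable_rectangle F.
  by apply/seteqP; split => X /=; [case|move=> h; split => //; exact: rect_sub].
rewrite /predictable_sets/= -GE.
apply: (g_sigma_algebra_measure_unique_trace (predictable_rectangle F) E mE) => //.
- by rewrite GE; exact: (predictable_rectangle_measurable hF).
- by rewrite GE; exact: predictable_rectangle_setI.
- by move=> X; rewrite GE; exact: m12.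
- move=> X; rewrite GE => h.
  have sE : sigma_algebra E [set X | X `<=` E].
    split => //; first by move=> A AE x [].
    by move=> A AE x [i _ Ax]; exact: (AE i).
  exact: (smallest_sub sE rect_sub h).
Qed.

(** [predictable_sets] puts no constraint on a set outside [E]. Intersecting with the product
    sigma-algebra makes the identity map measurable into [G]. *)
Let G : set (set (R * T)) := [set B | predictable_sets F B /\ measurable B].

Let sG : sigma_algebra setT G.
Proof.
have [p0 pC pU] := predictable_sigma_algebra F; split.
- by split => //; exact: measurable0.
- by move=> A [pA mA]; split; [exact: pC|rewrite setTD; exact: measurableC].
- by move=> A GA; split; [apply: pU => n; have [] := GA n|apply: bigcupT_measurable => n; have [] := GA n].
Qed.

(** The identity pushes both measures forward to the coarser sigma-algebra [G]. There they coincide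
    on subsets of [E], and [H] is still measurable, so no simple-function approximation is
    needed. *)
Lemma predictable_integral_eq (H : R -> T -> R) : predictable F H ->
  (forall s w, 0 <= s -> 0 <= H s w) ->
  (\int[m1]_(z in E) (H z.1 z.2)%:E = \int[m2]_(z in E) (H z.1 z.2)%:E)%E.
Proof.
move=> pH H0.
have mE : measurable E by exact: measurable_domain.
pose S := g_sigma_algebraType G.
pose id' : R * T -> S := fun z => z.
have mid : measurable_fun setT id'.
  by move=> _ B; rewrite measurable_g_measurableTypeE// => -[_ mB]; rewrite setTI.
have mES : @measurable _ S E.
  rewrite measurable_g_measurableTypeE//; split => //.
  rewrite /predictable_sets/= setIid.
  have [p0 pC _] := smallest_sigma_algebra E (predictable_rectangle F).
  by have := pC set0 p0; rewrite setD0.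
have mH : @measurable_fun _ _ S _ E (fun z : S => (H z.1 z.2)%:E).
  apply/measurable_EFinP => _ B mB; rewrite measurable_g_measurableTypeE//.
  have pB := pH B mB; split.
    by rewrite /predictable_sets/= setIA setIid.
  exact: (predictable_measurable hF pB).
rewrite -[LHS](@ge0_integral_pushforward _ _ _ _ _ id' mid m1 E (fun z : S => (H z.1 z.2)%:E))//; last first.
  by move=> z; rewrite inE => z0; rewrite lee_fin H0.
rewrite -[RHS](@ge0_integral_pushforward _ _ _ _ _ id' mid m2 E (fun z : S => (H z.1 z.2)%:E))//; last first.
  by move=> z; rewrite inE => z0; rewrite lee_fin H0.
apply: (@eq_measure_integral _ S _ _ (image_measure m2 mid) (image_measure m1 mid)) => A.
rewrite measurable_g_measurableTypeE// => -[pA mA] AE.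
rewrite /image_measure/= /pushforward.
have -> : id' @^-1` A = E `&` A by rewrite setIidr.
exact: predictable_measure_unique.
Qed.

End predictable_measures.

Lemma integrable_cst_finite d (S : measurableType d) (R : realType)
    (mu : {measure set S -> \bar R}) (D : set S) (c : R) :
  measurable D -> (mu D < +oo)%E -> mu.-integrable D (cst c%:E).
Proof.
move=> mD muD; apply/integrableP; split; first exact: measurable_cst.
by rewrite (_ : (fun z => _) = cst `|c|%:E) ?integral_cst// lte_mul_pinfty.
Qed.

Lemma expect_eq0_ae d (S : measurableType d) (R : realType)
    (mu : {measure set S -> \bar R}) (f : S -> R) :
  L1 mu f -> (forall x, 0 <= f x) -> expect mu f = 0 -> {ae mu, forall x, f x = 0}.
Proof.
move=> f1 f0 Ef; have mf : measurable_fun setT (EFin \o f).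
  by apply/measurable_EFinP; exact: L1_measurable f1.
have : (\int[mu]_x `|(EFin \o f) x| = 0)%E.
  rewrite -[RHS]/(0%:E) -Ef expectE//.
  by apply: eq_integral => x _ /=; rewrite ger0_norm.
move=> /(ae_eq_integral_abs mu measurableT mf).
by apply: filterS => x /(_ I) /= [].
Qed.

Section grid_step.
Context {R : realType}.
Implicit Types (s t : R) (c : nat -> R).

Lemma sum_grid_step n s t c : 0 <= t ->
  \sum_(i < grid_index n t) c i * \1_(`]clip n t i, clip n t i.+1]%classic : set R) s =
  if (0 < s)%O && (s <= t)%O then c (grid_index n s).-1 else 0.
Proof.
move=> t0; case: ifPn => [/andP[s0 st]|h].
  have si : ((grid_index n s).-1 < grid_index n t)%N.
    by rewrite prednK ?grid_index_gt0// le_grid_index// ltW.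
  rewrite (bigD1 (Ordinal si))//= indic_itvoc big1 ?addr0.
    rewrite prednK ?grid_index_gt0// le_min st/= -/(rgrid n s) rgrid_ge ?ltW// andbT.
    by rewrite /clip gt_min -/(lgrid n s) lgrid_lt// orbT mulr1.
  move=> i /eqP ih; rewrite indic_itvoc; case: (boolP (_ && _)) => [/andP[h1 h2]|]; last by rewrite mulr0.
  exfalso; apply: ih; apply/val_inj => /=.
  have h1' : grid n i < s.
    by move: h1; rewrite /clip gt_min => /orP[|//]; rewrite ltNge st.
  have h2' : s <= grid n i.+1 by move: h2; rewrite /clip le_min => /andP[].
  have : (grid_index n s <= i.+1)%N by rewrite grid_index_le// ltW.
  have : (i < grid_index n s)%N by rewrite grid_index_gt// ltW.
  by move=> h3 h4; have -> : grid_index n s = i.+1 by apply/eqP; rewrite eqn_leq h4.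
apply: big1 => i _; rewrite indic_itvoc; case: (boolP (_ && _)) => [/andP[h1 h2]|]; last by rewrite mulr0.
exfalso; move/negP : h; apply; rewrite (le_trans h2) ?clip_le// andbT.
by apply: le_lt_trans h1; exact: clip_ge0.
Qed.

Lemma clip_self n t : 0 <= t -> clip n t (grid_index n t) = t.
Proof. by move=> t0; rewrite /clip min_l// -grid_index_le. Qed.

Lemma clip_lgrid n s t : 0 < s -> s <= t -> clip n t (grid_index n s).-1 = lgrid n s.
Proof. by move=> s0 st; rewrite /clip -/(lgrid n s) min_r// (le_trans (ltW (lgrid_lt n s0))). Qed.

Lemma clip_rgrid_ge n s t : 0 < s -> s <= t -> s <= clip n t (grid_index n s).-1.+1.
Proof.
by move=> s0 st; rewrite prednK ?grid_index_gt0// le_min st rgrid_ge// ltW.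
Qed.

Lemma cvg_clip_rgrid s t : 0 < s -> s <= t ->
  clip n t (grid_index n s).-1.+1 @[n --> \oo] --> s.
Proof.
move=> s0 st; apply: (@cvg_le_dist _ _ _ _ _ (@harmonic R)); last exact: cvg_harmonic.
move=> n; rewrite ger0_norm ?subr_ge0 ?clip_rgrid_ge//.
rewrite prednK ?grid_index_gt0// lerBlDl (le_trans _ (rgrid_le n (ltW s0)))//.
by rewrite /clip ge_min lexx orbT.
Qed.

End grid_step.

(** * Predictable martingales of integrable variation *)

Section predictable_martingale.
Context {R : realType} {d : measure_display} {T : measurableType d}.
Variables (P : probability T R) (F : R -> set (set T)).
Hypothesis hF : usual_filtration P F.
Let E : set (R * T) := [set z | 0 <= z.1].
Variables a b : R -> T -> R.
Hypothesis aa : adapted F a.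
Hypothesis ab : adapted F b.
Hypothesis nda : nondecreasing_process a.
Hypothesis ndb : nondecreasing_process b.
Hypothesis ca : cadlag a.
Hypothesis cb : cadlag b.
Hypothesis a0 : forall w, a 0 w = 0.
Hypothesis b0 : forall w, b 0 w = 0.
Hypothesis a1 : forall s, 0 <= s -> L1 P (a s).
Hypothesis b1 : forall s, 0 <= s -> L1 P (b s).

Let A s w := a s w - b s w.

Hypothesis martA : martingale P F A.
Hypothesis predA : predictable F A.

Variable t : R.
Hypothesis t0 : 0 <= t.

Let ma s : 0 <= s -> measurable_fun setT (a s).
Proof. by move=> s0; exact: (adapted_measurable hF aa). Qed.

Let mb s : 0 <= s -> measurable_fun setT (b s).
Proof. by move=> s0; exact: (adapted_measurable hF ab). Qed.

Let mu_a := increasing_measure P t0 ma nda ca.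
Let mu_b := increasing_measure P t0 mb ndb cb.

Let A1 s : 0 <= s -> L1 P (A s).
Proof. by move=> s0; apply: L1B; [exact: a1|exact: b1]. Qed.

Let expect_increment B r s : 0 <= r -> r <= s -> F r B ->
  (\int[P]_w (\1_B w * (a s w - a r w))%:E = \int[P]_w (\1_B w * (b s w - b r w))%:E)%E.
Proof.
move=> r0 rs FB; have s0 := le_trans r0 rs; have mB := F_measurable hF r0 FB.
have [_ _ EA] := (martingaleP hF _).1 martA.
have La c : (forall s, 0 <= s -> L1 P (c s)) -> L1 P (fun w => \1_B w * (c s w - c r w)).
  move=> Lc; under eq_fun do rewrite mulrC.
  by apply: L1_indic => //; apply: L1B; exact: Lc.
rewrite -expectE ?La// -expectE ?La//; congr EFin.
apply/eqP; rewrite -subr_eq0 -expectB ?La//; apply/eqP.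
transitivity (expect P (fun w => A s w * \1_B w - A r w * \1_B w)).
  by apply: eq_expect => w; rewrite /A; ring.
rewrite expectB; [|by apply: L1_indic => //; exact: A1..].
by rewrite (EA _ _ _ r0 rs FB) subrr.
Qed.

(** For a rectangle over an event of [F s], the two masses are the expected increments of [a] and
    [b] on that event; the martingale property of [A = a - b] equates them. Slices at time 0 have no
    mass. *)
Let rect_eq B : predictable_rectangle F B -> mu_a B = mu_b B.
Proof.
case=> [[B' _ ->]|[s [r [B' [s0 sr FB ->]]]]].
  by rewrite !increasing_measure_0X.
rewrite increasing_measure_clip [RHS]increasing_measure_clip.
have m0 : 0 <= Num.min s t by rewrite le_min s0.
have mB := F_measurable hF s0 FB.
have mm : Num.min s t <= Num.min r t by rewrite le_min !ge_min sr lexx orbT.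
have mt : Num.min r t <= t by rewrite ge_min lexx orbT.
rewrite !increasing_measure_itvX//.
have [st|] := boolP (s <= t); first by apply: expect_increment; rewrite ?(min_l st)// le_min sr st.
rewrite -ltNge => ts; rewrite !min_r ?(ltW ts) ?(le_trans (ltW ts))//.
by apply: eq_integral => w _; rewrite !subrr.
Qed.

Let mE : measurable E. Proof. exact: measurable_domain. Qed.

Let mu_aE : 0 <= t -> (mu_a E < +oo)%E.
Proof.
move=> _.
rewrite /mu_a increasing_measure_domain// increasing_measure_itvX//.
rewrite -expectE ?ltry//; under eq_fun do rewrite mulrC.
by apply: L1_indic => //; apply: L1B; exact: a1.
Qed.

Let mu_bE : mu_a E = mu_b E.
Proof.
have -> : mu_a E = mu_a (`]0, t] `*` setT) by exact: increasing_measure_domain.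
have -> : mu_b E = mu_b (`]0, t] `*` setT) by exact: increasing_measure_domain.
apply: rect_eq; right; exists 0, t, setT; split => //; exact: (F_setT hF).
Qed.

(* The summand 1 makes the integrand nonnegative; it contributes the expectation
   of [A t], which is 0. *)
Let Y n i w := 1 + bounded_slope (A (clip n t i) w) (A (clip n t i.+1) w).

Let Y_bounds n i w : 0 <= Y n i w <= 2.
Proof. by have := bounded_slope_le1 (A (clip n t i) w) (A (clip n t i.+1) w); rewrite ler_norml /Y => /andP[? ?]; apply/andP; split; lra. Qed.

Let A0 w : A 0 w = 0.
Proof. by rewrite /A a0 b0 subrr. Qed.

Let mA s : 0 <= s -> measurable_fun setT (A s).
Proof. by move=> s0; exact: L1_measurable (A1 s0). Qed.

Let mY : 0 <= t -> forall n i, measurable_fun setT (Y n i).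
Proof.
move=> _ n i.
apply: measurable_funD; first exact: measurable_cst.
by apply: measurable_bounded_slope; apply: mA; exact: clip_ge0.
Qed.

(** The step integrand whose integrals are the telescoping sums. It looks ahead to the right end of
    each cell, so it need not be predictable and its two integrals may differ; only the limit [H] is
    compared under both measures. *)
Let H_ n (z : R * T) := \sum_(i < grid_index n t)
  Y n i z.2 * \1_(`]clip n t i, clip n t i.+1]%classic : set R) z.1.

Let mH_ : 0 <= t -> forall n, measurable_fun setT (H_ n).
Proof.
move=> _ n.
apply: measurable_sum => i; apply: measurable_funM.
  by apply: measurableT_comp; [exact: (mY t0 n i)|exact: measurable_snd].
by apply: measurableT_comp; [exact: measurable_indic|exact: measurable_fst].
Qed.

Let LY c n i : (forall s, 0 <= s -> L1 P (c s)) ->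
  L1 P (fun w => Y n i w * (c (clip n t i.+1) w - c (clip n t i) w)).
Proof.
move=> Lc; have Lcc : L1 P (fun w => 2 * (c (clip n t i.+1) w - c (clip n t i) w)).
  by apply: L1Z; apply: L1B; apply: Lc; exact: clip_ge0.
apply: (L1_le _ Lcc) => [|w].
  apply: measurable_funM; first exact: (mY t0 n i).
  by apply: measurable_funB; exact: (L1_measurable (Lc _ (clip_ge0 _ _ t0))).
rewrite 2!normrM; apply: ler_wpM2r; first exact: normr_ge0.
have /andP[Y0 Y2] := Y_bounds n i w.
by rewrite (ger0_norm Y0) (ger0_norm (ler0n R 2)).
Qed.

Let integral_H_ c (mc : forall s, 0 <= s -> measurable_fun setT (c s))
  (ndc : nondecreasing_process c) (cc : cadlag c) (c0 : forall w, c 0 w = 0)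
  (Lc : forall s, 0 <= s -> L1 P (c s)) n :
  (\int[increasing_measure P t0 mc ndc cc]_(z in E) (H_ n z)%:E =
  (expect P (fun w => \sum_(i < grid_index n t)
     Y n i w * (c (clip n t i.+1) w - c (clip n t i) w)))%:E)%E.
Proof.
rewrite expect_sum; last by move=> i; exact: LY.
rewrite -sumEFin; under eq_integral do rewrite -sumEFin.
set mu := increasing_measure _ _ _ _ _.
rewrite (ge0_integral_sum mu mE); last 2 first.
- move=> i; apply/measurable_EFinP; apply: measurable_funTS; apply: measurable_funM.
    exact: (measurableT_comp (mY t0 n i) (@measurable_snd _ _ _ _)).
  by apply: measurableT_comp; [exact: measurable_indic|exact: measurable_fst].
- by move=> i z _; rewrite lee_fin; apply: mulr_ge0; [by have /andP[] := Y_bounds n i z.2|rewrite indicE; exact: ler0n].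
apply: eq_bigr => i _.
rewrite (@integral_increasing_measure _ _ _ _ _ _ t0 mc ndc cc c0 _ _ _ (mY t0 n i) (fun w => proj1 (andP (Y_bounds n i w)))
  (clip_ge0 _ _ t0) (le_clip _ _ (leqnSn i)) (clip_le _ _ _)).
by rewrite expectE; last exact: LY.
Qed.

(** The left limit of [A], taken along the left grid points so that its predictability is immediate;
    at time 0 it equals [A 0]. *)
Let Aleft s w := limn (fun n => A (lgrid n s) w).

Let cvg_Aleft s w : 0 <= s -> A (lgrid n s) w @[n --> \oo] --> Aleft s w.
Proof.
move=> s0; suff : cvgn (fun n => A (lgrid n s) w) by [].
move: s0; rewrite le_eqVlt => /predU1P[<-|s0].
  by under eq_fun do rewrite lgrid0; exact: is_cvg_cst.
have [_ /(_ s0) /cvg_ex[la Ha]] := ca w (ltW s0).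
have [_ /(_ s0) /cvg_ex[lb Hb]] := cb w (ltW s0).
apply/cvg_ex; exists (la - lb); apply: cvgB.
  by apply: (cvg_at_left_seq Ha) => [n|]; [exact: lgrid_lt|apply: cvg_lgrid; exact: ltW].
by apply: (cvg_at_left_seq Hb) => [n|]; [exact: lgrid_lt|apply: cvg_lgrid; exact: ltW].
Qed.

Let adA : adapted F A. Proof. by case: martA. Qed.

(** The first factor is the indicator of []0, t]], as a difference of indicators already known to be
    predictable. *)
Let H s w : R := ((s <= t)%O%:R - (s <= 0)%O%:R) * (1 + bounded_slope (Aleft s w) (A s w)).

Let predH : predictable F H.
Proof.
have pl : predictable F Aleft.
  by apply: (predictable_left_limit (X := A)) => // s w; exact: cvg_Aleft.
have pI : predictable F (fun s _ => (s <= t)%O%:R + -1 * (s <= 0)%O%:R).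
  by apply: predictable_lin; apply: (predictable_le_cst hF).
have pS : predictable F (fun s w => 1 + bounded_slope (Aleft s w) (A s w)).
  have sG := predictable_sigma_algebra F.
  apply/predictableP/(measurable_wrtP _ sG); apply: measurable_funD; first exact: measurable_cst.
  by apply: measurable_bounded_slope; apply/(measurable_wrtP _ sG)/predictableP.
apply: (predictable_ext (predictableM pI pS)) => s w _.
by rewrite mulN1r.
Qed.

Let H_ge0 s w : 0 <= s -> 0 <= H s w.
Proof.
move=> s0; apply: mulr_ge0.
  have [h|h] := boolP (s <= 0); last by rewrite subr0; exact: ler0n.
  by rewrite (le_trans h t0) subrr; exact: lexx.
have := bounded_slope_le1 (Aleft s w) (A s w); rewrite ler_norml => /andP[h _].
by rewrite -lerBlDl sub0r.
Qed.

(** The left end of the cell around [s] stays strictly before [s] and yields the left limit, while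
    the right end comes from the right and yields [A s]. A jump of [A] at [s] therefore survives in
    the limit. *)
Let cvg_H_ z : E z -> H_ n z @[n --> \oo] --> H z.1 z.2.
Proof.
move=> z0; rewrite /H_ /H; under eq_fun do rewrite (sum_grid_step _ _ (fun i => Y _ i z.2) t0).
have [/andP[s0 st]|h] := boolP ((0 < z.1) && (z.1 <= t)); last first.
  rewrite (_ : _ - _ = 0) ?mul0r; first exact: cvg_cst.
  move: z0 h; rewrite /E/= le_eqVlt => /predU1P[<-|s0]; first by rewrite lexx t0 subrr.
  by rewrite s0/= => /negbTE ->; rewrite leNgt s0 subrr.
rewrite st (leNgt z.1) s0 subr0 mul1r; apply: cvgD; first exact: cvg_cst.
apply: bounded_slope_cvg.
  have := @cvg_Aleft _ z.2 (ltW s0); apply: cvg_trans; apply: near_eq_cvg; apply: nearW => n.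
  by rewrite clip_lgrid.
have us n := clip_rgrid_ge n s0 st.
have cu := cvg_clip_rgrid s0 st.
have [ra _] := ca z.2 (ltW s0); have [rb _] := cb z.2 (ltW s0).
apply: cvgB.
  exact: (@cvg_at_right_seq _ (a ^~ z.2) _ _ ra us cu).
exact: (@cvg_at_right_seq _ (b ^~ z.2) _ _ rb us cu).
Qed.

Let H__bounds n z : 0 <= H_ n z <= 2.
Proof.
rewrite /H_ (sum_grid_step _ _ (fun i => Y _ i z.2) t0); case: ifP => _; first exact: Y_bounds.
by rewrite lexx ler0n.
Qed.

Let dct_H (mu : {measure set (R * T) -> \bar R}) : (mu E < +oo)%E ->
  exists2 I : R, (\int[mu]_(z in E) (H z.1 z.2)%:E)%E = I%:E &
    (\int[mu]_(z in E) (H_ n z)%:E @[n --> \oo] --> I%:E)%E.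
Proof.
move=> muE.
have mH : measurable_fun E (fun z : R * T => H z.1 z.2).
  apply: (@measurable_fun_cvg _ _ _ E H_) => [n|z]; last exact: cvg_H_.
  exact: (measurable_funTS (mH_ t0 n)).
have [] := @dominated_convergence _ _ _ mu E mE (fun n z => (H_ n z)%:E)
   (fun z => (H z.1 z.2)%:E) (cst 2%:E).
- by move=> n; apply/measurable_EFinP; exact: (measurable_funTS (mH_ t0 n)).
- exact/measurable_EFinP.
- by apply: aeW => z Ez; apply: cvg_EFin; [exact: nearW|exact: cvg_H_].
- exact: integrable_cst_finite.
- apply: aeW => z n _ /=; have /andP[H0 H2] := H__bounds n z.
  by rewrite lee_fin (ger0_norm H0).
move=> H1 _ H2; have If := integrable_fin_num mE H1.
exists (fine (\int[mu]_(z in E) (H z.1 z.2)%:E)%E); first by rewrite (fineK If).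
by rewrite (fineK If).
Qed.

(* In the limit over the grids, the expectation of [bounded_square (A t)] is the
   integral of the predictable [bounded_slope (A s-) (A s)] against
   [mu_a - mu_b], which vanishes on predictable sets since [A] is a martingale. *)
Lemma predictable_martingale_zero : {ae P, forall w, a t w - b t w = 0}.
Proof.
have [I Ia cva] := dct_H (mu_aE t0).
have [J Jb cvb] := dct_H (eq_ind _ (fun x => (x < +oo)%E) (mu_aE t0) _ mu_bE).
have IJ : I = J.
  apply: EFin_inj; rewrite -Ia -Jb.
  exact: (predictable_integral_eq hF (mu_aE t0) mu_bE rect_eq predH H_ge0).
pose e := expect P (fun w => bounded_square (A t w)).
have mphi : measurable_fun setT (fun w => bounded_square (A t w)).
  by apply: measurable_bounded_square; exact: mA.
have Lphi : L1 P (fun w => bounded_square (A t w)).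
  apply: (@L1_bounded _ _ _ P (P_fin P) _ 1 mphi) => w.
  by rewrite (ger0_norm (bounded_square_ge0 _)) bounded_square_le1.
have Lsum c n : (forall s, 0 <= s -> L1 P (c s)) -> L1 P (fun w => \sum_(i < grid_index n t)
     Y n i w * (c (clip n t i.+1) w - c (clip n t i) w)).
  by move=> Lc; apply: L1_sum => i; exact: LY.
(* Along each path, [x + bounded_square x] telescopes over the grid; the linear part has expectation
   0 since [A] is a martingale starting at 0. *)
have ee n : expect P (fun w => \sum_(i < grid_index n t)
     Y n i w * (a (clip n t i.+1) w - a (clip n t i) w)) -
   expect P (fun w => \sum_(i < grid_index n t)
     Y n i w * (b (clip n t i.+1) w - b (clip n t i) w)) = e.
  rewrite -expectB; [|exact: Lsum..].
  transitivity (expect P (fun w => A t w + bounded_square (A t w))).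
    apply: eq_expect => w; rewrite -sumrB.
    transitivity (\sum_(0 <= i < grid_index n t)
       ((A (clip n t i.+1) w + bounded_square (A (clip n t i.+1) w))
        - (A (clip n t i) w + bounded_square (A (clip n t i) w)))).
      rewrite big_mkord; apply: eq_bigr => i _.
      have -> : bounded_square (A (clip n t i.+1) w) = bounded_square (A (clip n t i) w) +
          bounded_slope (A (clip n t i) w) (A (clip n t i.+1) w) *
          (A (clip n t i.+1) w - A (clip n t i) w) by rewrite -bounded_slopeE addrC subrK.
      rewrite /Y; move: (bounded_slope _ _) (bounded_square _) => p q; rewrite /A; ring.
    rewrite (telescope_sumr (fun i => A (clip n t i) w + bounded_square (A (clip n t i) w)) (leq0n _)).
    by rewrite (clip0 n t0) A0 bounded_square0 addr0 subr0 (clip_self n t0).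
  rewrite (expectD (A1 t0) Lphi).
  have [_ _ EA] := (martingaleP hF _).1 martA.
  have := EA 0 t setT (lexx _) t0 (F_setT hF (lexx _)).
  under eq_expect do rewrite indicE in_setT mulr1.
  under [X in _ = X -> _]eq_expect do rewrite A0 mul0r.
  by rewrite expect0 => ->; rewrite add0r.
have e0 : e = 0.
  have ha : expect P (fun w => \sum_(i < grid_index n t)
      Y n i w * (a (clip n t i.+1) w - a (clip n t i) w)) @[n --> \oo] --> I.
    apply: fine_cvg; apply: cvg_trans cva; apply: near_eq_cvg; apply: nearW => n.
    exact: (etrans (integral_H_ ma nda ca a0 a1 n) (expectE (Lsum a n a1))).
  have hb : expect P (fun w => \sum_(i < grid_index n t)
      Y n i w * (b (clip n t i.+1) w - b (clip n t i) w)) @[n --> \oo] --> I.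
    rewrite IJ; apply: fine_cvg; apply: cvg_trans cvb; apply: near_eq_cvg; apply: nearW => n.
    exact: (etrans (integral_H_ mb ndb cb b0 b1 n) (expectE (Lsum b n b1))).
  have h : (fun=> e) n @[n --> \oo] --> I - I.
    apply: cvg_trans (cvgB ha hb); apply: near_eq_cvg; apply: nearW => n.
    exact: ee n.
  have := cvg_lim (@Rhausdorff R) h; rewrite lim_cst; last exact: Rhausdorff.
  by rewrite subrr => he; exact: he.
have := expect_eq0_ae Lphi (fun w => bounded_square_ge0 _) e0.
by apply: filterS => w; exact: bounded_square_eq0.
Qed.

End predictable_martingale.

(** * Localization and uniqueness *)

Section uniqueness.
Context {R : realType} {d : measure_display} {T : measurableType d}.
Variables (P : probability T R) (F : R -> set (set T)).
Hypothesis hF : usual_filtration P F.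
Implicit Types (X Y : R -> T -> R) (theta : T -> \bar R).

(** Up to [theta] the value is that of [X]; afterwards it is that of the stopped process a little
    earlier, already frozen. The test between the two is [lgrid n s < theta], a left-grid sample,
    which becomes [s <= theta] in the limit when [theta] is positive. *)
Lemma predictable_stopped X theta : adapted F X -> cadlag X -> predictable F X ->
  stopping_time F theta -> predictable F (stopped X theta).
Proof.
move=> aX cX pX htheta; have th0 w : (0 <= theta w)%E by case: htheta.
pose I s w : R := \1_[set w | (s%:E < theta w)%E] w.
have aI : adapted F I.
  by move=> s s0; apply: (measurable_wrt_indic hF) => //; exact: (F_stopping_gt hF).
apply: (@predictable_cvg _ _ _ _ (fun n s w => I (lgrid n s) w * X s w +
    1 * ((1 + -1 * I (lgrid n s) w) * stopped X theta (lgrid n s) w))).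
  move=> n; have pI := predictable_left_grid n aI.
  have pS := predictable_left_grid n (stopped_adapted hF aX cX htheta).
  apply: predictable_lin; first exact: predictableM.
  by apply: predictableM => //; apply: predictable_lin => //; exact: predictable_cst.
move=> s w s0.
have I1 n : ((lgrid n s)%:E < theta w)%E -> I (lgrid n s) w = 1.
  by move=> h; rewrite /I indicE mem_set.
have I0 n : (theta w <= (lgrid n s)%:E)%E -> I (lgrid n s) w = 0.
  by move=> h; rewrite /I indicE memNset//=; apply/negP; rewrite -leNgt.
have [tw|] := boolP (0 < theta w)%E; last first.
  rewrite -leNgt => tw; rewrite stoppedE ltNge tw/=.
  apply: cvg_trans (_ : (fun=> 0) n @[n --> \oo] --> (0 : R)); last exact: cvg_cst.
  apply: near_eq_cvg; apply: nearW => n; rewrite I0.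
    by rewrite mul0r stoppedE ltNge tw/= !mulr0 addr0.
  by rewrite (le_trans tw)// lee_fin lgrid_ge0.
have [st|] := boolP (s%:E <= theta w)%E.
  rewrite stoppedE tw cap_id//.
  apply: cvg_trans (_ : (fun=> X s w) n @[n --> \oo] --> X s w); last exact: cvg_cst.
  apply: near_eq_cvg; apply: nearW => n; rewrite I1; first by rewrite mul1r mulN1r subrr mul0r mulr0 addr0.
  move: s0; rewrite le_eqVlt => /predU1P[<-|s0]; first by rewrite lgrid0.
  by apply: lt_le_trans st; rewrite lte_fin lgrid_lt.
rewrite -ltNge => ts.
apply: cvg_trans (_ : (fun=> stopped X theta s w) n @[n --> \oo] --> stopped X theta s w); last exact: cvg_cst.
have [r thr] : exists r, theta w = r%:E.
  by case: (theta w) (th0 w) ts => [r| |]// _ _; exists r.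
rewrite thr lte_fin in ts.
apply: near_eq_cvg; near=> n; have rl : r <= lgrid n s.
  by apply: ltW; near: n; exact: (cvgr_gt s (cvg_lgrid s0)).
rewrite I0 ?thr ?lee_fin// mul0r add0r mulr0 addr0 !mul1r.
by rewrite !stoppedE tw !cap_const// thr lee_fin// ltW.
Unshelve. all: by end_near. Qed.

Lemma stopped_nondecreasing X theta : nondecreasing_process X ->
  (forall w, (0 <= theta w)%E) -> nondecreasing_process (stopped X theta).
Proof.
move=> ndX th0 w s t s0 st; rewrite !stoppedE; case: ifP => // _.
by apply: ndX; [exact: cap_ge0|exact: le_cap].
Qed.

Lemma stopped0 X theta w : X 0 w = 0 -> (0 <= theta w)%E -> stopped X theta 0 w = 0.
Proof. by move=> X0 th0; rewrite stoppedE cap_id// X0; case: ifP. Qed.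

(* At the hitting times of its variation, [A] may overshoot by a jump, but by
   [tv_jump] the stopped variation is at most [2 n] plus the integrable
   [stopped A]. *)
Lemma predictable_local_martingale_zero A : finite_variation_process F A ->
  predictable F A -> local_martingale P F A ->
  {ae P, forall w, forall t, 0 <= t -> A t w = 0}.
Proof.
move=> fA pA [aA cA [tau [st nd too mA]]].
have A0 w : A 0 w = 0 by case: fA.
pose V := variation_process A.
have aV : adapted F V by exact: (variation_process_adapted hF).
have cV : cadlag V by exact: (variation_process_cadlag fA).
have ndV : nondecreasing_process V by exact: (variation_process_nd fA).
have V0 w : V 0 w = 0 by exact: variation_process0.
have tau0 n w : (0 <= tau n w)%E by case: (st n).
pose rho n := hitting_time V n%:R.
have srho n : stopping_time F (rho n) by exact: (hitting_time_stopping hF).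
have rho0 n w : (0 <= rho n w)%E by exact: hitting_time_ge0.
pose theta n w := mine (tau n w) (rho n w).
have sth n : stopping_time F (theta n) by exact: (stopping_time_min hF).
have th0 n w : (0 <= theta n w)%E by rewrite le_min tau0 rho0.
pose W t w := V t w + -1 * A t w.
have aW : adapted F W by exact: (adapted_lin hF).
have cW : cadlag W by exact: cadlag_lin.
have ndW : nondecreasing_process W by exact: (variation_process_sub_nd fA).
have W0 w : W 0 w = 0 by rewrite /W V0 A0 mulr0 addr0.
have zero n t : 0 <= t -> {ae P, forall w, stopped A (theta n) t w = 0}.
  move=> t0.
  have mS : martingale P F (stopped A (theta n)).
    rewrite /theta -(stopped_stopped A (tau0 n) (rho0 n)).
    by apply: (martingale_stopped hF) => //; exact: stopped_cadlag.
  have [aS iS _] := (martingaleP hF _).1 mS.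
  have SE s w : stopped W (theta n) s w = stopped V (theta n) s w + -1 * stopped A (theta n) s w.
    by rewrite stopped_lin.
  have LV s : 0 <= s -> L1 P (stopped V (theta n) s).
    move=> s0.
    have Lg : L1 P (fun w => 2 * n%:R + `|stopped A (theta n) s w|).
      apply: L1D; last by apply: L1_norm; exact: iS.
      by apply: (@L1_bounded _ _ _ P (P_fin P) _ (`|2 * n%:R|)).
    apply: (L1_le _ Lg); first exact: (adapted_measurable hF (stopped_adapted hF aV cV (sth n))).
    move=> w; rewrite [leRHS]ger0_norm ?addr_ge0 ?mulr_ge0//.
    rewrite !stoppedE; case: ifP => th; last by rewrite normr0 addr_ge0 ?mulr_ge0.
    have c0 := cap_ge0 (th0 n w) s0.
    rewrite ger0_norm; last by rewrite -(V0 w) ndV.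
    have := @tv_jump _ (A ^~ w) _ _ (cap (theta n) s w) n%:R c0 (ler0n _ _).
    rewrite A0 normr0 addr0; apply.
    - by move=> r r0; have [] := cA w r r0.
    - by case: fA => _ _ _ + r r0; apply.
    - move=> r r0; rewrite cap_lt// => /andP[_ rth]; apply: ltW.
      apply: (@hitting_time_lt _ _ _ V n%:R w r) => //.
      by apply: (lt_le_trans rth); rewrite ge_min lexx orbT.
  have LW s : 0 <= s -> L1 P (stopped W (theta n) s).
    move=> s0; rewrite (_ : stopped W (theta n) s = (fun w => stopped V (theta n) s w + -1 * stopped A (theta n) s w)).
      by apply: L1D; [exact: LV|apply: L1Z; exact: iS].
    by apply/funext => w; exact: SE.
  have AE : (fun s w => stopped V (theta n) s w - stopped W (theta n) s w) = stopped A (theta n).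
    by apply/funext => s; apply/funext => w; rewrite SE; lra.
  have := @predictable_martingale_zero _ _ _ P F hF (stopped V (theta n)) (stopped W (theta n))
    (stopped_adapted hF aV cV (sth n)) (stopped_adapted hF aW cW (sth n))
    (stopped_nondecreasing ndV (th0 n)) (stopped_nondecreasing ndW (th0 n))
    (stopped_cadlag cV (th0 n)) (stopped_cadlag cW (th0 n))
    (fun w => stopped0 (V0 w) (th0 n w)) (fun w => stopped0 (W0 w) (th0 n w)) LV LW _ _ t t0.
  rewrite AE => /(_ mS (predictable_stopped aA cA pA (sth n))).
  by apply: filterS => w; have /(congr1 (fun f => f t w)) /= -> := AE.
(* Countably many grid times and localizing indices leave a single null set; right-continuity then
   reaches every [t]. *)
have : {ae P, forall w, forall n k i, stopped A (theta k) (grid n i) w = 0}.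
  apply: ae_foralln => n; apply: ae_foralln => k; apply: ae_foralln => i.
  exact: zero (grid_ge0 n i).
apply: filterS2 too => w too H t t0.
have Ag n i : A (grid n i) w = 0.
  have g0 : 0 <= grid n i :> R by exact: grid_ge0.
  have thoo : theta k w @[k --> \oo] --> +oo%E.
    have := @hitting_time_cvg _ _ _ V w ndV => /cvgeyPge hr; move/cvgeyPge : too => ht.
    apply/cvgeyPge => B; near=> k; rewrite le_min; apply/andP; split; near: k.
      exact: ht.
    exact: hr.
  have [k _ /(_ k (leqnn k)) /= hk] : \forall k \near \oo, ((grid n i)%:E < theta k w)%E.
    by move/cvgeyPgt : thoo; exact.
  have := H n k i; rewrite stoppedE (le_lt_trans _ hk) ?lee_fin//.
  by rewrite cap_id// ltW.
have [Ar _] := cA w t t0.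
have := @cvg_at_right_seq _ (A ^~ w) t (fun n => rgrid n t) Ar (fun n => rgrid_ge n t0) (cvg_rgrid t0).
move=> h; apply: (cvg_unique _ h) => //.
apply: cvg_trans (_ : (fun=> 0) n @[n --> \oo] --> (0 : R)); last exact: cvg_cst.
by apply: near_eq_cvg; apply: nearW => n; rewrite /rgrid Ag.
Unshelve. all: by end_near. Qed.

End uniqueness.

(** * Stieltjes integrals of continuous processes *)

Section stieltjes_sum.
Context {R : realType}.
Variables (a : cumulative R R) (g : R -> R) (t K : R).
Hypothesis t0 : 0 <= t.
Hypothesis gK : forall s, 0 < s -> s <= t -> `|g s| <= K.
Hypothesis gc : forall s, 0 < s -> s <= t ->
  g (clip n t (grid_index n s).-1.+1) @[n --> \oo] --> g s.
Implicit Types (s x y : R) (n i : nat).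

Let mu := lebesgue_stieltjes_measure a.

Lemma stieltjes_measure_itv x y : x <= y -> mu `]x, y]%classic = (a y - a x)%:E.
Proof.
move=> xy; rewrite /mu /lebesgue_stieltjes_measure /measure_extension/=.
by rewrite measurable_mu_extE/= ?wlength_itv_bnd//; exact: is_ocitv.
Qed.

Let D : set R := `]0, t]%classic.

Let mD : measurable D. Proof. exact: measurable_itv. Qed.

Let step n s := \sum_(i < grid_index n t)
  g (clip n t i.+1) * \1_(`]clip n t i, clip n t i.+1]%classic : set R) s.

Let stepE n s : 0 < s -> s <= t -> step n s = g (clip n t (grid_index n s).-1.+1).
Proof.
by move=> s0 st; rewrite /step (sum_grid_step _ _ (fun i => g (clip n t i.+1)) t0) s0 st.
Qed.

Let measurable_step n : measurable_fun D (step n).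
Proof.
apply: measurable_funTS; apply: measurable_sum => i; apply: measurable_funM.
  exact: measurable_cst.
exact: measurable_indic.
Qed.

Lemma measurable_right_limit : measurable_fun D g.
Proof.
apply: (measurable_fun_cvg measurable_step) => s; rewrite /D/= in_itv/= => /andP[s0 st].
by under eq_fun do rewrite stepE//; exact: gc.
Qed.

Let muD : (mu D < +oo)%E.
Proof. by rewrite stieltjes_measure_itv// ltry. Qed.

Lemma stieltjes_integrable : mu.-integrable D (EFin \o g).
Proof.
have ik : mu.-integrable D (cst K%:E) by exact: integrable_cst_finite.
apply: (le_integrable _ _ _ ik) => //.
  by apply/measurable_EFinP; exact: measurable_right_limit.
move=> s; rewrite /D/= in_itv/= => /andP[s0 st].
by rewrite lee_fin (le_trans (gK s0 st))// ler_norm.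
Qed.

(** Step functions taking the value of [g] at the right end of each cell converge pointwise and are
    bounded by [K]. Right ends are the ones left over by summation by parts when the other factor is
    read at left ends. *)
Lemma cvg_stieltjes_sum :
  \sum_(i < grid_index n t) g (clip n t i.+1) * (a (clip n t i.+1) - a (clip n t i))
    @[n --> \oo] --> Rintegral mu D g.
Proof.
have step_itg n i : mu.-integrable D (fun s => (g (clip n t i.+1))%:E *
     (\1_(`]clip n t i, clip n t i.+1]%classic : set R) s)%:E)%E.
  apply: integrableZl => //; apply/integrableP; split.
    by apply/measurable_EFinP; exact: measurable_indic.
  under eq_integral do rewrite /= ger0_norm//.
  rewrite integral_indic//; apply: le_lt_trans muD; apply: le_measure; rewrite ?inE//.
    by apply: measurableI.
have integral_step n : (\int[mu]_(s in D) (step n s)%:E)%E =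
   (\sum_(i < grid_index n t) g (clip n t i.+1) * (a (clip n t i.+1) - a (clip n t i)))%:E.
  under eq_integral do rewrite -sumEFin.
  under eq_integral do under eq_bigr do rewrite EFinM.
  rewrite integral_sum// -sumEFin; apply: eq_bigr => i _.
  rewrite integralZl//; last first.
    apply/integrableP; split; first by apply/measurable_EFinP; exact: measurable_indic.
    under eq_integral do rewrite /= ger0_norm//.
    rewrite integral_indic//; apply: le_lt_trans muD; apply: le_measure; rewrite ?inE//.
    by apply: measurableI.
  rewrite integral_indic// setIidl; first by
    rewrite -[X in (_ * X)%E]/(mu `]clip n t i, clip n t i.+1]%classic) stieltjes_measure_itv ?le_clip.
  move=> s; rewrite /D/= !in_itv/= => /andP[h1 h2].
  by rewrite (le_lt_trans _ h1) ?clip_ge0// (le_trans h2)// clip_le.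
have [] := @dominated_convergence _ _ _ mu D mD (fun n s => (step n s)%:E)
   (EFin \o g) (cst K%:E).
- by move=> n; apply/measurable_EFinP; exact: measurable_step.
- by apply/measurable_EFinP; exact: measurable_right_limit.
- apply: aeW => s; rewrite /D/= in_itv/= => /andP[s0 st].
  apply: cvg_EFin; first exact: nearW.
  by under eq_fun do rewrite stepE//; exact: gc.
- exact: integrable_cst_finite.
- apply: aeW => s n; rewrite /D/= in_itv/= => /andP[s0 st].
  rewrite lee_fin stepE// gK ?clip_le// (lt_le_trans s0)//.
  exact: clip_rgrid_ge.
move=> ig _ H.
have H' : ((\sum_(i < grid_index n t) g (clip n t i.+1) * (a (clip n t i.+1) - a (clip n t i)))%:E
    @[n --> \oo] --> (Rintegral mu D g)%:E)%E.
  rewrite /Rintegral fineK; last by apply: (integrable_fin_num _ ig).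
  apply: cvg_trans H; apply: near_eq_cvg; apply: nearW => n /=.
  exact: integral_step.
exact: (fine_cvg H').
Qed.

(** Comparison with the increments of [a], from which right-continuity and finite variation of the
    integral are later deduced. *)
Lemma stieltjes_increment s : 0 <= s -> s <= t ->
  `|Rintegral mu D g - Rintegral mu `]0, s]%classic g| <= K * (a t - a s).
Proof.
move=> s0 st.
have DE : D = `]0, s]%classic `|` `]s, t]%classic.
  by rewrite -itv_bndbnd_setU// bnd_simp.
have dj : [disjoint `]0, s]%classic & `]s, t]%classic].
  apply/disj_setPS => y [/=]; rewrite 2!in_itv/= => /andP[_ yx] /andP[].
  by rewrite ltNge yx.
rewrite {1}DE Rintegral_setU//; last by rewrite -DE; exact: stieltjes_integrable.
rewrite addrC addKr.
have sub : `]s, t] `<=` D.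
  by move=> x /=; rewrite /D/= !in_itv/= => /andP[sx ->]; rewrite (le_lt_trans s0 sx).
have ig : mu.-integrable `]s, t]%classic (EFin \o g).
  by have ig0 := stieltjes_integrable; apply: (integrableS _ _ _ ig0).
apply: (le_trans (le_normr_Rintegral _ ig)) => //.
have mst : (mu `]s, t]%classic < +oo)%E by rewrite stieltjes_measure_itv// ltry.
have -> : K * (a t - a s) = Rintegral mu `]s, t]%classic (cst K).
  by rewrite Rintegral_cst// -[X in fine X]/(mu `]s, t]%classic) stieltjes_measure_itv.
apply: le_Rintegral => //.
- exact: (integrable_abse ig).
- exact: integrable_cst_finite.
- move=> x /=; rewrite in_itv/= => /andP[sx xt]; apply: gK => //.
  exact: le_lt_trans sx.
Qed.

End stieltjes_sum.

Section clamped_cumulative.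
Context {R : realType}.
Variables (h : R -> R) (t : R).
Hypothesis t0 : 0 <= t.
Hypothesis nd : forall x y, 0 <= x -> x <= y -> h x <= h y.
Hypothesis rc : forall s : R, 0 <= s -> h x @[x --> s^'+] --> h s.

(** A [cumulative] must be monotone and right-continuous on all of [R], whereas [h] is controlled
    only at nonnegative times; the path is frozen before 0 and after [t]. *)
Definition clamped_path s := h (Num.min t (Num.max 0 s)).

Lemma clamped_path_id s : 0 <= s -> s <= t -> clamped_path s = h s.
Proof. by move=> s0 st; rewrite /clamped_path max_r// min_r. Qed.

Let clamped_nd : nondecreasing clamped_path.
Proof.
move=> x y xy; apply: nd; first by rewrite le_min t0 le_max lexx.
by rewrite le_min !ge_min lexx/= ge_max !le_max lexx/= xy !orbT.
Qed.

Let clamped_rc : forall s, clamped_path x @[x --> s^'+] --> clamped_path s.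
Proof.
move=> s; have [s0|] := boolP (s < 0).
  apply: cvg_trans (_ : (fun=> clamped_path s) x @[x --> s^'+] --> clamped_path s); last exact: cvg_cst.
  apply: near_eq_cvg; near=> x; have x0 : x < 0 by near: x; exact: nbhs_right_lt.
  by rewrite /clamped_path (max_l (ltW s0)) (max_l (ltW x0)).
rewrite -leNgt => s0; have [st|] := boolP (s < t); last first.
  rewrite -leNgt => ts.
  apply: cvg_trans (_ : (fun=> clamped_path s) x @[x --> s^'+] --> clamped_path s); last exact: cvg_cst.
  apply: near_eq_cvg; near=> x; have sx : s < x by near: x; exact: nbhs_right_gt.
  rewrite /clamped_path !max_r ?(le_trans s0 (ltW sx))// !min_l//.
  exact: le_trans (ltW sx).
rewrite clamped_path_id ?(ltW st)//.
apply: cvg_trans (rc s0); apply: near_eq_cvg; near=> x.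
have sx : s < x by near: x; exact: nbhs_right_gt.
rewrite clamped_path_id// ?(le_trans s0 (ltW sx))//.
by apply: ltW; near: x; exact: nbhs_right_lt.
Unshelve. all: by end_near. Qed.

HB.instance Definition _ := isCumulative.Build R _ R clamped_path clamped_nd clamped_rc.

Definition clamped_cumulative : cumulative R R := clamped_path.

End clamped_cumulative.

Section stieltjes_riemann.
Context {R : realType}.
Variables (g v h1 h2 : R -> R).
Hypothesis gc : forall (t : R) (u : nat -> R), 0 <= t -> (forall n, 0 <= u n) ->
  u n @[n --> \oo] --> t -> g (u n) @[n --> \oo] --> g t.
Hypothesis gb : forall t : R, 0 <= t -> exists K, forall s, 0 <= s -> s <= t -> `|g s| <= K.
Hypothesis nd1 : forall x y, 0 <= x -> x <= y -> h1 x <= h1 y.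
Hypothesis nd2 : forall x y, 0 <= x -> x <= y -> h2 x <= h2 y.
Hypothesis rc1 : forall s : R, 0 <= s -> h1 x @[x --> s^'+] --> h1 s.
Hypothesis rc2 : forall s : R, 0 <= s -> h2 x @[x --> s^'+] --> h2 s.
Hypothesis vE : forall s, 0 <= s -> v s - v 0 = h1 s - h2 s.

Definition riemann_sum (f w : R -> R) n (t : R) :=
  \sum_(0 <= i < gsize n) f (clip n t i.+1) * (w (clip n t i.+1) - w (clip n t i)).

Lemma riemann_sumE (f w : R -> R) n (t : R) : 0 <= t -> t <= n.+1%:R -> riemann_sum f w n t =
  \sum_(i < grid_index n t) f (clip n t i.+1) * (w (clip n t i.+1) - w (clip n t i)).
Proof.
move=> t0 tn; rewrite /riemann_sum (@big_cat_nat _ _ _ (grid_index n t))//=; last first.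
  by rewrite grid_index_le// grid_gsize.
rewrite [X in _ + X]big1_seq ?addr0 ?big_mkord// => i; rewrite mem_index_iota => /andP[_ /andP[ti _]].
have tg : t <= grid n i by rewrite -grid_index_le.
have tg' : t <= grid n i.+1 by rewrite -grid_index_le// (leq_trans ti).
by rewrite /clip !min_l// subrr mulr0.
Qed.

Let gclip (t s : R) : 0 < s -> s <= t ->
  g (clip n t (grid_index n s).-1.+1) @[n --> \oo] --> g s.
Proof.
move=> s0 st; apply: gc; first exact: ltW.
  by move=> n; apply: clip_ge0; rewrite (le_trans (ltW s0)).
exact: cvg_clip_rgrid.
Qed.

(** The sums involve [v] alone, so their limit is the same for every decomposition of [v] into
    nondecreasing functions. This is what determines the value selected in [stieltjes_integral]. *)
Lemma cvg_riemann_sum (t I : R) : 0 <= t -> is_stieltjes_integral g v t I ->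
  riemann_sum g v n t @[n --> \oo] --> I.
Proof.
move=> t0 [a [b [vab _ _ ->]]]; have [K gK] := gb t0.
have gK' s : 0 < s -> s <= t -> `|g s| <= K by move=> /ltW; exact: gK.
have ca := @cvg_stieltjes_sum _ a _ _ _ t0 gK' (@gclip t).
have cb := @cvg_stieltjes_sum _ b _ _ _ t0 gK' (@gclip t).
apply: cvg_trans (cvgB ca cb); apply: near_eq_cvg; near=> n.
rewrite riemann_sumE//; last first.
  by apply: (@le_trans _ _ n%:R); [near: n; exact: nbhs_infty_ger|rewrite ler_nat].
rewrite ?fctE -sumrB; apply: eq_bigr => i _.
have E j : v (clip n t j) = v 0 + (a (clip n t j) - b (clip n t j)).
  by rewrite -vab ?clip_ge0 ?clip_le// addrC subrK.
rewrite !E; ring.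
Unshelve. all: by end_near. Qed.

Let cum1 (t : R) (t0 : 0 <= t) : cumulative R R := clamped_cumulative t0 nd1 rc1.
Let cum2 (t : R) (t0 : 0 <= t) : cumulative R R := clamped_cumulative t0 nd2 rc2.

(** One pair of functions, frozen at [t], represents the integrals up to all earlier [s], so that
    integrals with different upper limits can be subtracted. *)
Let horizon (s t : R) (t0 : 0 <= t) : 0 <= s -> s <= t ->
  is_stieltjes_integral g v s
    (Rintegral (lebesgue_stieltjes_measure (cum1 t0)) `]0, s] g
     - Rintegral (lebesgue_stieltjes_measure (cum2 t0)) `]0, s] g).
Proof.
move=> s0 st; have [K gK] := gb s0.
have gK' r : 0 < r -> r <= s -> `|g r| <= K by move=> /ltW; exact: gK.
exists (cum1 t0), (cum2 t0); split => //.
- move=> r /andP[r0 rs]; rewrite vE//.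
  by rewrite /cum1 /cum2 /= !clamped_path_id// (le_trans rs).
- exact: (@stieltjes_integrable _ (cum1 t0) _ _ _ s0 gK' (@gclip s)).
- exact: (@stieltjes_integrable _ (cum2 t0) _ _ _ s0 gK' (@gclip s)).
Qed.

Lemma stieltjes_integralP (t : R) : 0 <= t ->
  is_stieltjes_integral g v t (stieltjes_integral g v t).
Proof.
move=> t0; apply: (@xgetPex _ 0 [set I | is_stieltjes_integral g v t I]).
by eexists; exact: (horizon t0 t0 (lexx t)).
Qed.

Lemma cvg_stieltjes_integral (t : R) : 0 <= t ->
  riemann_sum g v n t @[n --> \oo] --> stieltjes_integral g v t.
Proof. by move=> t0; apply: cvg_riemann_sum => //; exact: stieltjes_integralP. Qed.

Lemma stieltjes_integral_unique (t I : R) : 0 <= t -> is_stieltjes_integral g v t I ->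
  stieltjes_integral g v t = I.
Proof.
move=> t0 hI; have h1' := cvg_stieltjes_integral t0; have h2' := cvg_riemann_sum t0 hI.
by apply: (cvg_unique _ h1' h2').
Qed.

Lemma stieltjes_integral_increment (t K s : R) : (forall s, 0 <= s -> s <= t -> `|g s| <= K) ->
  0 <= s -> s <= t ->
  `|stieltjes_integral g v t - stieltjes_integral g v s| <=
    K * ((h1 t + h2 t) - (h1 s + h2 s)).
Proof.
move=> gK s0 st; have t0 := le_trans s0 st.
rewrite (stieltjes_integral_unique t0 (horizon t0 t0 (lexx t))).
rewrite (stieltjes_integral_unique s0 (horizon t0 s0 st)).
set a := cum1 t0; set b := cum2 t0.
have gK' r : 0 < r -> r <= t -> `|g r| <= K by move=> /ltW; exact: gK.
have ia := @stieltjes_increment _ a _ _ _ t0 gK' (@gclip t) s s0 st.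
have ib := @stieltjes_increment _ b _ _ _ t0 gK' (@gclip t) s s0 st.
have E1 : a t - a s = h1 t - h1 s by rewrite /a /= !clamped_path_id.
have E2 : b t - b s = h2 t - h2 s by rewrite /b /= !clamped_path_id.
rewrite E1 in ia; rewrite E2 in ib.
have swap (x y z u : R) : x - y - (z - u) = (x - z) - (y - u) by ring.
rewrite swap (le_trans (ler_normB _ _))//.
have -> : K * (h1 t + h2 t - (h1 s + h2 s)) = K * (h1 t - h1 s) + K * (h2 t - h2 s) by ring.
exact: lerD.
Qed.

Lemma stieltjes_integral0 : stieltjes_integral g v 0 = 0.
Proof.
have h := cvg_stieltjes_integral (lexx 0); apply: (cvg_unique _ h) => //.
apply: cvg_trans (_ : (fun=> 0) n @[n --> \oo] --> (0 : R)); last exact: cvg_cst.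
apply: near_eq_cvg; apply: nearW => n; rewrite /riemann_sum big1// => i _.
by rewrite /clip !min_l ?grid_ge0// subrr mulr0.
Qed.

End stieltjes_riemann.

(** * Running supremum of a continuous process *)

Section running_sup.
Context {R : realType} {d : measure_display} {T : measurableType d}.
Variables (P : probability T R) (F : R -> set (set T)).
Hypothesis hF : usual_filtration P F.
Variable D : R -> T -> R.
Hypothesis aD : adapted F D.
Hypothesis cD : continuous_process D.

Lemma continuous_path_bounded w (t : R) : 0 <= t ->
  exists K, forall s, 0 <= s -> s <= t -> `|D s w| <= K.
Proof.
move=> t0; have h : {within `[0, t], continuous (fun s => `|D s w|)}.
  have h' : {within `[0, t], continuous (D ^~ w)}.
    move: (@cD w); apply: continuous_subspaceW => s /=; by rewrite !in_itv/= => /andP[-> _].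
  move=> s; apply: continuous_comp; first exact: h'.
  exact: norm_continuous.
have [c _ Hc] := EVT_max t0 h.
by exists (`|D c w|) => s s0 st; apply: Hc; rewrite in_itv/= s0.
Qed.

Definition running_sup t w : R := sup [set `|D s w| | s in [set s | 0 <= s <= t]].

Let hs t w : 0 <= t -> has_sup [set `|D s w| | s in [set s | 0 <= s <= t]].
Proof.
move=> t0; split; first by exists (`|D 0 w|); exists 0 => //=; rewrite lexx.
have [K HK] := continuous_path_bounded w t0.
by exists K => y [s /= /andP[s0 st] <-]; exact: HK.
Qed.

Lemma running_sup_ge w s t : 0 <= s -> s <= t -> `|D s w| <= running_sup t w.
Proof.
move=> s0 st; apply: ub_le_sup; first by case: (hs w (le_trans s0 st)).
by exists s => //=; rewrite s0.
Qed.

Lemma running_sup_nd : nondecreasing_process running_sup.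
Proof.
move=> w s t s0 st; apply: ge_sup; first by case: (hs w s0).
move=> y [r /= /andP[r0 rs] <-]; apply: running_sup_ge => //.
exact: le_trans st.
Qed.

(** By continuity, the supremum exceeds [c] as soon as [|D|] does at one of the countably many
    clipped grid times. *)
Lemma running_sup_adapted : adapted F running_sup.
Proof.
move=> t t0; have sF := F_sigma hF t0; apply/(measurable_wrtP _ sF).
apply: (measurability (@RGenOInfty.G R)) => [|/= _ [_ [c ->] <-]].
  exact: RGenOInfty.measurableE.
rewrite setTI measurable_g_measurableTypeE//.
rewrite (_ : _ @^-1` _ = \bigcup_n \bigcup_i [set w | c < `|D (clip n t i) w|]).
  apply: (F_bigcup hF) => // n; apply: (F_bigcup hF) => // i.
  apply: measurable_wrt_gt => //; apply: (measurable_wrt_norm hF) => //.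
  by apply: (measurable_wrt_mono hF _ _ (aD _)); rewrite ?clip_ge0 ?clip_le.
apply/seteqP; split => w /=; rewrite in_itv/= andbT; last first.
  move=> [n _ [i _ /= ci]]; apply: (lt_le_trans ci).
  by apply: running_sup_ge; rewrite ?clip_ge0 ?clip_le.
move=> cs; have rc0 : 0 < running_sup t w - c by rewrite subr_gt0.
have [e [s /= /andP[s0 st] <-] ce] := sup_adherent rc0 (hs w t0).
have {}ce : c < `|D s w| by move: ce; rewrite -/(running_sup t w) subKr.
have cc : `|D (clip n t (grid_index n s)) w| @[n --> \oo] --> `|D s w|.
  apply: cvg_norm; apply: (@continuous_process_cvg _ _ _ D w s (fun n => clip n t (grid_index n s))) => //.
    by move=> n; exact: clip_ge0.
  apply: (@cvg_le_dist _ _ _ _ _ (@harmonic R)); last exact: cvg_harmonic.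
  move=> n; rewrite ger0_norm ?subr_ge0 ?le_min ?st ?rgrid_ge//.
  by rewrite lerBlDl (le_trans _ (rgrid_le n s0))// ge_min lexx orbT.
have [n _ /(_ n (leqnn n)) /= hn] := cvgr_gt _ cc _ ce.
by exists n => //; exists (grid_index n s).
Qed.

End running_sup.

(** * The Stieltjes integral as a process *)

Section integral_process.
Context {R : realType} {d : measure_display} {T : measurableType d}.
Variables (P : probability T R) (F : R -> set (set T)).
Hypothesis hF : usual_filtration P F.
Variables D v : R -> T -> R.
Hypothesis aD : adapted F D.
Hypothesis cD : continuous_process D.
Hypothesis fv : finite_variation_process F v.
Implicit Types (w : T) (s t : R).

Definition integral_process t w := stieltjes_integral (D ^~ w) (v ^~ w) t.

Let V := variation_process v.
Let W t w := V t w + -1 * v t w.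

Let gc w t (u : nat -> R) : 0 <= t -> (forall n, 0 <= u n) ->
  u n @[n --> \oo] --> t -> D (u n) w @[n --> \oo] --> D t w.
Proof. exact: continuous_process_cvg. Qed.

Let gb w t : 0 <= t -> exists K, forall s, 0 <= s -> s <= t -> `|D s w| <= K.
Proof. exact: continuous_path_bounded. Qed.

Let ndV w x y : 0 <= x -> x <= y -> V x w <= V y w.
Proof. exact: (variation_process_nd fv). Qed.

Let ndW w x y : 0 <= x -> x <= y -> W x w <= W y w.
Proof. exact: (variation_process_sub_nd fv). Qed.

Let cV : cadlag V. Proof. exact: (variation_process_cadlag fv). Qed.

Let cW : cadlag W. Proof. by apply: cadlag_lin => //; case: fv. Qed.

Let rV w s : 0 <= s -> V x w @[x --> s^'+] --> V s w.
Proof. by move=> s0; have [] := cV w s0. Qed.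

Let rW w s : 0 <= s -> W x w @[x --> s^'+] --> W s w.
Proof. by move=> s0; have [] := cW w s0. Qed.

Let vE w s : 0 <= s -> v s w - v 0 w = V s w - W s w.
Proof. by move=> s0; case: fv => _ _ -> _; rewrite /W; lra. Qed.

Lemma cvg_integral_process w t : 0 <= t ->
  riemann_sum (D ^~ w) (v ^~ w) n t @[n --> \oo] --> integral_process t w.
Proof.
exact: (cvg_stieltjes_integral (@gc w) (@gb w) (@ndV w) (@ndW w) (@rV w) (@rW w) (@vE w)).
Qed.

Lemma integral_process0 w : integral_process 0 w = 0.
Proof.
exact: (stieltjes_integral0 (@gc w) (@gb w) (@ndV w) (@ndW w) (@rV w) (@rW w) (@vE w)).
Qed.

Let increment w t K s : (forall s, 0 <= s -> s <= t -> `|D s w| <= K) ->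
  0 <= s -> s <= t -> `|integral_process t w - integral_process s w| <=
    K * ((V t w + W t w) - (V s w + W s w)).
Proof.
exact: (stieltjes_integral_increment (@gc w) (@gb w) (@ndV w) (@ndW w) (@rV w) (@rW w) (@vE w)).
Qed.

Let av : adapted F v. Proof. by case: fv. Qed.

Lemma integral_process_adapted : adapted F integral_process.
Proof.
move=> t t0; apply: (measurable_wrt_cvg hF
  (f := fun n w => riemann_sum (D ^~ w) (v ^~ w) n t)) => // [n|w].
  have mclip X j : adapted F X -> measurable_wrt (F t) (X (clip n t j)).
    by move=> aX; apply: (measurable_wrt_mono hF _ _ (aX _ _)); rewrite ?clip_ge0 ?clip_le.
  apply: (measurable_wrt_sum hF) => // i; apply: (measurable_wrtM hF) => //.
    exact: mclip.
  by apply: (measurable_wrtB hF) => //; exact: mclip.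
exact: cvg_integral_process.
Qed.

(** In a Riemann sum the upper limit enters only through samples at [min s (grid n i)], each
    predictable in [s]; the integral is their pointwise limit. *)
Lemma integral_process_predictable : predictable F v -> predictable F integral_process.
Proof.
move=> pv; have pD := continuous_predictable aD cD.
apply: (@predictable_cvg _ _ _ _ (fun n t w => riemann_sum (D ^~ w) (v ^~ w) n t)).
  move=> n; apply: predictable_sum => i; apply: predictableM.
    by apply: (predictable_min hF) => //; exact: grid_ge0.
  have p1 : predictable F (fun s w => v (Num.min s (grid n i.+1)) w).
    by apply: (predictable_min hF) => //; exact: grid_ge0.
  have p2 : predictable F (fun s w => v (Num.min s (grid n i)) w).
    by apply: (predictable_min hF) => //; exact: grid_ge0.
  by apply: (predictable_ext (predictable_lin (-1) p1 p2)) => t w _; rewrite mulN1r.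
by move=> t w; exact: cvg_integral_process.
Qed.

(** With [K] a bound of [|D|] up to [t], adding [K (V + W)] makes the integral nondecreasing on
    [[0, t]]. Written as a difference of monotone functions, it has left limits and finite
    variation. *)
Let nd_shift w t K s r : (forall s, 0 <= s -> s <= t -> `|D s w| <= K) ->
  0 <= s -> s <= r -> r <= t ->
  integral_process s w + K * (V s w + W s w) <= integral_process r w + K * (V r w + W r w).
Proof.
move=> HK s0 sr rt; have := @increment w r K s (fun x x0 xr => HK x x0 (le_trans xr rt)) s0 sr.
by rewrite ler_norml => /andP[h _]; lra.
Qed.

Let K_ge0 w t K : 0 <= t -> (forall s, 0 <= s -> s <= t -> `|D s w| <= K) -> 0 <= K.
Proof. by move=> t0 /(_ t t0 (lexx t)); apply: le_trans. Qed.

Let nd_K w t K s r : 0 <= K -> 0 <= s -> s <= r -> r <= t ->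
  K * (V s w + W s w) <= K * (V r w + W r w).
Proof. by move=> K0 s0 sr rt; rewrite ler_wpM2l// lerD// ?ndV// ndW. Qed.

Lemma integral_process_cadlag : cadlag integral_process.
Proof.
move=> w t t0; split.
  have t1 : 0 <= t + 1 by rewrite addr_ge0.
  have [K HK] := @gb w (t + 1) t1.
  have K0 := K_ge0 t1 HK.
  apply/cvgrPdist_le => e e0.
  have rZ : V s w + W s w @[s --> t^'+] --> V t w + W t w.
    by apply: cvgD; [exact: rV|exact: rW].
  (* [K] may be 0, hence the division by [K + 1]; it bounds [|D|] on [[0, t + 1]] because a right
     limit looks beyond [t]. *)
  move/cvgrPdist_le : rZ => /(_ (e / (K + 1))) H.
  near=> s; have ts : t < s by near: s; exact: nbhs_right_gt.
  have s1 : s <= t + 1 by apply: ltW; near: s; apply: nbhs_right_lt; rewrite ltrDl.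
  rewrite distrC (le_trans (@increment w s K t (fun x x0 xs => HK x x0 (le_trans xs s1)) t0 (ltW ts)))//.
  have Hs : `|V t w + W t w - (V s w + W s w)| <= e / (K + 1).
    by near: s; apply: H; rewrite divr_gt0// ltr_pwDr.
  rewrite distrC in Hs; have Hs' := le_trans (ler_norm _) Hs.
  rewrite (le_trans (ler_wpM2l K0 Hs'))// mulrCA ler_piMr ?(ltW e0)//.
  by rewrite ler_pdivrMr ?mul1r ?lerDl// ltr_pwDr.
move=> tp; have [K HK] := @gb w t t0; have K0 := K_ge0 t0 HK.
have h1 := nondecreasing_left_limit (fun r s => @nd_shift w t K r s HK) tp.
have h2 := nondecreasing_left_limit (fun r s => @nd_K w t K r s K0) tp.
rewrite -[X in cvg (X @ _)](_ : (fun s => integral_process s w + K * (V s w + W s w))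
    - (fun s => K * (V s w + W s w)) = _); first exact: is_cvgB.
by apply/funext => s; rewrite fctE addrK.
Unshelve. all: by end_near. Qed.

Lemma integral_process_fv : finite_variation_process F integral_process.
Proof.
split; [exact: integral_process_adapted|exact: integral_process_cadlag|exact: integral_process0|].
move=> w t t0; have [K HK] := @gb w t t0; have K0 := K_ge0 t0 HK.
move: (t0); rewrite le_eqVlt => /predU1P[<-|tp]; first exact: bounded_variationxx.
rewrite (_ : (fun s => _) = (fun s => integral_process s w + K * (V s w + W s w))
   \+ (\- (fun s => K * (V s w + W s w)))); last by apply/funext => s /=; rewrite addrK.
apply: bounded_variationD => //.
  apply: nondecreasing_bounded_variation => x y; rewrite !in_itv/= => /andP[x0 xt] /andP[y0 yt] xy.
  exact: (nd_shift HK).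
apply/bounded_variationN; apply: nondecreasing_bounded_variation => x y.
rewrite !in_itv/= => /andP[x0 xt] /andP[y0 yt] xy.
exact: (nd_K _ K0 x0 xy yt).
Qed.

End integral_process.

(** * Integration by parts *)

Section martingale_transform.
Context {R : realType} {d : measure_display} {T : measurableType d}.
Variables (P : probability T R) (F : R -> set (set T)).
Hypothesis hF : usual_filtration P F.
Implicit Types (w : T) (s t p q : R) (Y : R -> T -> R) (xi : T -> R).

(** Rounding [xi] up to the grid yields a finite combination of indicators of events in [F p], for
    which the claim is the martingale identity. The rounding error is at most 1, so [K + 1] times
    the increment dominates. *)
Let multiplier_ge0 Y p q xi K : martingale P F Y -> 0 <= p -> p <= q ->
  measurable_wrt (F p) xi -> (forall w, 0 <= xi w <= K) ->
  expect P (fun w => xi w * (Y q w - Y p w)) = 0.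
Proof.
move=> /(martingaleP hF)[aY iY EY] p0 pq mxi xiK.
have q0 := le_trans p0 pq.
have xi0 w : 0 <= xi w by case/andP: (xiK w).
have LD : L1 P (fun w => Y q w - Y p w) by apply: L1B; exact: iY.
have mxi' : measurable_fun setT xi by exact: (measurable_wrt_measurable hF p0).
pose lev k j := [set w | grid_index k (xi w) = j].
have Flev k j : F p (lev k j).
  have Fle i : F p [set w | xi w <= grid k i] by exact: measurable_wrt_le.
  case: j => [|j].
    rewrite (_ : lev _ _ = [set w | xi w <= grid k 0]); first exact: Fle.
    apply/seteqP; split => w /=; rewrite -grid_index_le// leqn0; first by move=> ->.
    by move/eqP.
  rewrite (_ : lev _ _ = [set w | xi w <= grid k j.+1] `\` [set w | xi w <= grid k j]).
    by apply: (F_setD hF).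
  apply/seteqP; split => w /=; rewrite -!grid_index_le//.
    by move=> ->; rewrite leqnn ltnn.
  by case=> ? /negP; rewrite -ltnNge => ?; apply/eqP; rewrite eqn_leq; apply/andP.
have mlev k j : measurable (lev k j) by exact: (F_measurable hF p0).
pose N k := (grid_index k K).+1.
have xiE k w : rgrid k (xi w) = \sum_(j < N k) grid k j * \1_(lev k j) w.
  have h : (grid_index k (xi w) < N k)%N.
    by rewrite ltnS le_grid_index//; case/andP : (xiK w).
  rewrite (bigD1 (Ordinal h))//= big1 ?addr0; first by rewrite indicE mem_set// mulr1.
  move=> i /eqP ih; rewrite indicE memNset ?mulr0// => /= hi.
  by apply: ih; apply/val_inj.
have Llev k j : L1 P (fun w => grid k j * (Y q w * \1_(lev k j) w - Y p w * \1_(lev k j) w)).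
  by apply: L1Z; apply: L1B; apply: L1_indic => //; exact: iY.
have E0 k : expect P (fun w => rgrid k (xi w) * (Y q w - Y p w)) = 0.
  transitivity (expect P (fun w => \sum_(j < N k)
      grid k j * (Y q w * \1_(lev k j) w - Y p w * \1_(lev k j) w))).
    apply: eq_expect => w; rewrite xiE mulr_suml; apply: eq_bigr => j _; ring.
  rewrite expect_sum; last by move=> j; exact: Llev.
  rewrite big1// => j _; rewrite expectZ; last first.
    by apply: L1B; apply: L1_indic => //; exact: iY.
  rewrite expectB; [|by apply: L1_indic => //; exact: iY..].
  by rewrite (EY _ _ _ p0 pq (Flev k j)) subrr mulr0.
have mr k : measurable_fun setT (fun w => rgrid k (xi w)).
  under eq_fun do rewrite xiE.
  apply: measurable_sum => j; apply: measurable_funM; first exact: measurable_cst.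
  exact: measurable_indic.
have [] := @expect_dct _ _ _ P (fun k w => rgrid k (xi w) * (Y q w - Y p w))
    (fun w => xi w * (Y q w - Y p w)) (fun w => (K + 1) * `|Y q w - Y p w|).
- by move=> k; apply: measurable_funM; [exact: mr|exact: L1_measurable LD].
- by apply: L1Z; exact: L1_norm.
- by move=> w; apply: cvgM; [exact: cvg_rgrid|exact: cvg_cst].
- move=> k w; rewrite normrM ler_wpM2r//.
  rewrite ger0_norm ?grid_ge0// (le_trans (rgrid_le k (xi0 w)))// lerD//.
    by case/andP: (xiK w).
  by rewrite invf_le1// ler1n.
move=> _ h; apply: (cvg_unique _ h) => //.
apply: cvg_trans (_ : (fun=> 0) n @[n --> \oo] --> (0 : R)); last exact: cvg_cst.
by apply: near_eq_cvg; apply: nearW => k; rewrite E0.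
Qed.

(** Shifting by [K] makes the multiplier nonnegative, and the added constant contributes nothing
    because increments of a martingale are centred. *)
Lemma martingale_multiplier Y p q xi K : martingale P F Y -> 0 <= p -> p <= q ->
  measurable_wrt (F p) xi -> (forall w, `|xi w| <= K) ->
  expect P (fun w => xi w * (Y q w - Y p w)) = 0.
Proof.
move=> mY p0 pq mxi xiK; have q0 := le_trans p0 pq.
have [aY iY EY] := (martingaleP hF Y).1 mY.
have LD : L1 P (fun w => Y q w - Y p w) by apply: L1B; exact: iY.
have LK : L1 P (fun w => K * (Y q w - Y p w)) by exact: L1Z.
have mxi' : measurable_fun setT xi by exact: (measurable_wrt_measurable hF p0).
have Lxi : L1 P (fun w => xi w * (Y q w - Y p w)).
  apply: (L1_le _ LK).
    by apply: measurable_funM => //; exact: L1_measurable LD.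
  by move=> w; rewrite !normrM ler_wpM2r// (le_trans (xiK w))// ler_norm.
have mxiK : measurable_wrt (F p) (fun w => xi w + K).
  by apply: (measurable_wrtD hF) => //; exact: (measurable_wrt_cst hF).
have h1 := @multiplier_ge0 Y p q _ (K + K) mY p0 pq mxiK (fun w => _).
have {}h1 : expect P (fun w => (xi w + K) * (Y q w - Y p w)) = 0.
  by apply: h1 => w; have := xiK w; rewrite ler_norml => /andP[? ?]; apply/andP; split; lra.
have h2 : expect P (fun w => K * (Y q w - Y p w)) = 0.
  rewrite expectZ// expectB; [|exact: iY..].
  have E z : expect P (fun w => Y z w * \1_setT w) = expect P (Y z).
    by apply: eq_expect => w; rewrite indicE in_setT mulr1.
  by have := EY _ _ setT p0 pq (F_setT hF p0); rewrite !E => ->; rewrite subrr mulr0.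
have := h1; under eq_expect do rewrite mulrDl.
by rewrite expectD// h2 addr0.
Qed.

(** One term of a discrete stochastic integral over []c, e]]. Whatever the order of [c], [e], [s]
    and [t], the two sides differ by [xi] on [B] times an increment of [Y] that is zero or starts
    after both [c] and [s]; [xi] and [B] are then known at its start. *)
Lemma martingale_transform_step Y xi K (c e s t : R) B : martingale P F Y ->
  0 <= c -> c <= e -> measurable_wrt (F c) xi -> (forall w, `|xi w| <= K) ->
  0 <= s -> s <= t -> F s B ->
  expect P (fun w => xi w * (Y (Num.min t e) w - Y (Num.min t c) w) * \1_B w) =
  expect P (fun w => xi w * (Y (Num.min s e) w - Y (Num.min s c) w) * \1_B w).
Proof.
move=> mY c0 ce mxi xiK s0 st FB; have t0 := le_trans s0 st.
have [aY iY EY] := (martingaleP hF Y).1 mY.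
have K0 w : 0 <= K by apply: le_trans (xiK w).
have zero (p q : R) (f : T -> R) : c <= p -> s <= p -> p <= q ->
    (forall w, f w = xi w * \1_B w * (Y q w - Y p w)) -> expect P f = 0.
  move=> cp sp pq fE; rewrite (eq_expect _ fE).
  apply: (@martingale_multiplier Y p q (fun w => xi w * \1_B w) K) => //.
  - exact: le_trans cp.
  - apply: (measurable_wrtM hF); first exact: le_trans cp.
      exact: (measurable_wrt_mono hF c0 cp).
    apply: (measurable_wrt_indic hF); first exact: le_trans cp.
    exact: (F_mono hF s0 sp FB).
  - move=> w; rewrite normrM indicE; case: (w \in B); rewrite /= ?normr1 ?normr0 ?mulr1// mulr0.
    exact: K0.
have [tc|] := boolP (t <= c).
  have sc := le_trans st tc.
  rewrite !min_l// ?(le_trans sc)// ?(le_trans tc)//.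
  by apply: eq_expect => w; rewrite !subrr !mulr0.
rewrite -ltNge => ct; rewrite [Num.min t c]min_r; last exact: ltW.
have [sc|] := boolP (s <= c).
  rewrite [Num.min s c]min_l// [Num.min s e]min_l; last exact: le_trans ce.
  transitivity (0 : R).
    apply: (zero c (Num.min t e)) => //; first by rewrite le_min ce ltW.
    by move=> w; ring.
  apply/esym; rewrite -(expect0 P); apply: eq_expect => w.
  by rewrite subrr mulr0 mul0r.
rewrite -ltNge => cs; rewrite [Num.min s c]min_r; last exact: ltW.
have [es|] := boolP (e <= s).
  by rewrite !min_r//; exact: le_trans st.
rewrite -ltNge => se; rewrite [Num.min s e]min_l; last exact: ltW.
have Lxi p q : 0 <= p -> 0 <= q -> L1 P (fun w => xi w * (Y q w - Y p w) * \1_B w).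
  move=> p0 q0; apply: L1_indic; first exact: (F_measurable hF s0).
  have LK : L1 P (fun w => K * (Y q w - Y p w)) by apply: L1Z; apply: L1B; exact: iY.
  apply: (L1_le _ LK).
    apply: measurable_funM; first exact: (measurable_wrt_measurable hF c0).
    by apply: L1_measurable; apply: L1B; exact: iY.
  by move=> w; rewrite !normrM ler_wpM2r// (le_trans (xiK w))// ler_norm.
have e0 := le_trans c0 ce.
apply/eqP; rewrite -subr_eq0 -expectB; [|by apply: Lxi; rewrite ?le_min ?t0..|exact: Lxi].
apply/eqP; apply: (zero s (Num.min t e)) => //; first exact: ltW.
  by rewrite le_min st ltW.
by move=> w; ring.
Qed.

End martingale_transform.

Lemma summation_by_parts (R : comRingType) (a b : nat -> R) N :
  \sum_(0 <= i < N) a i * (b i.+1 - b i) =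
  a N * b N - a 0%N * b 0%N - \sum_(0 <= i < N) b i.+1 * (a i.+1 - a i).
Proof.
elim: N => [|N ih]; first by rewrite !big_nil subrr subr0.
rewrite !big_nat_recr//= ih; ring.
Qed.

(** The differences are moved onto the monotone [p] and [q], so the bound does not depend on [N]:
    each of the two boundary terms is at most [c^2], and the total variation of [p - q] is at most
    [2 c], against factors bounded by [c]. *)
Lemma summation_by_parts_le (R : realFieldType) (p q b : nat -> R) c N :
  (forall i, 0 <= p i <= c) -> (forall i, 0 <= q i <= c) ->
  (forall i, p i <= p i.+1) -> (forall i, q i <= q i.+1) -> (forall i, `|b i| <= c) ->
  `|\sum_(0 <= i < N) (p i - q i) * (b i.+1 - b i)| <= 4 * c ^+ 2.
Proof.
move=> pc qc pnd qnd bc.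
have c0 : 0 <= c by rewrite (le_trans _ (bc 0%N)).
rewrite (summation_by_parts (fun i => p i - q i)).
have ac i : `|p i - q i| <= c.
  by have /andP[? ?] := pc i; have /andP[? ?] := qc i; rewrite ler_norml; apply/andP; split; lra.
have abc i : `|(p i - q i) * b i| <= c ^+ 2.
  by rewrite normrM expr2 ler_pM.
have h : `|\sum_(0 <= i < N) b i.+1 * (p i.+1 - q i.+1 - (p i - q i))| <= c * (c + c).
  apply: (@le_trans _ _ (\sum_(0 <= i < N) c * ((p i.+1 - p i) + (q i.+1 - q i)))).
    apply: (le_trans (ler_norm_sum _ _ _)); apply: ler_sum => i _.
    rewrite normrM ler_pM//.
    have := pnd i; have := qnd i => h1 h2; rewrite ler_norml; apply/andP; split; lra.
  rewrite -mulr_sumr big_split/= !telescope_sumr// ler_wpM2l//.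
  have /andP[? ?] := pc N; have /andP[? ?] := qc N.
  have /andP[? ?] := pc 0%N; have /andP[? ?] := qc 0%N; lra.
apply: (le_trans (ler_normB _ _)); apply: (le_trans (lerD (ler_normB _ _) h)).
have := abc N; have := abc 0%N; move: h; rewrite !expr2 mulrDr => *; lra.
Qed.

Section integration_by_parts.
Context {R : realType} {d : measure_display} {T : measurableType d}.
Variables (P : probability T R) (F : R -> set (set T)).
Hypothesis hF : usual_filtration P F.
Variables D v : R -> T -> R.
Hypothesis mD : martingale P F D.
Hypothesis cD : continuous_process D.
Hypothesis fv : finite_variation_process F v.
Implicit Types (w : T) (s t : R).

Let aD : adapted F D. Proof. by case: mD. Qed.

Let V := variation_process v.
Let W t w := V t w + -1 * v t w.
(** A process dominating [V], [W] and the running supremum of [|D|], so that one hitting time keeps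
    all three below [c] strictly before it. *)
Let Z t w := V t w + 1 * W t w + 1 * running_sup D t w.

Let V0 w t : 0 <= t -> 0 <= V t w.
Proof. by move=> t0; rewrite (le_trans _ (norm_le_variation_process fv w t0)). Qed.

Let W0 w t : 0 <= t -> 0 <= W t w.
Proof.
move=> t0; have := norm_le_variation_process fv w t0.
by rewrite /W ler_norml => /andP[? ?]; rewrite /V; lra.
Qed.

Let ndV : nondecreasing_process V. Proof. exact: (variation_process_nd fv). Qed.

Let ndW : nondecreasing_process W. Proof. exact: (variation_process_sub_nd fv). Qed.

Let aV : adapted F V. Proof. exact: (variation_process_adapted hF fv). Qed.

Let aW : adapted F W. Proof. by apply: (adapted_lin hF) => //; case: fv. Qed.

Let aZ : adapted F Z.
Proof.
apply: (adapted_lin hF); first exact: (adapted_lin hF).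
exact: (running_sup_adapted hF aD cD).
Qed.

Let ndZ : nondecreasing_process Z.
Proof.
move=> w s t s0 st; have h1 := ndV w s0 st; have h2 := ndW w s0 st.
by have h3 := running_sup_nd cD w s0 st; rewrite /Z; lra.
Qed.

Let L t w := v t w * D t w + -1 * integral_process D v t w.

Let aL : adapted F L.
Proof.
apply: (adapted_lin hF); last exact: (integral_process_adapted hF).
by apply: (adaptedM hF) => //; case: fv.
Qed.

Let cL : cadlag L.
Proof.
apply: cadlag_lin; last exact: (integral_process_cadlag cD fv).
by apply: cadlagM; [case: fv|exact: continuous_process_cadlag].
Qed.

Section localized.
Variable c : R.
Hypothesis c0 : 0 <= c.
Let tau := hitting_time Z c.

Let htau : stopping_time F tau. Proof. exact: (hitting_time_stopping hF _ aZ ndZ). Qed.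

Let tau0 w : (0 <= tau w)%E. Proof. exact: hitting_time_ge0. Qed.

Let Z_lt w s : 0 <= s -> (s%:E < tau w)%E -> [/\ V s w < c, W s w < c & `|D s w| < c].
Proof.
move=> s0 st; have := hitting_time_lt s0 st; have := V0 w s0; have := W0 w s0.
have := running_sup_ge cD w s0 (lexx s); rewrite /Z !mul1r => h1 h2 h3 h4.
have h5 : 0 <= `|D s w| by [].
by split; lra.
Qed.

Let Y := stopped D tau.

Let mY : martingale P F Y.
Proof. by apply: (martingale_stopped hF) => //; exact: continuous_process_cadlag. Qed.

(** Before [tau] the bound is that of [Z]; continuity of [D] carries it to [tau] itself. *)
Let Y_le w s : 0 <= s -> `|Y s w| <= c.
Proof.
move=> s0; rewrite /Y stoppedE; case: ifPn => [tp|_]; last by rewrite normr0.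
have r0 : 0 <= cap tau s w by exact: cap_ge0.
have [h|h] := boolP ((cap tau s w)%:E < tau w)%E.
  by apply: ltW; case: (Z_lt r0 h).
have rp : 0 < cap tau s w.
  by rewrite -leNgt in h; rewrite -lte_fin (lt_le_trans tp).
have cl : `|D (lgrid n (cap tau s w)) w| @[n --> \oo] --> `|D (cap tau s w) w|.
  apply: cvg_norm; apply: (@continuous_process_cvg _ _ _ D w (cap tau s w) (fun n => lgrid n (cap tau s w))) => //.
    by move=> n; exact: lgrid_ge0.
  exact: cvg_lgrid.
have rt : ((cap tau s w)%:E <= tau w)%E by rewrite capE// ge_min lexx orbT.
have ccl : cvg (`|D (lgrid n (cap tau s w)) w| @[n --> \oo]).
  by apply/cvg_ex; exists (`|D (cap tau s w) w|).
rewrite -(cvg_lim _ cl)//; apply: limr_le => //.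
apply: nearW => n; apply: ltW.
have h' : ((lgrid n (cap tau s w))%:E < tau w)%E by rewrite (lt_le_trans _ rt)// lte_fin lgrid_lt.
by case: (Z_lt (lgrid_ge0 n _) h').
Qed.

(* Equal to [v t] before [tau], and bounded at all times. *)
Let vc t w := Num.min (V t w) c - Num.min (W t w) c.

Let vc_le t w : 0 <= t -> `|vc t w| <= c.
Proof.
move=> t0; have h1 : 0 <= Num.min (V t w) c by rewrite le_min V0.
have h2 : 0 <= Num.min (W t w) c by rewrite le_min W0.
have h3 : Num.min (V t w) c <= c by rewrite ge_min lexx orbT.
have h4 : Num.min (W t w) c <= c by rewrite ge_min lexx orbT.
by rewrite /vc ler_norml; apply/andP; split; lra.
Qed.

(** The discrete integral of [vc] against the stopped [D]. The coefficients are read at unclipped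
    grid times, which do not depend on [t], so that each term is a martingale in [t]. *)
Let transform n t w :=
  \sum_(0 <= i < gsize n) vc (grid n i) w * (Y (clip n t i.+1) w - Y (clip n t i) w).

Let transform_clip n t w : 0 <= t -> transform n t w =
  \sum_(0 <= i < gsize n) vc (clip n t i) w * (Y (clip n t i.+1) w - Y (clip n t i) w).
Proof.
move=> t0; apply: eq_bigr => i _; have [h|] := boolP (grid n i <= t).
  by congr (vc _ w * _); rewrite /clip min_r.
rewrite -ltNge => /ltW h; rewrite /clip [Num.min t (grid n i)]min_l//.
by rewrite min_l ?subrr ?mulr0// (le_trans h)// le_grid.
Qed.

Let transform_le n t w : 0 <= t -> `|transform n t w| <= 4 * c ^+ 2.
Proof.
move=> t0; rewrite transform_clip//.
apply: (@summation_by_parts_le _ (fun i => Num.min (V (clip n t i) w) c)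
  (fun i => Num.min (W (clip n t i) w) c) (fun i => Y (clip n t i) w)) => i.
- by rewrite le_min c0 (V0 w (clip_ge0 _ _ t0)) ge_min lexx orbT.
- by rewrite le_min c0 (W0 w (clip_ge0 _ _ t0)) ge_min lexx orbT.
- by rewrite le_min !ge_min lexx orbT ndV ?clip_ge0// le_clip.
- by rewrite le_min !ge_min lexx orbT ndW ?clip_ge0// le_clip.
- by apply: Y_le; rewrite clip_ge0.
Qed.

(** Summation by parts turns the transform into a boundary term [v D] minus a Riemann sum of [D]
    against [v], and the latter converges to the Stieltjes integral. *)
Let cvg_transform t w : 0 <= t -> transform n t w @[n --> \oo] --> stopped L tau t w.
Proof.
move=> t0; rewrite stoppedE; case: ifPn => tw; last first.
  rewrite (_ : (fun n => transform n t w) = fun=> 0); first exact: cvg_cst.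
  apply/funext => n; rewrite /transform big1// => i _.
  by rewrite /Y !stoppedE (negbTE tw) subrr mulr0.
set r := cap tau t w; have r0 : 0 <= r by exact: cap_ge0.
have vD w' : v 0 w' = 0 by case: fv.
have YE n i : Y (clip n t i) w = D (clip n r i) w.
  rewrite /Y stoppedE tw; congr (D _ w); apply: (@EFin_inj R).
  by rewrite capE// /clip !EFin_min /r capE// minAC.
have E n : transform n t w = v (clip n r (gsize n)) w * D (clip n r (gsize n)) w -
    riemann_sum (D ^~ w) (v ^~ w) n r.
  rewrite /riemann_sum; transitivity (\sum_(0 <= i < gsize n)
      v (clip n r i) w * (D (clip n r i.+1) w - D (clip n r i) w)).
    (* A cell starting at or after [r] has no increment. The others start strictly before [tau],
       where the caps in [vc] are inactive and [vc] equals [v], so a jump at [tau] is never seen. *)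
    apply: eq_bigr => i _; rewrite !YE; have [h|] := boolP (grid n i < r).
      have hi : ((grid n i)%:E < tau w)%E.
        by rewrite (@lt_le_trans _ _ r%:E) ?lte_fin// /r capE// ge_min lexx orbT.
      have [h1 h2 _] := Z_lt (grid_ge0 n i) hi.
      congr (_ * _); rewrite /vc !min_l ?(ltW h1) ?(ltW h2)// /clip min_r ?(ltW h)//.
      by rewrite /W; lra.
    rewrite -leNgt => h; rewrite /clip [Num.min r (grid n i)]min_l//.
    by rewrite min_l ?subrr ?mulr0// (le_trans h)// le_grid.
  rewrite (summation_by_parts (fun i => v (clip n r i) w) (fun i => D (clip n r i) w)).
  by rewrite clip0// vD mul0r subr0.
under eq_fun do rewrite E.
rewrite /L mulN1r; apply: cvgB; last exact: (cvg_integral_process cD fv).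
apply: cvg_trans (_ : (fun=> v r w * D r w) n @[n --> \oo] --> v r w * D r w); last exact: cvg_cst.
by apply: near_eq_cvg; near=> n; have -> : clip n r (gsize n) = r by near: n; exact: clip_gsize_near.
Unshelve. all: by end_near. Qed.

Let aY : adapted F Y. Proof. by case: mY. Qed.

Let mvc s : 0 <= s -> measurable_wrt (F s) (vc s).
Proof.
move=> s0; have sF := F_sigma hF s0; apply/(measurable_wrtP _ sF).
have /(measurable_wrtP _ sF) m1 := aV s0; have /(measurable_wrtP _ sF) m2 := aW s0.
by apply: measurable_funB; apply: measurable_minr.
Qed.

Let measurable_transform n t : 0 <= t -> measurable_fun setT (transform n t).
Proof.
move=> t0; apply: measurable_sum => i; apply: measurable_funM.
  by apply: (measurable_wrt_measurable hF (grid_ge0 n i)); exact: mvc (grid_ge0 n i).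
by apply: measurable_funB; apply: (adapted_measurable hF aY); rewrite clip_ge0.
Qed.

Let transform_martingale n s t B : 0 <= s -> s <= t -> F s B ->
  expect P (fun w => transform n t w * \1_B w) = expect P (fun w => transform n s w * \1_B w).
Proof.
move=> s0 st FB; have t0 := le_trans s0 st; have mB := F_measurable hF s0 FB.
have [_ iY _] := (martingaleP hF Y).1 mY.
have Lt r i : 0 <= r -> L1 P (fun w => vc (grid n i) w * (Y (clip n r i.+1) w - Y (clip n r i) w) * \1_B w).
  move=> r0; apply: L1_indic => //.
  have LK : L1 P (fun w => c * (Y (clip n r i.+1) w - Y (clip n r i) w)).
    by apply: L1Z; apply: L1B; apply: iY; rewrite clip_ge0.
  apply: (L1_le _ LK).
    apply: measurable_funM.
      by apply: (measurable_wrt_measurable hF (grid_ge0 n i)); exact: mvc (grid_ge0 n i).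
    by apply: measurable_funB; apply: (adapted_measurable hF aY); rewrite clip_ge0.
  move=> w; rewrite !normrM ler_wpM2r// (le_trans (vc_le w (grid_ge0 n i)))//.
  exact: ler_norm.
have E r : 0 <= r -> expect P (fun w => transform n r w * \1_B w) =
   \sum_(i < gsize n) expect P (fun w => vc (grid n i) w * (Y (clip n r i.+1) w - Y (clip n r i) w) * \1_B w).
  move=> r0; rewrite -expect_sum; last by move=> i; exact: Lt.
  by apply: eq_expect => w; rewrite /transform big_mkord mulr_suml.
rewrite (E t t0) (E s s0); apply: eq_bigr => i _.
apply: (@martingale_transform_step _ _ _ _ _ hF Y (vc (grid n i)) c) => //.
- exact: grid_ge0.
- by rewrite le_grid.
- exact: mvc (grid_ge0 n i).
- by move=> w; apply: vc_le (grid_ge0 n i).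
Qed.

Lemma stopped_integration_by_parts : martingale P F (stopped L tau).
Proof.
have muT := P_fin P.
have Lc (k : R) : L1 P (fun=> k).
  by apply: (@L1_bounded _ _ _ _ _ _ `|k|) => //; exact: measurable_cst.
have K t n B : 0 <= t -> measurable B -> measurable_fun setT (fun w => transform n t w * \1_B w).
  by move=> t0 mB; apply: measurable_funM; [exact: measurable_transform|exact: measurable_indic].
have lim t B : 0 <= t -> measurable B -> L1 P (fun w => stopped L tau t w * \1_B w) /\
    expect P (fun w => transform n t w * \1_B w) @[n --> \oo] -->
    expect P (fun w => stopped L tau t w * \1_B w).
  move=> t0 mB; apply: (@expect_dct _ _ _ P _ _ (fun=> 4 * c ^+ 2)).
  - by move=> n; exact: K.
  - exact: Lc.
  - by move=> w; apply: cvgM; [exact: cvg_transform|exact: cvg_cst].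
  - move=> n w; rewrite normrM (le_trans _ (transform_le n w t0))// ler_piMr//.
    by rewrite indicE; case: (w \in B); rewrite /= ?normr1 ?normr0.
apply/(martingaleP hF); split.
- exact: (stopped_adapted hF aL cL htau).
- move=> t t0; have [h _] := lim t setT t0 measurableT.
  by move: h; congr (L1 P); apply/funext => w; rewrite indicE in_setT mulr1.
- move=> s t B s0 st FB; have t0 := le_trans s0 st; have mB := F_measurable hF s0 FB.
  have [_ h1] := lim t B t0 mB; have [_ h2] := lim s B s0 mB.
  have EE : (fun n => expect P (fun w => transform n t w * \1_B w)) =
      (fun n => expect P (fun w => transform n s w * \1_B w)).
    by apply/funext => n; exact: transform_martingale.
  by move: h1; rewrite EE => h1; exact: (cvg_unique _ h1 h2).
Qed.

End localized.

Lemma integration_by_parts_local_martingale :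
  local_martingale P F (fun t w => v t w * D t w + -1 * integral_process D v t w).
Proof.
split; [exact: aL|exact: cL|exists (fun n => hitting_time Z n%:R)]; split.
- by move=> n; exact: (hitting_time_stopping hF).
- by move=> w; exact: hitting_time_nd.
- by apply: aeW => w; exact: hitting_time_cvg.
- by move=> n; exact: stopped_integration_by_parts.
Qed.

End integration_by_parts.

(** * Density process, bracket and conclusion *)

Section density.
Context {R : realType} {d : measure_display} {T : measurableType d}.
Variables (P : probability T R) (F : R -> set (set T)).
Hypothesis hF : usual_filtration P F.
Implicit Types (X Y Z v : R -> T -> R) (w : T) (s t : R).

(** For an event of [F s], both sides of the martingale identity equal [Q A]. *)
Lemma density_process_martingale (Q : {charge set T -> \bar R}) D :
  density_process P F Q D -> martingale P F D.
Proof.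
move=> [aD hD]; split => //; first by move=> t t0; case: (hD t t0).
move=> s t A s0 st FA; have t0 := le_trans s0 st.
have [_ hs] := hD s s0; have [_ ht] := hD t t0.
by rewrite -(hs A FA) -(ht A (F_mono hF s0 st FA)).
Qed.

Lemma eq_cadlag X Y : cadlag X -> (forall t w, 0 <= t -> X t w = Y t w) -> cadlag Y.
Proof.
move=> cX XY w t t0; have [Xr Xl] := cX w t t0; split.
  rewrite -XY//; apply: cvg_trans Xr; apply: near_eq_cvg; near=> s.
  by apply: XY; rewrite (le_trans t0)//; apply: ltW; near: s; exact: nbhs_right_gt.
move=> tp; have /cvg_ex[l Xl'] := Xl tp; apply/cvg_ex; exists l.
apply: cvg_trans Xl'; apply: near_eq_cvg; near=> s.
by apply: XY; near: s; exact: nbhs_left_ge.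
Unshelve. all: by end_near. Qed.

Lemma eq_adapted X Y : adapted F X -> (forall t w, 0 <= t -> X t w = Y t w) -> adapted F Y.
Proof.
move=> aX XY t t0; rewrite (_ : Y t = X t); first exact: aX.
by apply/funext => w; rewrite XY.
Qed.

Lemma eq_local_martingale X Y : local_martingale P F X ->
  (forall t w, 0 <= t -> X t w = Y t w) -> local_martingale P F Y.
Proof.
move=> lX XY; have [aX cX _] := lX; apply: (local_martingale_indistinguishable hF lX).
- exact: eq_adapted XY.
- exact: eq_cadlag XY.
- by apply: aeW => w t t0; exact: XY.
Qed.

(** The process [v' - v] is predictable of finite variation and equals [m - m'], a local martingale;
    hence it vanishes. *)
Lemma canonical_decomposition_unique X m v m' v' :
  canonical_decomposition P F X m v -> canonical_decomposition P F X m' v' ->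
  {ae P, forall w, forall t, 0 <= t -> m' t w = m t w}.
Proof.
move=> [lm fv pv Xm] [lm' fv' pv' Xm'].
have lA : local_martingale P F (fun t w => v' t w - v t w).
  apply: (eq_local_martingale (local_martingale_lin hF (-1) lm lm')) => t w t0.
  by have := Xm t w t0; rewrite (Xm' t w t0) => h; lra.
have pA : predictable F (fun t w => v' t w - v t w).
  by apply: (predictable_ext (predictable_lin (-1) pv' pv)) => t w _; rewrite mulN1r.
apply: filterS (predictable_local_martingale_zero hF (finite_variation_processB hF fv' fv) pA lA).
move=> w h t t0; have := Xm t w t0; rewrite (Xm' t w t0); have := h t t0; lra.
Qed.

(** The bracket comes with some decompositions of [X] and [D]. By uniqueness their martingale parts
    are indistinguishable from [m] and from [D] itself, the latter decomposed as [D + 0]. *)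
Lemma martingale_bracket D m C X : martingale P F D -> continuous_process D ->
  angle_bracket P F X D C -> (exists v, canonical_decomposition P F X m v) ->
  local_martingale P F (fun t w => m t w * D t w + -1 * C t w).
Proof.
move=> mD cD [m' [v' [n [w0 [dX dD fC pC lC]]]]] [v dXm].
have lD := martingale_local_martingale hF (continuous_process_cadlag cD) mD.
have fz : finite_variation_process F (fun _ _ => 0 : R).
  split => //.
  - by move=> t t0; exact: (measurable_wrt_cst hF).
  - by move=> w t t0; split; [exact: cvg_cst|move=> _; exact: is_cvg_cst].
  - move=> w t t0; apply: nondecreasing_bounded_variation => x y; by [].
have dD' : canonical_decomposition P F D D (fun _ _ => 0).
  by split => //; [exact: predictable_cst|move=> t w _; rewrite addr0].
have En := canonical_decomposition_unique dD dD'.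
have Em := canonical_decomposition_unique dX dXm.
have [aC cC _ _] := fC; have [[am cm _] _ _ _] := dXm; have [aD cadD _] := lD.
apply: (local_martingale_indistinguishable hF lC).
- by apply: (adapted_lin hF) => //; exact: (adaptedM hF).
- by apply: cadlag_lin => //; exact: cadlagM.
- by apply: filterS2 En Em => w En Em t t0; rewrite En// Em// mulN1r.
Qed.

End density.

Theorem proposition6 (R : realType) (d : measure_display)
    (T : measurableType d) (P : probability T R)
    (Q : {charge set T -> \bar R}) (F : R -> set (set T))
    (D : R -> T -> R) (Dinf : T -> R) (M m v C : R -> T -> R)
    (hQP : Q `<< P)
    (hF : usual_filtration P F)
    (hD : density_process P F Q D)
    (hDcont : continuous_process D)
    (hDlim : {ae P, forall w, D t w @[t --> +oo] --> Dinf w})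
    (hDinf : {ae P, forall w, Dinf w != 0})
    (hM : canonical_decomposition P F M m v)
    (hC : angle_bracket P F M D C) :
  QP_local_martingale P F D M <->
  {ae P, forall w, forall t, 0 <= t ->
    stieltjes_integral (fun s => D s w) (fun s => v s w) t + C t w = 0}.
Proof.
have mD := density_process_martingale hF hD.
have lmDC := martingale_bracket hF mD hDcont hC (ex_intro _ v hM).
have [lm fv pv ME] := hM.
have [fC pC] : finite_variation_process F C /\ predictable F C.
  by case: hC => [? [? [? [? []]]]].
have [aD _ _] := mD; have cD := continuous_process_cadlag hDcont.
have lvD := integration_by_parts_local_martingale hF mD hDcont fv.
pose A t w := integral_process D v t w + C t w.
have fA : finite_variation_process F A.
  exact: (finite_variation_processD hF (integral_process_fv hF aD hDcont fv) fC).
have pA : predictable F A.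
  have pI := integral_process_predictable hF aD hDcont fv pv.
  by apply: (predictable_ext (predictable_lin 1 pI pC)) => t w _; rewrite mul1r.
have lN := local_martingale_lin hF 1 lmDC lvD.
have MDE t w : 0 <= t -> m t w * D t w + -1 * C t w +
    1 * (v t w * D t w + -1 * integral_process D v t w) = M t w * D t w - A t w.
  by move=> t0; rewrite (ME t w t0) /A; ring.
split => [[_ lMD]|A0].
- apply: (predictable_local_martingale_zero hF fA pA).
  apply: (eq_local_martingale hF (local_martingale_lin hF (-1) lMD lN)) => t w t0.
  by rewrite MDE//; ring.
- split; first by exists m, v.
  have [[am cm _] [av cv _ _]] := (lm, fv).
  (* [M] is constrained only through its decomposition at nonnegative times, so adaptedness and path
     regularity of [M D] are read off from [m + v]. *)
  have Meq t w : 0 <= t -> (m t w + 1 * v t w) * D t w = M t w * D t w.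
    by move=> t0; rewrite ME// mul1r.
  apply: (local_martingale_indistinguishable hF lN).
  + by apply: (eq_adapted _ Meq); apply: (adaptedM hF) => //; exact: (adapted_lin hF).
  + by apply: (eq_cadlag _ Meq); apply: cadlagM => //; exact: cadlag_lin.
  + by apply: filterS A0 => w A0 t t0; rewrite MDE// [A t w](A0 t t0) subr0.
Qed.
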